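(* Let $\mathfrak g$ be a simple finite-dimensional Lie algebra over $\mathbb C$ of rank $n$, let $\mathfrak n$ be its maximal nilpotent subalgebra with basis $\{e_\beta\}_{\beta\in R^+}$ and dual basis $\{f^\beta\}_{\beta\in R^+}$, and for $i=1,\dots,n$ put $$c_i=\sum_{\alpha\in R^+}A_i(\alpha)\,e_\alpha\otimes f^\alpha,\qquad b_i=e_{\gamma_i}\otimes f^{\alpha_i},\quad \gamma_i=\mu-m_i\alpha_i .$$ (1) If $\mathfrak g\neq\mathfrak{sl}(2)$, then $\dim H^1(\mathfrak n;\mathfrak n)=2n$, and the (classes of the) cocycles $c_1,\dots,c_n,b_1,\dots,b_n$ form a basis of $H^1(\mathfrak n;\mathfrak n)$. (2) If $\mathfrak g\neq\mathfrak{sl}(2),\mathfrak{sl}(3)$, then in the Lie algebra $\mathfrak l_0=\Pi(H^1(\mathfrak n;\mathfrak n))$ one has, for all $i,j=1,\dots,n$, $$[c_i,c_j]=[b_i,b_j]=0,\qquad [c_i,b_j]=w_i(b_j)\,b_j,$$ where $w(b)=(w_1(b),\dots,w_n(b))$ is the weight of the cochain $b$.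
   Context: Ground field $\mathbb C$. $R^+$ is the set of positive roots of $\mathfrak g$ (with respect to a fixed Cartan subalgebra and simple roots $\alpha_1,\dots,\alpha_n$), and $\mathfrak n=\bigoplus_{\beta\in R^+}\mathfrak g_\beta$ is the maximal nilpotent subalgebra. $\{e_\beta\}_{\beta\in R^+}$ is the basis of $\mathfrak n$ formed by the root vectors of a Chevalley basis of $\mathfrak g$, and $\{f^\beta\}$ is the dual basis of $\mathfrak n^*$. Every $\alpha\in R^+$ (more generally every weight) is written $\alpha=\sum_i A_i(\alpha)\alpha_i$. $\mu$ is the maximal root, and $m_i=\max\{m\in\mathbb Z_{\ge 0}\mid \mu-k\alpha_i\in R^+\text{ for all }k=0,1,\dots,m\}$. $C^k=C^k(\mathfrak n;\mathfrak n)=\mathfrak n\otimes\Lambda^k\mathfrak n^*$ are the cochains with adjoint coefficients, with the Chevalley–Eilenberg differential $d$; $H^k=H^k(\mathfrak n;\mathfrak n)$ is the cohomology. The weight of $e_\gamma\otimes f^{\beta_1}\wedge\dots\wedge f^{\beta_k}$ is $\gamma-\beta_1-\dots-\beta_k$, written as its vector of coordinates in the basis $\alpha_1,\dots,\alpha_n$. Bracket: for monomials $a=e_\alpha\otimes f^{\beta_1}\wedge\dots\wedge f^{\beta_p}$ and $b=e_{\alpha'}\otimes f^{\beta'_1}\wedge\dots\wedge f^{\beta'_q}$ put $$a\cdot b=\sum_{k=1}^{p}(-1)^{p-k}f^{\beta_k}(e_{\alpha'})\,e_\alpha\otimes f^{\beta_1}\wedge\dots\wedge\widehat{f^{\beta_k}}\wedge\dots\wedge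 f^{\beta_p}\wedge f^{\beta'_1}\wedge\dots\wedge f^{\beta'_q},$$ extended bilinearly, and $[a,b]=a\cdot b-(-1)^{(p-1)(q-1)}b\cdot a$. This makes $\Pi(C^{\bullet+1})$ ($\Pi$ is the change of parity; $C^{k+1}$ is placed in degree $k$ and has parity $k \bmod 2$) a differential graded Lie superalgebra, hence induces a Lie superalgebra structure on $\mathfrak l_\bullet$, $\mathfrak l_k=\Pi(H^{k+1})$; in particular $\mathfrak l_0=\Pi(H^1)$ is a Lie algebra. Cocycles are identified with their classes. *)

(* Defs.v *)
From HB Require Import structures.
From mathcomp Require Import all_boot all_order all_algebra.
From mathcomp Require Import finmap reals complex.

Set Implicit Arguments.
Unset Strict Implicit.
Unset Printing Implicit Defensive.

Import Order.TTheory GRing.Theory Num.Theory.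

Local Open Scope ring_scope.

HB.mixin Record isLie (K : fieldType) L of Vector K L := {
  lie : L -> L -> L;
  lie_is_linearl : forall y, linear (fun x => lie x y);
  lie_is_linearr : forall x, linear (lie x);
  liexx : forall x, lie x x = 0;
  lie_jacobi : forall x y z,
    lie x (lie y z) + lie y (lie z x) + lie z (lie x y) = 0
}.

#[short(type="lieAlgType")]
HB.structure Definition LieAlgebra (K : fieldType) :=
  {L of isLie K L & Vector K L}.

Section LieAlgebra.
Variables (K : fieldType) (L : lieAlgType K).
Implicit Types (x y : L) (U V : {vspace L}).

HB.instance Definition _ x :=
  GRing.isLinear.Build K L L _ (lie x) (lie_is_linearr x).

Definition ad x : 'End(L) := linfun (lie x).

Lemma adE x y : ad x y = lie x y.
Proof. exact: lfunE. Qed.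

Fact ad_is_linear : linear ad.
Proof.
move=> a x y; apply/lfunP => z; rewrite add_lfunE scale_lfunE !adE.
exact: lie_is_linearl.
Qed.

HB.instance Definition _ := GRing.isLinear.Build K L 'End(L) _ ad ad_is_linear.

Lemma lieDl x y z : lie (x + y) z = lie x z + lie y z.
Proof. by rewrite -!adE linearD add_lfunE. Qed.

Lemma lieZl a x y : lie (a *: x) y = a *: lie x y.
Proof. by rewrite -!adE linearZ scale_lfunE. Qed.

Lemma lie_suml I (r : seq I) (P : pred I) (F : I -> L) y :
  lie (\sum_(i <- r | P i) F i) y = \sum_(i <- r | P i) lie (F i) y.
Proof. by rewrite -adE linear_sum sum_lfunE; under eq_bigr do rewrite adE. Qed.

Lemma lieC x y : lie x y = - lie y x.
Proof.
apply/eqP; rewrite -addr_eq0; move: (liexx (x + y)).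
by rewrite lieDl !linearD /= !liexx add0r addr0 => ->.
Qed.

Definition lie_ideal U := forall x y, y \in U -> lie x y \in U.

Definition simple_lie :=
  (exists x y, lie x y != 0) /\
  (forall U, lie_ideal U -> U = 0%VS \/ U = fullv).

Definition lie_prod U V : {vspace L} :=
  <<[seq lie x y | x <- vbasis U, y <- vbasis V]>>%VS.

Definition lie_subalg U := {in U &, forall x y, lie x y \in U}.

Definition lie_nilpotent U := exists k, iter k (lie_prod U) U = 0%VS.

Definition self_normalizing U :=
  forall x, {in U, forall y, lie x y \in U} -> x \in U.

Definition cartan_subalg U :=
  [/\ lie_subalg U, lie_nilpotent U & self_normalizing U].

Definition isom_sl k :=
  exists phi : 'Hom(L, 'M[K]_k),
    [/\ lker phi = 0%VS,
        forall A, (A \in limg phi) = (\tr A == 0)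
      & forall x y, phi (lie x y) = phi x *m phi y - phi y *m phi x].

Definition dual U := 'Hom(subvs_of U, K^o).

Definition rootspace U (b : dual U) : {vspace L} :=
  (\bigcap_(i < \dim U)
     passmx.leigenspace (ad (vbasis U)`_i) (b (vsproj U (vbasis U)`_i)))%VS.

Lemma rootspaceP U (b : dual U) x :
  reflect (forall h : subvs_of U, lie (vsval h) x = (b h : K) *: x)
          (x \in rootspace b).
Proof.
have UP (i : 'I_(\dim U)) : (vbasis U)`_i \in U.
  by apply: vbasis_mem; apply: mem_nth; rewrite size_tuple.
have eigP f a : (x \in passmx.leigenspace f a) = (f x == a *: x).
  by rewrite memv_ker add_lfunE opp_lfunE scale_lfunE id_lfunE subr_eq0.
rewrite /rootspace memvE; apply: (iffP subv_bigcapP) => [xP h | xP i _].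
  have hE : h = \sum_(i < \dim U) coord (vbasis U) i (vsval h)
                  *: vsproj U (vbasis U)`_i.
    apply: val_inj; rewrite /= raddf_sum {1}(coord_vbasis (valP h)).
    by apply: eq_bigr => i _; rewrite -[RHS]/(val _) linearZ /= vsprojK.
  rewrite [in RHS]hE {1}(coord_vbasis (subvsP h)) lie_suml.
  rewrite linear_sum scaler_suml; apply: eq_bigr => i _.
  rewrite linearZ /= lieZl -scalerA; congr (_ *: _).
  by apply/eqP; move: (xP i isT); rewrite -memvE eigP adE.
by rewrite -memvE eigP adE -xP vsprojK.
Qed.

Definition is_root U (b : dual U) : bool := (b != 0) && (rootspace b != 0%VS).

Definition root_base U (Phi : {fset dual U}) n (S : n.-tuple (dual U)) :=
  [/\ basis_of fullv S, {subset S <= Phi}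
    & {in Phi, forall b, exists k : 'I_n -> nat,
        b = \sum_i tnth S i *+ k i \/ b = - \sum_i tnth S i *+ k i}].

(* Only the values of e on Phi are relevant. The last clause reads
   [e_b, e_c] = +/- (p + 1) e_(b + c), where p is the largest integer such that
   c - p b is a root. The brackets [e_b, e_c] with b + c nonzero and not a root
   vanish by the second clause. *)
Definition chevalley_basis U (Phi : {fset dual U}) n
    (S : n.-tuple (dual U)) (e : dual U -> L) :=
  [/\ basis_of fullv ([seq lie (e b) (e (- b)) | b <- S] ++
                      [seq e b | b <- enum_fset Phi]),
      {in Phi, forall b, e b \in rootspace b},
      {in Phi, forall b, lie (e b) (e (- b)) \in U /\
                         b (vsproj U (lie (e b) (e (- b)))) = 2%:R}
    & {in Phi &, forall b c, b + c \in Phi ->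
        forall p, c - b *+ p \in Phi ->
          (forall q, c - b *+ q \in Phi -> (q <= p)%N) ->
        lie (e b) (e c) = e (b + c) *+ p.+1 \/
        lie (e b) (e c) = - e (b + c) *+ p.+1}].

End LieAlgebra.

Record chevalley_datum (K : numFieldType) (g : lieAlgType K) := ChevalleyDatum {
  cartan : {vspace g};
  cartanP : cartan_subalg cartan;
  roots : {fset dual cartan};
  rootsP : forall b, (b \in roots) = is_root b;
  rank : nat;
  simple_root : rank.-tuple (dual cartan);
  simple_rootP : root_base roots simple_root;
  root_vector : dual cartan -> g;
  root_vectorP : chevalley_basis roots simple_root root_vector
}.

Arguments root_vector {K g} c _ : rename.

Section ChevalleyDatum.
Variables (K : numFieldType) (g : lieAlgType K) (D : chevalley_datum g).
Local Notation weight := (dual (cartan D)).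
Implicit Types (b c : weight) (i : 'I_(rank D)).

Definition simple_coord i b : K := coord (simple_root D) i b.

Definition pos_roots : {fset weight} :=
  [fset b in roots D | [forall i, 0 <= simple_coord i b]]%fset.

Lemma simple_root_pos i : tnth (simple_root D) i \in pos_roots.
Proof.
have [/andP[_ freeS] subS _] := simple_rootP D.
rewrite !inE subS ?mem_tnth //=; apply/forallP => j.
by rewrite /simple_coord (tnth_nth 0) coord_free // ler0n.
Qed.

Definition simple_idx i : pos_roots := [` simple_root_pos i]%fset.

(* Maximal for the order in which b <= c iff all coordinates of c - b in the
   simple roots are nonnegative. *)
Definition maximal_root mu :=
  mu \in roots D /\
  {in roots D, forall b,
     (forall i, simple_coord i mu <= simple_coord i b) -> b = mu}.

Definition max_string mu i m :=
  let P m := forall k, (k <= m)%N ->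
    mu - tnth (simple_root D) i *+ k \in pos_roots in
  P m /\ (forall m', P m' -> (m' <= m)%N).

Definition nilspace : {vspace g} := (\sum_(b : pos_roots) rootspace (val b))%VS.

Lemma lie_rootspace b c x y : x \in rootspace b -> y \in rootspace c ->
  lie x y \in rootspace (b + c).
Proof.
move=> /rootspaceP xb /rootspaceP yc; apply/rootspaceP => h.
have := lie_jacobi (vsval h) x y.
rewrite (lieC y (vsval h)) xb yc linearN /= !linearZ /= (lieC y x) scalerN.
rewrite add_lfunE scalerDl scalerN -addrA -opprD => /eqP; rewrite subr_eq0 => /eqP->.
exact: addrC.
Qed.

Lemma pos_roots_add b c x y : b \in pos_roots -> c \in pos_roots ->
  x \in rootspace b -> y \in rootspace c -> lie x y \in nilspace.
Proof.
rewrite !inE => /andP[bR /forallP b_ge0] /andP[cR /forallP c_ge0] xb yc.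
have xyP := lie_rootspace xb yc.
have [->|xy0] := eqVneq (lie x y) 0; first exact: mem0v.
have [/andP[spanS freeS] _ _] := simple_rootP D.
have bcD i : simple_coord i (b + c) = simple_coord i b + simple_coord i c.
  exact: linearD.
have posbc : b + c \in pos_roots.
  rewrite !inE rootsP /is_root; apply/andP; split; last first.
    by apply/forallP => i; rewrite bcD addr_ge0.
  apply/andP; split; last first.
    by apply: contraNneq xy0 => r0; rewrite r0 memv0 in xyP.
  move: bR; rewrite rootsP => /andP[b0 _]; apply: contraNneq b0 => bc0.
  have b00 i : simple_coord i b = 0.
    have /eqP := bcD i; rewrite bc0 [simple_coord _ 0]linear0 eq_sym.
    by rewrite paddr_eq0 // => /andP[/eqP].
  have bS : b \in <<simple_root D>>%VS by rewrite (eqP spanS) memvf.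
  rewrite (coord_span bS) big1 // => i _.
  by rewrite [coord _ _ _]b00 scale0r.
rewrite memvE; apply: (sumv_sup [` posbc]%fset) => //.
Qed.

Lemma nilspace_subalg : lie_subalg nilspace.
Proof.
move=> _ _ /memv_sumP[xs xsP ->] /memv_sumP[ys ysP ->].
rewrite lie_suml rpred_sum // => b _; rewrite linear_sum rpred_sum // => c _.
exact: pos_roots_add (valP b) (valP c) (xsP _ _) (ysP _ _).
Qed.

Definition nilp : Type := subvs_of nilspace.
HB.instance Definition _ := Vector.on nilp.

Definition nilp_lie (x y : nilp) : nilp :=
  vsproj nilspace (lie (vsval x) (vsval y)).

Lemma val_nilp_lie x y : vsval (nilp_lie x y) = lie (vsval x) (vsval y).
Proof. by rewrite vsprojK // nilspace_subalg ?subvsP. Qed.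

Fact nilp_lie_linearl y : linear (fun x => nilp_lie x y).
Proof.
by move=> a x z; apply: val_inj; rewrite /= !val_nilp_lie lieDl lieZl.
Qed.

Fact nilp_lie_linearr x : linear (nilp_lie x).
Proof. by move=> a y z; apply: val_inj; rewrite /= !val_nilp_lie linearP. Qed.

Fact nilp_liexx x : nilp_lie x x = 0.
Proof. by apply: val_inj; rewrite /= val_nilp_lie liexx. Qed.

Fact nilp_jacobi x y z : nilp_lie x (nilp_lie y z) + nilp_lie y (nilp_lie z x)
  + nilp_lie z (nilp_lie x y) = 0.
Proof.
apply: val_inj; rewrite /= !val_nilp_lie -[RHS]/(0 : g).
by rewrite -(lie_jacobi (vsval x) (vsval y) (vsval z)).
Qed.

HB.instance Definition _ := isLie.Build K nilp
  nilp_lie_linearl nilp_lie_linearr nilp_liexx nilp_jacobi.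

Definition nilp_basis (b : pos_roots) : nilp :=
  vsproj nilspace (root_vector D (val b)).

End ChevalleyDatum.

Section Quotient.
Variables (K : fieldType) (V : vectType K) (U : {vspace V}).

(* V / U is realized on a complement of U; quot_proj is the canonical map. *)
Definition quotv : Type := subvs_of (U^C)%VS.
HB.instance Definition _ := Vector.on quotv.

Definition quot_proj : 'Hom(V, quotv) :=
  (linfun (vsproj (U^C)%VS) \o (\1 - projv U))%VF.

Lemma quot_projE v : vsval (quot_proj v) = v - projv U v.
Proof.
rewrite comp_lfunE lfunE /= vsprojK; rewrite add_lfunE opp_lfunE id_lfunE //.
exact: memv_projC.
Qed.

Lemma quot_proj_eq0 v : (quot_proj v == 0) = (v \in U).
Proof.
rewrite -(inj_eq val_inj) [val _]quot_projE subr_eq0.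
apply/eqP/idP => [->|vU]; first exact: memv_proj.
by rewrite projv_id.
Qed.

Definition quot_repr (x : quotv) : V := vsval x.

Lemma quot_reprK : cancel quot_repr quot_proj.
Proof.
move=> x; apply: val_inj; rewrite [LHS]quot_projE /projv.
have UC0 : (U^C :&: U = 0)%VS by rewrite capvC capv_compl.
have := daddv_pi_add (capv_compl U) (_ : quot_repr x \in _).
rewrite addv_complf memvf (daddv_pi_id UC0 (subvsP x)) => /(_ isT).
by rewrite -[RHS]add0r => /addIr ->; rewrite subr0.
Qed.

End Quotient.

Section Cochains.
Variables (K : fieldType) (L : lieAlgType K) (I : finType) (e : I -> L).
Implicit Types (S : {set I}) (s : seq I).

(* When e is a basis of L, these are the elements f^i of the dual basis. *)
Definition dual_coord i (x : L) : K := coord (codom_tuple e) (enum_rank i) x.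

Fixpoint inversions s : nat :=
  if s is i :: s' then
    (count (fun j => enum_rank j < enum_rank i)%N s' + inversions s')%N
  else 0%N.

Definition omit k s := take k s ++ drop k.+1 s.

(* The space L (x) Lambda L^* of cochains of all degrees. The basis e being
   ordered by enum_rank, phi S is the value of phi on (e_i), i ranging over S
   in increasing order, so that phi = \sum_S phi S (x) f^S, where f^S is the
   exterior product of the f^i for i in S in increasing order. *)
Definition cochain := {ffun {set I} -> L}.

(* phi (e_(s_0), ..., e_(s_(k-1))) *)
Definition cochain_eval (phi : cochain) s : L :=
  if uniq s then (-1) ^+ inversions s *: phi [set i in s] else 0.

(* e_c (x) f^(s_0) /\ ... /\ f^(s_(k-1)) *)
Definition monomial c s : cochain :=
  [ffun S => if uniq s && (S == [set i in s])
             then (-1) ^+ inversions s *: e c else 0].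

Definition cochains (k : nat) : {vspace cochain} :=
  <<[seq monomial c (enum A) | c : I <- enum I,
      A : {set I} <- enum [set A : {set I} | #|A| == k]]>>%VS.

(* The Chevalley-Eilenberg differential
     (d phi)(x_0, ..., x_k) =
       \sum_i (-1)^i [x_i, phi (.., ^x_i, ..)] +
       \sum_(i < j) (-1)^(i + j) phi ([x_i, x_j], .., ^x_i, .., ^x_j, ..). *)
Definition differential (phi : cochain) : cochain :=
  [ffun S : {set I} =>
     \sum_(i < #|S|) (-1) ^+ i *:
       lie (e (enum_val i)) (cochain_eval phi (omit i (enum S)))
   + \sum_(i < #|S|) \sum_(j < #|S| | (i < j)%N) (-1) ^+ (i + j) *:
       \sum_l dual_coord l (lie (e (enum_val i)) (e (enum_val j))) *:
         cochain_eval phi (l :: omit i (omit j (enum S)))].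

Fact cochain_eval_is_linear s : linear (fun phi => cochain_eval phi s).
Proof.
move=> a phi psi; rewrite /cochain_eval !ffunE; case: uniq; last first.
  by rewrite scaler0 addr0.
by rewrite scalerDr !scalerA mulrC.
Qed.

Fact differential_is_linear : linear differential.
Proof.
move=> a phi psi; apply/ffunP => S; rewrite !ffunE /= scalerDr !scaler_sumr.
rewrite addrACA; congr (_ + _); rewrite -big_split; apply: eq_bigr => i _ /=.
  rewrite cochain_eval_is_linear linearP /= scalerDr !scalerA.
  by rewrite [_ * a]mulrC.
rewrite scaler_sumr -big_split /=; apply: eq_bigr => j _.
rewrite scalerA [a * _]mulrC -scalerA -scalerDr; congr *:%R.
rewrite scaler_sumr -big_split /=; apply: eq_bigr => l _.
by rewrite cochain_eval_is_linear scalerDr !scalerA [_ * a]mulrC.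
Qed.

HB.instance Definition _ :=
  GRing.isLinear.Build K cochain cochain _ differential differential_is_linear.

Definition cocycles k : {vspace cochain} :=
  (cochains k :&: lker (linfun differential))%VS.

Definition coboundaries k : {vspace cochain} :=
  if k is k'.+1 then (linfun differential @: cochains k')%VS else 0%VS.

(* H^k, inside the quotient of the space of all cochains by B^k. *)
Definition cohomology k : {vspace quotv (coboundaries k)} :=
  (quot_proj (coboundaries k) @: cocycles k)%VS.

Definition cohom_class k (phi : cochain) : quotv (coboundaries k) :=
  quot_proj (coboundaries k) phi.

Definition monomial_dot c s c' s' : cochain :=
  \sum_(k < size s) (-1) ^+ (size s - k.+1) *:
    (dual_coord (tnth (in_tuple s) k) (e c') *: monomial c (omit k s ++ s')).

Definition cochain_dot (a b : cochain) : cochain :=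
  \sum_c \sum_S \sum_c' \sum_S'
    (dual_coord c (a S) * dual_coord c' (b S')) *:
      monomial_dot c (enum S) c' (enum S').

(* For a of degree p and b of degree q; (p + 1)(q + 1) has the parity of
   (p - 1)(q - 1). *)
Definition cochain_bracket p q (a b : cochain) : cochain :=
  cochain_dot a b - (-1) ^+ (p.+1 * q.+1) *: cochain_dot b a.

(* Meant for x in H^p and y in H^q, whose representatives quot_repr x and
   quot_repr y are then cocycles; as the bracket is compatible with the
   differential, the class does not depend on the choice of representatives. *)
Definition cohom_bracket p q (x : quotv (coboundaries p))
    (y : quotv (coboundaries q)) : quotv (coboundaries (p + q).-1) :=
  cohom_class (p + q).-1 (cochain_bracket p q (quot_repr x) (quot_repr y)).

End Cochains.

Section Generators.
Variables (K : numFieldType) (g : lieAlgType K) (D : chevalley_datum g).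

Definition c_cochain (i : 'I_(rank D)) : cochain (nilp D) (pos_roots D) :=
  \sum_(b : pos_roots D)
    simple_coord i (val b) *: monomial (@nilp_basis K g D) b [:: b].

(* The i-th coordinate of the weight of e_c (x) f^(s_0) /\ ... /\ f^(s_(k-1)) *)
Definition monomial_weight (i : 'I_(rank D)) (c : pos_roots D)
    (s : seq (pos_roots D)) : K :=
  simple_coord i (val c - \sum_(b <- s) val b).

End Generators.

(* Main.v *)
Require Import Defs.
From HB Require Import structures.
From mathcomp Require Import all_boot all_order all_algebra.
From mathcomp Require Import finmap reals complex.
From mathcomp Require Import boolp ring.

(** The classes in H^1 are the derivations of n modulo the inner ones.  The torus
    splits a derivation into weight components: a component phi of weight w maps
    each root vector e_b into the root space of b + w.  As n is generated by the
    simple root vectors ([pos_root_ind], [der_eq0]), phi is known from the vectors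
    phi(e_i), where e_i is the root vector of the simple root a_i.

    Weight 0 gives the combinations of the c_i.  For w <> 0 the Casimir element
    decides.  Normalized by the trace form of g, it acts on g as the identity.
    Let e*_a, in the root space of -a, be dual to e_a, and put
    x = \sum_(a > 0) [e*_a, phi(e_a)].  Then [homotopy_weight]
      [e_i, x] = (1 - (w, w) - (2 rho, w)) / 2 phi(e_i)   for every simple a_i,
    so that phi is inner unless the constant vanishes.  If it does vanish and
    phi(e_i) <> 0, then the root s_i(w + a_i) has the same Casimir value as a highest
    root, hence is one, because every way of raising a root contributes a positive
    term to the Casimir value 1 ([casimir], [casimir_top]).  The highest root of a
    simple algebra is unique ([top_root_unique]), so w + a_i = s_i(mu) = gamma_i, this
    singles out i, and phi is a multiple of b_i ([standard_homogeneous]).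

    The c_i and b_i are independent modulo inner derivations: inner ones have no
    component of weight 0, and an inner derivation sending e_i to a vector with a
    component along the root vector of gamma_i would need the root
    gamma_i - a_i = s_i(mu + a_i), which is beyond mu.

    The bracket in degree 1 is the commutator of derivations, which gives the
    formulas involving the diagonal c_i at once.  The composite of b_i and b_j is
    nonzero only if gamma_j = a_i; then the rank is two, and either the roots are those
    of sl(3) or mu = gamma_i and the composite e_mu (x) f^(a_j) is a multiple of the
    inner derivation by the root vector of mu - a_j ([mu_refl_eq_simple],
    [dot_b_coboundary]). *)

Set Implicit Arguments.
Unset Strict Implicit.
Unset Printing Implicit Defensive.

Import Order.TTheory GRing.Theory Num.Theory.

Local Open Scope ring_scope.

(** * Brackets and coordinates in a basis *)

Section LieLemmas.
Variables (K : fieldType) (L : lieAlgType K).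
Implicit Types x y z : L.

Lemma lieDr x y z : lie x (y + z) = lie x y + lie x z.
Proof. exact: linearD. Qed.
Lemma lieZr a x y : lie x (a *: y) = a *: lie x y.
Proof. exact: linearZ. Qed.
Lemma lie0l x : lie 0 x = 0.
Proof. by rewrite -adE linear0 zero_lfunE. Qed.
Lemma lie0r x : lie x 0 = 0.
Proof. exact: linear0. Qed.
Lemma lieNl x y : lie (- x) y = - lie x y.
Proof. by rewrite -scaleN1r lieZl scaleN1r. Qed.
Lemma lieNr x y : lie x (- y) = - lie x y.
Proof. exact: linearN. Qed.
Lemma lie_sumr I (r : seq I) (P : pred I) (F : I -> L) y :
  lie y (\sum_(i <- r | P i) F i) = \sum_(i <- r | P i) lie y (F i).
Proof. exact: linear_sum. Qed.
Lemma lie_leibniz x y z : lie x (lie y z) = lie (lie x y) z + lie y (lie x z).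
Proof.
apply/eqP; rewrite -subr_eq0 opprD (lieC (lie x y)) opprK (lieC x z) lieNr opprK.
by rewrite addrA addrAC lie_jacobi.
Qed.
Lemma lie_lie x y z : lie (lie x y) z = lie x (lie y z) - lie y (lie x z).
Proof. by rewrite lie_leibniz addrK. Qed.

Variables (I : finType) (e : I -> L).

Fact dual_coord_is_linear i : linear (dual_coord e i : L -> K^o).
Proof. exact: linearP. Qed.
HB.instance Definition _ i :=
  GRing.isLinear.Build K L K^o _ (dual_coord e i) (dual_coord_is_linear i).

Hypothesis basis_e : basis_of fullv (codom_tuple e).

Lemma codom_nth i : (codom_tuple e)`_(enum_rank i) = e i.
Proof. by rewrite nth_codom enum_rankK. Qed.

Lemma dual_coord_basis i j : dual_coord e i (e j) = (i == j)%:R.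
Proof.
rewrite /dual_coord -[in X in coord _ _ X](codom_nth j) coord_free ?(basis_free basis_e) //.
by rewrite (inj_eq enum_rank_inj) eq_sym.
Qed.

Lemma dual_coordK x : x = \sum_i dual_coord e i x *: e i.
Proof.
rewrite {1}(coord_basis basis_e (memvf x)) (reindex _ (onW_bij _ (enum_rank_bij I))).
by apply: eq_bigr => i _; rewrite codom_nth.
Qed.

End LieLemmas.

Lemma codom_free (K : fieldType) (V : vectType K) (T : finType) (f : T -> V) :
  (forall k : T -> K, \sum_t k t *: f t = 0 -> forall t, k t = 0) ->
  free (codom_tuple f).
Proof.
move=> F; apply/freeP => k k0 i.
rewrite -(enum_valK i); apply: (F (fun t => k (enum_rank t))); rewrite -[RHS]k0.
rewrite [RHS](reindex _ (onW_bij _ (enum_rank_bij T))); apply: eq_bigr => t _.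
by rewrite nth_codom enum_rankK.
Qed.

Lemma enum_sum (A B : finType) :
  enum {: (A + B)%type} = map inl (enum A) ++ map inr (enum B).
Proof. by rewrite !enumT [in LHS]unlock. Qed.

(** * Coordinates in a Chevalley basis *)

Section ChevalleyTheory.
Variables (K : numFieldType) (g : lieAlgType K) (D : chevalley_datum g).
Local Notation weight := (dual (cartan D)).
Local Notation H := (cartan D).
Local Notation Phi := (Defs.roots D).
Local Notation e := (root_vector D).
Implicit Types (a b c : weight) (x y z h : g) (i j : 'I_(rank D)).

(** The value of the weight b at h.  The projection only makes it a function on all
    of g; it is used for h in the Cartan subalgebra. *)
Definition wt b h : K := b (vsproj H h).
Definition coroot b : g := lie (e b) (e (- b)).
(** The Chevalley basis of the datum, indexed so that the lemmas on [dual_coord]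
    apply to it. *)
Definition chevalley_elt (t : 'I_(rank D) + Phi) : g :=
  match t with inl i => coroot (tnth (simple_root D) i) | inr b => e (val b) end.

Lemma chevalley_eltP : basis_of fullv (codom_tuple chevalley_elt).
Proof.
have [B _ _ _] := root_vectorP D.
suff -> : tval (codom_tuple chevalley_elt) = [seq coroot b | b <- simple_root D] ++
                      [seq e b | b <- enum_fset Phi] by [].
rewrite -[X in map coroot X]map_tnth_enum [X in map e X](enum_fsetE Phi).
by rewrite -!map_comp /= codomE enum_sum map_cat -!map_comp.
Qed.

Definition coroot_coef i x : K := dual_coord chevalley_elt (inl i) x.
(** The default value 0 outside the roots spares case distinctions on whether a sum
    of roots is a root. *)
Definition root_coef b x : K :=
  if insub b is Some b' then dual_coord chevalley_elt (inr b') x else 0.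
Definition cartan_part x : g := \sum_i coroot_coef i x *: coroot (tnth (simple_root D) i).

Lemma chevalley_expand x : x = cartan_part x + \sum_(b <- Phi) root_coef b x *: e b.
Proof.
rewrite {1}(dual_coordK chevalley_eltP x) big_sumType big_seq_fsetE /=; congr (_ + _).
by apply: eq_bigr => b _; rewrite /root_coef valK.
Qed.

Lemma cartan_part_is_linear : linear cartan_part.
Proof.
move=> k x y; rewrite /cartan_part scaler_sumr -big_split; apply: eq_bigr => i _ /=.
by rewrite /coroot_coef linearP scalerDl scalerA.
Qed.
HB.instance Definition _ := GRing.isLinear.Build K g g _ cartan_part cartan_part_is_linear.

Lemma root_coef_is_linear b : linear (root_coef b : g -> K^o).
Proof.
by move=> k x y; rewrite /root_coef; case: insubP => [u _ _|_]; rewrite ?linearP // scaler0 addr0.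
Qed.
HB.instance Definition _ b := GRing.isLinear.Build K g K^o _ (root_coef b) (root_coef_is_linear b).

Lemma root_coef_e b c : c \in Phi -> root_coef b (e c) = (b == c)%:R.
Proof.
move=> cP; rewrite /root_coef; case: insubP => [u _ <-|bP]; last first.
  by case: eqP bP => // ->; rewrite cP.
by rewrite -[c]/(val [` cP]%fset) -/(chevalley_elt (inr [` cP]%fset)) (dual_coord_basis chevalley_eltP).
Qed.

Lemma root_coef_notin b x : b \notin Phi -> root_coef b x = 0.
Proof. by move=> bP; rewrite /root_coef; case: insubP => // u; rewrite (negPf bP). Qed.

Lemma cartan_part_e c : c \in Phi -> cartan_part (e c) = 0.
Proof.
move=> cP; rewrite /cartan_part big1 // => i _; rewrite /coroot_coef.
by rewrite -[c]/(val [` cP]%fset) -/(chevalley_elt (inr [` cP]%fset)) (dual_coord_basis chevalley_eltP) scale0r.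
Qed.

Lemma root_coef_cartan_part b x : root_coef b (cartan_part x) = 0.
Proof.
rewrite /cartan_part raddf_sum big1 // => i _ /=.
rewrite linearZ /= /root_coef; case: insubP => [u _ _|_]; last by rewrite scaler0.
by rewrite -/(chevalley_elt (inl i)) (dual_coord_basis chevalley_eltP) scaler0.
Qed.

Lemma e_neq0 b : b \in Phi -> e b != 0.
Proof.
move=> bP; apply/eqP => /(congr1 (root_coef b)); rewrite root_coef_e // eqxx linear0.
by move/eqP; rewrite oner_eq0.
Qed.

Lemma e_rootspace b : b \in Phi -> e b \in rootspace b.
Proof. by have [_ E _ _] := root_vectorP D; apply: E. Qed.

Lemma corootP b : b \in Phi -> coroot b \in H /\ wt b (coroot b) = 2%:R.
Proof. by have [_ _ E _] := root_vectorP D; apply: E. Qed.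

Lemma simple_root_in i : tnth (simple_root D) i \in Phi.
Proof. by have [_ S _] := simple_rootP D; rewrite S // mem_tnth. Qed.

Lemma cartan_part_H x : cartan_part x \in H.
Proof. by rewrite memv_suml // => i _; rewrite memvZ // (corootP (simple_root_in i)).1. Qed.

Lemma wtD b c h : wt (b + c) h = wt b h + wt c h.
Proof. by rewrite /wt add_lfunE. Qed.
Lemma wtN b h : wt (- b) h = - wt b h.
Proof. by rewrite /wt opp_lfunE. Qed.
Lemma wt0 h : wt 0 h = 0.
Proof. by rewrite /wt zero_lfunE. Qed.
Lemma wtZ k b h : wt (k *: b) h = k * wt b h.
Proof. by rewrite /wt scale_lfunE. Qed.
Lemma wtMn b n h : wt (b *+ n) h = wt b h *+ n.
Proof. by elim: n => [|n IH]; rewrite ?mulr0n ?wt0 // !mulrS wtD IH. Qed.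
Lemma wt_sum I (r : seq I) (P : pred I) (F : I -> weight) h :
  wt (\sum_(i <- r | P i) F i) h = \sum_(i <- r | P i) wt (F i) h.
Proof. by rewrite /wt sum_lfunE. Qed.
Fact wt_is_linear b : linear (wt b : g -> K^o).
Proof. by move=> k x y; rewrite /wt !linearP. Qed.
HB.instance Definition _ b := GRing.isLinear.Build K g K^o _ (wt b) (wt_is_linear b).

Lemma rootspaceE b x :
  (x \in rootspace b) <-> {in H, forall h, lie h x = wt b h *: x}.
Proof.
split=> [/rootspaceP xb h hH|E].
  by have := xb (vsproj H h); rewrite vsprojK.
by apply/rootspaceP => h; rewrite E ?subvsP // /wt vsvalK.
Qed.

Lemma lie_He h b : h \in H -> b \in Phi -> lie h (e b) = wt b h *: e b.
Proof. by move=> hH bP; apply: (rootspaceE b (e b)).1 => //; apply: e_rootspace. Qed.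

End ChevalleyTheory.

(** * Root spaces and structure constants *)

Section RootStrings.
Variables (K : numFieldType) (g : lieAlgType K) (D : chevalley_datum g).
Local Notation weight := (dual (cartan D)).
Local Notation H := (cartan D).
Local Notation Phi := (Defs.roots D).
Local Notation e := (root_vector D).
Implicit Types (a b c : weight) (x y z h : g) (i j : 'I_(rank D)).

Lemma H_subalg x y : x \in H -> y \in H -> lie x y \in H.
Proof. by have [S _ _] := cartanP D; apply: S. Qed.

Lemma mem_lie_prod (U V : {vspace g}) x y :
  x \in U -> y \in V -> lie x y \in lie_prod U V.
Proof.
move=> xU yV; rewrite (coord_vbasis xU) (coord_vbasis yV) lie_suml.
rewrite rpred_sum // => i _; rewrite lie_sumr rpred_sum // => j _.
rewrite lieZl lieZr !memvZ // memv_span //.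
by apply: allpairs_f; apply: mem_nth; rewrite size_tuple.
Qed.

(** Excludes nonzero eigenvalues of ad h inside the Cartan subalgebra. *)
Lemma H_ad_nilpotent h y : h \in H -> y \in H -> exists n, iter n (lie h) y = 0.
Proof.
move=> hH yH; have [_ [n n0] _] := cartanP D; exists n; apply/eqP.
rewrite -memv0 -n0; elim: n {n0} => //= n IH; exact: mem_lie_prod.
Qed.

Lemma neq0_wt b : b != 0 -> exists2 h, h \in H & wt b h != 0.
Proof.
case/lfunPn => u; rewrite zero_lfunE => ub.
by exists (vsval u); rewrite ?subvsP // /wt vsvalK.
Qed.

Lemma root_neq0 b : b \in Phi -> b != 0.
Proof. by rewrite rootsP => /andP[]. Qed.

Lemma cartan_part_sum_e (F : weight -> K) : cartan_part D (\sum_(b <- Phi) F b *: e b) = 0.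
Proof.
rewrite raddf_sum big_seq big1 // => b bP /=.
by rewrite linearZ /= cartan_part_e // scaler0.
Qed.

Lemma root_coef_sum_e (F : weight -> K) b : b \in Phi ->
  root_coef b (\sum_(c <- Phi) F c *: e c) = F b.
Proof.
move=> bP; rewrite raddf_sum (bigD1_seq b) ?fset_uniq //= linearZ /= root_coef_e // eqxx.
rewrite big_seq_cond big1 ?addr0 => [|c /andP[cP cb]]; first exact: mulr1.
by rewrite linearZ /= root_coef_e // eq_sym (negPf cb); exact: mulr0.
Qed.

Lemma lie_H_expand h x : h \in H ->
  lie h x = lie h (cartan_part D x) + \sum_(b <- Phi) (wt b h * root_coef b x) *: e b.
Proof.
move=> hH; rewrite {1}(chevalley_expand D x) lieDr; congr (_ + _).
rewrite lie_sumr big_seq [RHS]big_seq; apply: eq_bigr => b bP.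
by rewrite lieZr lie_He // scalerA mulrC.
Qed.

Lemma cartan_partK x : cartan_part D (cartan_part D x) = cartan_part D x.
Proof.
by rewrite {2}(chevalley_expand D x) linearD /= cartan_part_sum_e addr0.
Qed.

(** The difference y - cartan_part y lies in the Cartan subalgebra, where ad h is
    nilpotent, and in the span of the root vectors, on which the ad h are diagonal
    and have no common kernel. *)
Lemma cartan_part_id y : y \in H -> cartan_part D y = y.
Proof.
move=> yH; apply/eqP; rewrite eq_sym -subr_eq0.
have zH : y - cartan_part D y \in H by rewrite memvB // cartan_part_H.
have z0 : cartan_part D (y - cartan_part D y) = 0 by rewrite linearB /= cartan_partK subrr.
move: (y - cartan_part D y) zH z0 => {yH}y yH y0.
have yE := chevalley_expand D y; rewrite y0 add0r in yE.
suff E b : b \in Phi -> root_coef b y = 0.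
  by rewrite yE big_seq big1 // => b /E ->; rewrite scale0r.
move=> bP; have [h hH hb] := neq0_wt (root_neq0 bP).
(* b(h)^n is the factor by which (ad h)^n = 0 multiplies the coefficient of e_b *)
have [n n0] := H_ad_nilpotent hH yH.
have [_ E] : cartan_part D (iter n (lie h) y) = 0 /\
   root_coef b (iter n (lie h) y) = wt b h ^+ n * root_coef b y.
  elim: n {n0} => [|n [IH1 IH2]] /=; first by rewrite mul1r.
  rewrite lie_H_expand // IH1 lie0r add0r cartan_part_sum_e root_coef_sum_e //.
  by rewrite IH2 exprS mulrA.
move: E; rewrite n0 linear0 => /esym/eqP.
by rewrite mulf_eq0 expf_eq0 (negPf hb) andbF /= => /eqP.
Qed.

Lemma root_coef_H b y : y \in H -> root_coef b y = 0.
Proof. by move/cartan_part_id <-; rewrite root_coef_cartan_part. Qed.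

Lemma cartan_part_lieH h x : h \in H -> cartan_part D (lie h x) = lie h (cartan_part D x).
Proof.
move=> hH; rewrite lie_H_expand // linearD /= cartan_part_sum_e addr0 cartan_part_id //.
by rewrite H_subalg // cartan_part_H.
Qed.

Lemma root_coef_lieH b h x : h \in H -> root_coef b (lie h x) = wt b h * root_coef b x.
Proof.
move=> hH; case: (boolP (b \in Phi)) => bP; last by rewrite !root_coef_notin // mulr0.
by rewrite lie_H_expand // linearD /= root_coef_H ?add0r ?root_coef_sum_e // H_subalg // cartan_part_H.
Qed.

(** Root spaces are lines: a vector of nonzero weight has no Cartan part, since ad h
    is nilpotent there, and distinct weights are separated by some h. *)
Lemma rootspace_line c x : c != 0 -> x \in rootspace c -> x = root_coef c x *: e c.
Proof.
move=> c0 /rootspaceE xc.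
have x0 : cartan_part D x = 0.
  have [h hH wch] := neq0_wt c0.
  have [n n0] := H_ad_nilpotent hH (cartan_part_H D x).
  have : iter n (lie h) (cartan_part D x) = wt c h ^+ n *: cartan_part D x.
    elim: n {n0} => [|n IH] /=; first by rewrite scale1r.
    by rewrite IH lieZr -cartan_part_lieH // xc // linearZ /= scalerA exprSr.
  by rewrite n0 => /esym/eqP; rewrite scaler_eq0 expf_eq0 (negPf wch) andbF /= => /eqP.
have E b : b != c -> root_coef b x = 0.
  rewrite -subr_eq0 => /neq0_wt[h hH]; rewrite wtD wtN => bch.
  have := root_coef_lieH b x hH; rewrite xc // linearZ /= => /eqP.
  by rewrite -[_ *: _]/(_ * _) eq_sym -subr_eq0 -mulrBl mulf_eq0 (negPf bch) => /eqP.
rewrite {1}(chevalley_expand D x) x0 add0r; case: (boolP (c \in Phi)) => cP.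
  rewrite (bigD1_seq c) ?fset_uniq //= big1 ?addr0 // => b /E ->.
  by rewrite scale0r.
rewrite big_seq big1 => [|b bP]; first by rewrite root_coef_notin // scale0r.
by rewrite E ?scale0r //; apply: contraNneq cP => <-.
Qed.

Lemma rootspace_notin c x : c != 0 -> c \notin Phi -> x \in rootspace c -> x = 0.
Proof. by move=> c0 cP /rootspace_line -> //; rewrite root_coef_notin // scale0r. Qed.

(** If -b were not a root, [e_b, e_(-b)] would have no component of weight 0, but it is a
    vector of the Cartan subalgebra on which b takes the value 2. *)
Lemma root_opp b : (- b \in Phi) = (b \in Phi).
Proof.
suff E c : c \in Phi -> - c \in Phi.
  by apply/idP/idP => /E; rewrite ?opprK.
move=> cP; apply/negPn/negP => NcP; have [hcH hc2] := corootP cP.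
suff E : coroot c = 0 :> g.
  by move: hc2 => /eqP; rewrite E linear0 eq_sym pnatr_eq0.
rewrite -(cartan_part_id hcH) /coroot {1}(chevalley_expand D (e (- c))) lieDr linearD /=.
rewrite lieC lie_He ?cartan_part_H // linearN linearZ /= (cartan_part_e cP) scaler0 oppr0 add0r.
rewrite lie_sumr raddf_sum big_seq big1 // => d dP /=.
have cd0 : c + d != 0 by apply: contraNneq NcP => /eqP; rewrite addrC addr_eq0 => /eqP <-.
rewrite lieZr linearZ /=.
rewrite (rootspace_line cd0 (lie_rootspace (e_rootspace cP) (e_rootspace dP))).
case: (boolP (c + d \in Phi)) => cdP; last by rewrite (root_coef_notin _ cdP) scale0r linear0 scaler0.
by rewrite linearZ /= cartan_part_e // !scaler0.
Qed.

Lemma corootN b : coroot (- b) = - coroot b :> g.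
Proof. by rewrite /coroot opprK lieC. Qed.

(** Every element of the Cartan subalgebra is a combination of brackets of root vectors
    of opposite weights, on which ad h acts with weight 0. *)
Lemma lie_HH h h' : h \in H -> h' \in H -> lie h h' = 0.
Proof.
move=> hH h'H; rewrite -(cartan_part_id h'H) lie_sumr big1 // => i _.
set b := tnth _ i; have bP : b \in Phi := simple_root_in i.
rewrite lieZr /coroot lie_leibniz !(lie_He hH) ?root_opp // wtN lieZl lieZr.
by rewrite scaleNr subrr scaler0.
Qed.

Definition struct_const a b : K := root_coef (a + b) (lie (e a) (e b)).

Lemma lie_ee a b : a \in Phi -> b \in Phi -> a + b != 0 ->
  lie (e a) (e b) = struct_const a b *: e (a + b).
Proof.
by move=> aP bP ab0; apply: rootspace_line => //; apply: lie_rootspace; exact: e_rootspace.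
Qed.

Lemma lie_ee0 a b : a \in Phi -> b \in Phi -> a + b != 0 -> a + b \notin Phi ->
  lie (e a) (e b) = 0.
Proof. by move=> aP bP ab0 abP; rewrite lie_ee // /struct_const root_coef_notin // scale0r. Qed.

Lemma addMn_inj a b m n : a != 0 -> b + a *+ m = b + a *+ n -> m = n.
Proof.
case/neq0_wt => h hH ha /(congr1 (fun c => wt c h)); rewrite !wtD => /addrI.
rewrite !wtMn -[LHS]mulr_natr -[RHS]mulr_natr => /(mulfI ha) /eqP; rewrite eqr_nat => /eqP //.
Qed.

(** The roots are finitely many and a is not torsion. *)
Lemma string_bound a b : a != 0 -> exists n, forall p, b + a *+ p \in Phi -> (p <= n)%N.
Proof.
move=> a0; rewrite -[Phi]/(Phi : {fset weight}).
suff : exists n, forall p, b + a *+ p \in enum_fset Phi -> (p <= n)%N by [].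
elim: (enum_fset Phi) => [|c s [n IH]]; first by exists 0%N.
have [[p pE]|nE] := EM (exists p, b + a *+ p = c).
  exists (maxn n p) => q; rewrite inE leq_max => /orP[/eqP|/IH ->//].
  by rewrite -pE => /addMn_inj -> //; rewrite leqnn orbT.
exists n => q; rewrite inE => /orP[/eqP qE|/IH//].
by case: nE; exists q.
Qed.

(** The Chevalley relation [e_a, e_b] = +/- (p + 1) e_(a + b) applies to the largest p such
    that b - p a is a root; such a p exists by finiteness. *)
Lemma struct_const_neq0 a b : a \in Phi -> b \in Phi -> a + b \in Phi -> struct_const a b != 0.
Proof.
move=> aP bP abP; have [_ _ _ E] := root_vectorP D.
have Na0 : - a != 0 by rewrite oppr_eq0 root_neq0.
have [n nP] := string_bound b Na0.
have P0 : exists p, b + (- a) *+ p \in Phi by exists 0%N; rewrite mulr0n addr0.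
case: (ex_maxnP P0 nP) => p pP pmax.
have ee : root_coef (a + b) (e (a + b)) = 1 by rewrite root_coef_e // eqxx.
rewrite mulNrn in pP.
have {}pmax q : b - a *+ q \in Phi -> (q <= p)%N by rewrite -mulNrn => /pmax.
rewrite /struct_const; case: (E a b aP bP abP p pP pmax) => ->.
  by rewrite raddfMn /= ee pnatr_eq0.
by rewrite raddfMn /= raddfN /= ee mulNrn oppr_eq0 pnatr_eq0.
Qed.

End RootStrings.

(** * Root strings *)

Section Strings.
Variables (K : numFieldType) (g : lieAlgType K) (D : chevalley_datum g).
Local Notation weight := (dual (cartan D)).
Local Notation H := (cartan D).
Local Notation Phi := (Defs.roots D).
Local Notation e := (root_vector D).
Implicit Types (a b c : weight) (x y z h : g) (i j : 'I_(rank D)).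

Lemma wt_coroot a : a \in Phi -> wt a (coroot a) = 2%:R.
Proof. by case/corootP. Qed.

Lemma coroot_H a : a \in Phi -> coroot a \in H.
Proof. by case/corootP. Qed.

(** [e_a, e_a] = 0 would contradict the nonvanishing of the structure constant. *)
Lemma two_root a : a \in Phi -> a *+ 2 \notin Phi.
Proof.
move=> aP; apply/negP; rewrite mulr2n => /(struct_const_neq0 aP aP).
by rewrite /struct_const liexx linear0 eqxx.
Qed.

Lemma mulrn_neq0 a n : a \in Phi -> a *+ n.+1 != 0.
Proof.
move=> /root_neq0/neq0_wt[h hH ha]; apply/eqP => /(congr1 (fun b => wt b h)).
by rewrite wtMn wt0 => /eqP; rewrite mulrn_eq0 (negPf ha).
Qed.

Lemma string_up a c : a \in Phi -> c \in Phi ->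
  exists q, (forall j : nat, (j <= q)%N -> c + a *+ j \in Phi) /\ c + a *+ q.+1 \notin Phi.
Proof.
move=> aP cP; have [n nP] := string_bound c (root_neq0 aP).
have ex : exists q, c + a *+ q.+1 \notin Phi.
  by exists n; apply/negP => /nP; rewrite ltnn.
case: (ex_minnP ex) => q qP qmin; exists q; split=> //.
case=> [_|j jq].
  by rewrite mulr0n addr0.
by apply/negPn/negP => /qmin; rewrite leqNgt jq.
Qed.

(** The sl(2)-computation on a string starting at c, where e_(-a) vanishes: by induction
    the scalar at the k-th step is minus the sum of the values at the coroot of a of
    c, c + a, .., c + k a. *)
Lemma string_climb a c k : a \in Phi -> lie (e (- a)) (e c) = 0 ->
  (forall j : nat, (j <= k)%N -> c + a *+ j \in Phi) ->
  lie (e (- a)) (lie (e a) (e (c + a *+ k))) =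
    - (k.+1%:R * (wt c (coroot a) + k%:R)) *: e (c + a *+ k).
Proof.
move=> aP c0.
have step x : lie (e (- a)) (lie (e a) x) = lie (e a) (lie (e (- a)) x) - lie (coroot a) x.
  by rewrite lie_leibniz addrC (lieC (e (- a)) (e a)) lieNl.
elim: k => [|k IH] kP.
  have cP : c \in Phi by have := kP 0%N isT; rewrite mulr0n addr0.
  by rewrite step mulr0n addr0 c0 lie0r add0r (lie_He (coroot_H aP) cP) addr0 mul1r scaleNr.
have kP' (j : nat) : (j <= k)%N -> c + a *+ j \in Phi by move/leqW/kP.
have kP1 : a + (c + a *+ k) \in Phi.
  by have := kP k.+1 (leqnn _); rewrite mulrS addrCA.
have N0 := struct_const_neq0 aP (kP' k (leqnn k)) kP1.
have E : e (c + a *+ k.+1) = (struct_const a (c + a *+ k))^-1 *: lie (e a) (e (c + a *+ k)).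
  rewrite lie_ee ?root_neq0 ?kP' // scalerA mulVf // scale1r.
  by rewrite mulrS addrCA.
rewrite step {1}E lieZr (IH kP') !lieZr scalerA mulrC -scalerA -E.
rewrite lie_He ?coroot_H ?kP // -scalerBl wtD wtMn wt_coroot //; congr (_ *: _).
by rewrite -mulr_natr; ring.
Qed.

(** At the top of the string the scalar of [string_climb] is 0. *)
Lemma string_top a c q : a \in Phi -> lie (e (- a)) (e c) = 0 ->
  (forall j : nat, (j <= q)%N -> c + a *+ j \in Phi) -> c + a *+ q.+1 \notin Phi ->
  c + a *+ q.+1 != 0 -> wt c (coroot a) = - q%:R.
Proof.
move=> aP c0 qP qN qn0.
have := string_climb aP c0 qP; rewrite lie_ee0 ?lie0r ?qP //.
- move/esym/eqP; rewrite scaler_eq0 (negPf (e_neq0 (qP _ _))) // orbF.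
  by rewrite oppr_eq0 mulf_eq0 pnatr_eq0 /= addr_eq0 => /eqP.
- by move: qn0; rewrite mulrS addrCA.
- by move: qN; rewrite mulrS addrCA.
Qed.

(** For the least multiple k a with k > 1 that is a root, (k - 1) a is not a root or k = 2.
    The latter is excluded by [two_root]; otherwise a string starts at k a, so its value
    2 k at the coroot of a would be nonpositive. *)
Lemma root_multiple a k : a \in Phi -> a *+ k \in Phi -> k = 1%N.
Proof.
move=> aP kaP; apply/eqP/negPn/negP => k1.
(* the multiple 0 is no root, so that the least k exceeds 1 *)
have ex : exists k, (k != 1)%N && (a *+ k \in Phi) by exists k; rewrite k1.
case: (ex_minnP ex) => {k k1 kaP ex}; case=> [|[|[|k]]] //; rewrite ?andbF //.
- by rewrite mulr0n /= => /root_neq0; rewrite eqxx.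
- by rewrite (negPf (two_root aP)).
case/andP=> _ kP kmin.
have kN : a *+ k.+2 \notin Phi.
  by apply/negP => k2P; have := kmin k.+2; rewrite k2P /= ltnn => /(_ isT).
have kE : - a + a *+ k.+3 = a *+ k.+2 by rewrite mulrS addKr.
have z0 : lie (e (- a)) (e (a *+ k.+3)) = 0.
  by apply: lie_ee0; rewrite ?root_opp ?kE // mulrn_neq0.
have [q [qP qN]] := string_up aP kP.
have := string_top aP z0 qP qN; rewrite -mulrnDr addnS mulrn_neq0 // => /(_ isT).
rewrite wtMn wt_coroot // => /eqP; rewrite -addr_eq0 -mulrnA -natrD pnatr_eq0.
by rewrite mulnS.
Qed.

(** The string is described by its unbroken part around b.  Its two ends give the Cartan
    integer by [string_top], and [string_climb] gives the scalar of the
    operator ad e_(-a) ad e_a. *)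
Lemma root_string a b : a \in Phi -> b \in Phi -> b != a -> b != - a ->
  exists p q, [/\ forall j : nat, (j <= p)%N -> b - a *+ j \in Phi,
    b - a *+ p.+1 \notin Phi,
    forall j : nat, (j <= q)%N -> b + a *+ j \in Phi,
    b + a *+ q.+1 \notin Phi &
    wt b (coroot a) = p%:R - q%:R /\
    lie (e (- a)) (lie (e a) (e b)) = (p.+1 * q)%:R *: e b].
Proof.
move=> aP bP ba bNa; have NaP : - a \in Phi by rewrite root_opp.
have [p [pP pN]] := string_up NaP bP; have [q [qP qN]] := string_up aP bP.
have pE (j : nat) : b + (- a) *+ j = b - a *+ j by rewrite mulNrn.
have pP' (j : nat) : (j <= p)%N -> b - a *+ j \in Phi by rewrite -pE; apply: pP.
exists p, q; split=> //; first by rewrite -pE.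
(* c is the bottom of the string *)
pose c := b - a *+ p.
have cE (j : nat) : c + a *+ (p + j) = b + a *+ j by rewrite /c mulrnDr addrA subrK.
have n0 k : b + a *+ k.+1 != 0.
  apply/eqP => /eqP; rewrite addr_eq0 => /eqP E; move: bP bNa.
  by rewrite E root_opp => /(root_multiple aP) ->; rewrite mulr1n eqxx.
have n0' k : b - a *+ k.+1 != 0.
  apply/eqP => /eqP; rewrite subr_eq0 => /eqP E; move: bP ba.
  by rewrite E => /(root_multiple aP) ->; rewrite mulr1n eqxx.
have caE : - a + c = b - a *+ p.+1 by rewrite mulrS opprD addrCA.
have c0 : lie (e (- a)) (e c) = 0.
  have cP0 : c \in Phi by exact: pP'.
  by apply: lie_ee0; rewrite ?caE // -pE.
have cP (j : nat) : (j <= p + q)%N -> c + a *+ j \in Phi.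
  case: (leqP j p) => [jp _|/ltnW pj jq].
    have -> : c + a *+ j = b - a *+ (p - j).
      by rewrite /c -{1}(subnK jp) mulrnDr opprD addrA subrK.
    by rewrite pP' // leq_subr.
  by rewrite -(subnKC pj) cE qP // leq_subLR.
have T := string_top aP c0 cP; rewrite -addnS cE in T.
have {}T := T qN (n0 q).
have wE : wt b (coroot a) = p%:R - q%:R.
  move: T; rewrite /c wtD wtN wtMn wt_coroot // => T.
  by rewrite -(subrK (2%:R *+ p) (wt b (coroot a))) T natrD mulr2n mulrnDl; ring.
split=> //.
have /= := @string_climb a c p aP c0 _.
rewrite -[X in c + a *+ X]addn0 cE mulr0n addr0 => ->; last first.
  by move=> j jp; apply: cP; rewrite (leq_trans jp) // leq_addr.
by congr (_ *: _); rewrite T natrM natrD; ring.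
Qed.

End Strings.

(** * Integrality, reflections and positive roots *)

Section PositiveRoots.
Variables (K : numFieldType) (g : lieAlgType K) (D : chevalley_datum g).
Local Notation weight := (dual (cartan D)).
Local Notation H := (cartan D).
Local Notation Phi := (Defs.roots D).
Local Notation e := (root_vector D).
Implicit Types (a b c : weight) (x y z h : g) (i : 'I_(rank D)).

Local Notation P := (pos_roots D).
Local Notation al i := (tnth (simple_root D) i).

Lemma wt_coroot_real a b : a \in Phi -> b \in Phi -> wt b (coroot a) \is Num.real.
Proof.
move=> aP bP; have [->|ba] := eqVneq b a; first by rewrite wt_coroot // realn.
have [->|bNa] := eqVneq b (- a); first by rewrite wtN wt_coroot // realN realn.
by have [p [q [_ _ _ _ [-> _]]]] := root_string aP bP ba bNa; rewrite realB ?realn.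
Qed.

Lemma reflection_root a b : a \in Phi -> b \in Phi -> b - wt b (coroot a) *: a \in Phi.
Proof.
move=> aP bP; have [->|ba] := eqVneq b a.
  by rewrite wt_coroot // scaler_nat mulr2n opprD addrA subrr sub0r root_opp.
have [->|bNa] := eqVneq b (- a).
  by rewrite wtN wt_coroot // scaleNr opprK scaler_nat mulr2n addKr.
have [p [q [pP _ qP _ [-> _]]]] := root_string aP bP ba bNa.
have [pq|/ltnW qp] := leqP q p.
  by rewrite -natrB // scaler_nat pP // leq_subr.
by rewrite -[p%:R - _]opprB scaleNr opprK -natrB // scaler_nat qP // leq_subr.
Qed.

Lemma sub_root a b : a \in Phi -> b \in Phi -> b != a -> 0 < wt b (coroot a) -> b - a \in Phi.
Proof.
move=> aP bP ba; have [->|bNa] := eqVneq b (- a).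
  by rewrite wtN wt_coroot // oppr_gt0 ltrn0.
have [p [q [pP _ _ _ [-> _]]]] := root_string aP bP ba bNa.
by case: p pP => [|p] pP; rewrite subr_gt0 ltr_nat // => _; apply: (pP 1%N).
Qed.

(** The scalar is a nonnegative integer also when b is proportional to a, and it
    vanishes exactly when b cannot be raised by a. *)
Lemma ladder a b : a \in Phi -> b \in Phi -> exists n : nat,
  lie (e (- a)) (lie (e a) (e b)) = n%:R *: e b /\
  (n == 0%N) = (a + b \notin Phi) && (a + b != 0).
Proof.
move=> aP bP; have [->|ba] := eqVneq b a.
  exists 0%N; rewrite liexx lie0r scale0r; split=> //.
  by rewrite -mulr2n two_root ?mulrn_neq0.
have [->|bNa] := eqVneq b (- a).
  exists 2%N; rewrite -/(coroot a) lieC (lie_He (coroot_H aP)) ?root_opp // wtN wt_coroot //.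
  by rewrite scaleNr opprK subrr eqxx andbF.
have [p [q [pP _ qP qN [wE E]]]] := root_string aP bP ba bNa.
exists (p.+1 * q)%N; split=> //; rewrite muln_eq0 /= [a + b]addrC.
have -> : b + a != 0 by rewrite addr_eq0.
rewrite andbT; case: q qP qN {wE E} => [|q] qP qN; first by rewrite qN.
by rewrite (qP 1%N).
Qed.

Lemma weight_expand b : b = \sum_i simple_coord i b *: al i.
Proof.
have [B _ _] := simple_rootP D.
rewrite {1}(coord_basis B (memvf b)); apply: eq_bigr => i _.
by rewrite -tnth_nth.
Qed.

Lemma simple_coordD i b c : simple_coord i (b + c) = simple_coord i b + simple_coord i c.
Proof. exact: linearD. Qed.
Lemma simple_coordN i b : simple_coord i (- b) = - simple_coord i b.
Proof. exact: linearN. Qed.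
Lemma simple_coordZ i k b : simple_coord i (k *: b) = k * simple_coord i b.
Proof. exact: linearZ. Qed.
Lemma simple_coordMn i b n : simple_coord i (b *+ n) = simple_coord i b *+ n.
Proof. exact: raddfMn. Qed.
Lemma simple_coord_simple i i' : simple_coord i (al i') = (i == i')%:R.
Proof.
have [B _ _] := simple_rootP D.
by rewrite /simple_coord (tnth_nth 0) coord_free ?(basis_free B) // eq_sym.
Qed.

Lemma pos_root_in b : b \in P -> b \in Phi.
Proof. by rewrite !inE => /andP[]. Qed.

Lemma pos_coord_nat b i : b \in P -> exists n : nat, simple_coord i b = n%:R.
Proof.
rewrite !inE => /andP[bP /forallP b0]; have [_ _ E] := simple_rootP D.
have [k kE] := E b bP.
have kE' : simple_coord i (\sum_i al i *+ k i) = (k i)%:R.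
  rewrite /simple_coord raddf_sum (bigD1 i) //= big1 ?addr0.
    by rewrite -/(simple_coord _ _) simple_coordMn simple_coord_simple eqxx.
  move=> i' ii'; rewrite -/(simple_coord _ _) simple_coordMn simple_coord_simple.
  by rewrite eq_sym (negPf ii') mul0rn.
have := b0 i; case: kE => ->; first by exists (k i).
rewrite simple_coordN kE' oppr_ge0 lern0 => /eqP ->.
by exists 0%N; rewrite oppr0.
Qed.

Lemma pos_coord_ge0 b i : b \in P -> 0 <= simple_coord i b.
Proof. by rewrite !inE => /andP[_ /forallP]. Qed.

Lemma root_pos_or_neg b : b \in Phi -> (b \in P) || (- b \in P).
Proof.
move=> bP; have [_ _ E] := simple_rootP D; have [k kE] := E b bP.
have kE' i : simple_coord i (\sum_i al i *+ k i) = (k i)%:R.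
  rewrite /simple_coord raddf_sum (bigD1 i) //= big1 ?addr0.
    by rewrite -/(simple_coord _ _) simple_coordMn simple_coord_simple eqxx.
  move=> i' ii'; rewrite -/(simple_coord _ _) simple_coordMn simple_coord_simple.
  by rewrite eq_sym (negPf ii') mul0rn.
rewrite !inE root_opp bP /=; case: kE => ->; rewrite ?opprK.
  by apply/orP; left; apply/forallP => i; rewrite kE' ler0n.
by apply/orP; right; apply/forallP => i; rewrite kE' ler0n.
Qed.

Lemma pos_coord_gt0 b : b \in P -> exists i, 0 < simple_coord i b.
Proof.
move=> bP; suff: [exists i, 0 < simple_coord i b] by case/existsP => i; exists i.
 apply: contraT => /existsPn b0.
have := root_neq0 (pos_root_in bP); rewrite {1}(weight_expand b) big1 ?eqxx // => i _.
have := b0 i; rewrite lt_def pos_coord_ge0 // andbT negbK => /eqP ->.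
by rewrite scale0r.
Qed.

Lemma root_coord_gt0 b i : b \in Phi -> 0 < simple_coord i b -> b \in P.
Proof.
move=> bP b0; have /orP[//|/(pos_coord_ge0 i)] := root_pos_or_neg bP.
by rewrite simple_coordN oppr_ge0 => /(lt_le_trans b0); rewrite ltxx.
Qed.

Lemma pos_opp b : b \in P -> - b \notin P.
Proof.
move=> bP; have [i bi] := pos_coord_gt0 bP; apply/negP => /(pos_coord_ge0 i).
by rewrite simple_coordN oppr_ge0 => /(lt_le_trans bi); rewrite ltxx.
Qed.

Lemma pos_add b c : b \in P -> c \in P -> b + c \in Phi -> b + c \in P.
Proof.
move=> bP cP bcP; have [i bi] := pos_coord_gt0 bP.
by apply: (@root_coord_gt0 _ i) => //; rewrite simple_coordD ltr_wpDr ?pos_coord_ge0.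
Qed.

Lemma pos_add_neq0 b c : b \in P -> c \in P -> b + c != 0.
Proof.
by move=> bP cP; rewrite addr_eq0; apply: contraTneq cP => E; rewrite -[c]opprK -E pos_opp.
Qed.

Lemma simple_root_in_pos i : al i \in P.
Proof. exact: simple_root_pos. Qed.

(** The only multiple of a simple root that is a positive root is itself. *)
Lemma pos_other_coord i b : b \in P -> b != al i -> exists2 i', i' != i & 0 < simple_coord i' b.
Proof.
move=> bP bi; suff : [exists i', (i' != i) && (0 < simple_coord i' b)].
  by case/existsP => i' /andP[]; exists i'.
apply: contraT => /existsPn b0.
have [n nE] := pos_coord_nat i bP.
have bE : b = al i *+ n.
  rewrite {1}(weight_expand b) (bigD1 i) //= nE scaler_nat big1 ?addr0 // => i' ii'.
  have := b0 i'; rewrite ii' /= lt_def pos_coord_ge0 // andbT negbK => /eqP ->.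
  by rewrite scale0r.
case/eqP: bi; rewrite bE; suff -> : n = 1%N by rewrite mulr1n.
by apply: (@root_multiple _ _ _ (al i)); rewrite ?simple_root_in // -bE pos_root_in.
Qed.

(** Adding a multiple of a simple root leaves another positive coordinate unchanged. *)
Lemma pos_shift i b k : b \in P -> b != al i -> b + k *: al i \in Phi -> b + k *: al i \in P.
Proof.
move=> bP bi; have [i' ii' b0] := pos_other_coord bP bi.
move=> bkP; apply: (@root_coord_gt0 _ i') => //.
by rewrite simple_coordD simple_coordZ simple_coord_simple (negPf ii') mulr0 addr0.
Qed.

Lemma pos_sub_simple i b : b \in P -> b != al i -> b - al i \in Phi -> b - al i \in P.
Proof. by move=> bP bi; rewrite -scaleN1r; apply: pos_shift. Qed.

Lemma simple_sub_pos i b : b \in P -> al i - b \notin P.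
Proof.
move=> bP; apply/negP => aP.
have [bi|bi] := eqVneq b (al i).
  by have := root_neq0 (pos_root_in aP); rewrite bi subrr eqxx.
have := pos_sub_simple bP bi; rewrite -opprB root_opp => /(_ (pos_root_in aP)).
by rewrite (negPf (pos_opp aP)).
Qed.

Lemma perm_roots : perm_eq (enum_fset Phi) (enum_fset P ++ map -%R (enum_fset P)).
Proof.
apply: uniq_perm; first exact: fset_uniq.
  rewrite cat_uniq fset_uniq (map_inj_uniq oppr_inj) fset_uniq andbT.
  by apply/hasPn => _ /mapP[b bP ->]; apply: pos_opp.
move=> b; rewrite mem_cat; apply/idP/orP.
  by move/root_pos_or_neg/orP => [bP|bP]; [left|right; apply/mapP; exists (- b); rewrite ?opprK].
by case=> [/pos_root_in //|/mapP[c /pos_root_in cP ->]]; rewrite root_opp.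
Qed.

Lemma sum_roots (V : nmodType) (F : weight -> V) :
  \sum_(b <- Phi) F b = \sum_(b <- P) F b + \sum_(b <- P) F (- b).
Proof. by rewrite (perm_big _ perm_roots) big_cat big_map. Qed.

End PositiveRoots.

(** * The trace form *)

Section TraceForm.
Variables (K : numFieldType) (g : lieAlgType K) (D : chevalley_datum g).
Local Notation weight := (dual (cartan D)).
Local Notation H := (cartan D).
Local Notation Phi := (Defs.roots D).
Local Notation e := (root_vector D).
Implicit Types (a b c : weight) (x y z h : g) (i : 'I_(rank D)).

Local Notation P := (pos_roots D).
Local Notation al i := (tnth (simple_root D) i).

Local Notation v := (@chevalley_elt K g D).

Definition basis_trace (f : g -> g) : K := \sum_t dual_coord v t (f (v t)).

Lemma basis_trace_comm (f f' : {linear g -> g}) : basis_trace (f \o f') = basis_trace (f' \o f).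
Proof.
have E (f1 f2 : {linear g -> g}) : basis_trace (f1 \o f2) =
    \sum_t \sum_t' dual_coord v t' (f2 (v t)) * dual_coord v t (f1 (v t')).
  apply: eq_bigr => t _; rewrite /= {1}(dual_coordK (chevalley_eltP D) (f2 (v t))).
  by rewrite !linear_sum; apply: eq_bigr => t' _; rewrite !linearZ.
rewrite !E exchange_big; apply: eq_bigr => t _; apply: eq_bigr => t' _.
exact: mulrC.
Qed.

Lemma basis_traceE f : basis_trace f = \sum_i coroot_coef i (f (coroot (al i))) + \sum_(b <- Phi) root_coef b (f (e b)).
Proof.
rewrite /basis_trace big_sumType big_seq_fsetE; congr (_ + _).
by apply: eq_bigr => b _; rewrite /root_coef valK.
Qed.

(** The Killing form of g. *)
Definition trform x y : K := basis_trace (lie x \o lie y).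

Lemma trformC x y : trform x y = trform y x.
Proof. exact: basis_trace_comm. Qed.

Lemma trform_is_linear x : linear (trform x : g -> K^o).
Proof.
move=> k y z; rewrite /trform /basis_trace scaler_sumr -big_split; apply: eq_bigr => t _ /=.
by rewrite lieDl lieZl !linearP.
Qed.
HB.instance Definition _ x := GRing.isLinear.Build K g K^o _ (trform x) (trform_is_linear x).

Lemma trformZr k x y : trform x (k *: y) = k * trform x y.
Proof. exact: linearZ. Qed.
Lemma trformZl k x y : trform (k *: x) y = k * trform x y.
Proof. by rewrite trformC trformZr trformC. Qed.
Lemma trformNl x y : trform (- x) y = - trform x y.
Proof. by rewrite trformC linearN /= trformC. Qed.

(** Cyclicity of the trace. *)
Lemma trform_invariant x y z : trform (lie x y) z = - trform y (lie x z).
Proof.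
apply/eqP; rewrite -addr_eq0; apply/eqP.
have -> : trform (lie x y) z = basis_trace (lie x \o (lie y \o lie z)) - basis_trace (lie y \o (lie x \o lie z)).
  rewrite /trform /basis_trace -sumrB; apply: eq_bigr => t _ /=.
  by rewrite lie_lie linearB.
have -> : trform y (lie x z) = basis_trace (lie y \o (lie x \o lie z)) - basis_trace ((lie y \o lie z) \o lie x).
  rewrite /trform /basis_trace -sumrB; apply: eq_bigr => t _ /=.
  by rewrite lie_lie !linearB.
rewrite -(basis_trace_comm (lie x) (lie y \o lie z : {linear g -> g})).
by rewrite addrA subrK subrr.
Qed.

Lemma H_rootspace0 h : h \in H -> h \in rootspace (0 : weight).
Proof. by move=> hH; apply/rootspaceE => h' h'H; rewrite wt0 scale0r (lie_HH h'H hH). Qed.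

Lemma trform_orth a b x y : x \in rootspace a -> y \in rootspace b -> a + b != 0 -> trform x y = 0.
Proof.
move=> /rootspaceE xa /rootspaceE yb /neq0_wt[h hH]; rewrite wtD => ab.
have := trform_invariant h x y; rewrite xa // yb // trformZl trformZr => /eqP.
by rewrite -addr_eq0 -mulrDl mulf_eq0 (negPf ab) => /eqP.
Qed.

(** The ad h are diagonal in the Chevalley basis, with the roots as eigenvalues. *)
Lemma trform_HH h h' : h \in H -> h' \in H -> trform h h' = \sum_(b <- Phi) wt b h * wt b h'.
Proof.
move=> hH h'H; rewrite /trform basis_traceE big1 ?add0r => [|i _ /=]; last first.
  by rewrite (lie_HH h'H (coroot_H (simple_root_in i))) lie0r [coroot_coef _ _]linear0.
rewrite big_seq [RHS]big_seq; apply: eq_bigr => b bP /=.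
rewrite !(lie_He _ bP) // lieZr (lie_He hH bP) !linearZ /= root_coef_e // eqxx.
by rewrite -[_ *: _]/(_ * _) -[_ *: 1]/(_ * 1) mulr1 mulrC.
Qed.

(** A sum of squares of integers, one of which is 2. *)
Lemma trform_coroot_gt0 b : b \in Phi -> 0 < trform (coroot b) (coroot b).
Proof.
move=> bP; rewrite trform_HH ?coroot_H // (bigD1_seq b) ?fset_uniq //= wt_coroot //.
rewrite ltr_wpDr // ?mulr_gt0 ?ltr0n //.
rewrite big_seq_cond sumr_ge0 // => c /andP[cP _].
by rewrite -expr2 real_exprn_even_ge0 // wt_coroot_real.
Qed.

Lemma trform_coroot b h : b \in Phi -> h \in H -> trform (coroot b) h = wt b h * trform (e b) (e (- b)).
Proof.
by move=> bP hH; rewrite {1}/coroot trform_invariant lieC lie_He // linearN /= opprK trformZr trformC.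
Qed.

Lemma trform_eNe_gt0 b : b \in Phi -> 0 < trform (e b) (e (- b)).
Proof.
move=> bP; have := trform_coroot_gt0 bP; rewrite trform_coroot ?coroot_H // wt_coroot //.
by rewrite pmulr_rgt0 ?ltr0n.
Qed.

(** The vectors e*_b: dual to the root vectors for the trace form. *)
Definition dual_vector b : g := (trform (e b) (e (- b)))^-1 *: e (- b).
(** The element t_b of the Cartan subalgebra that represents b for the trace form. *)
Definition riesz b : g := lie (e b) (dual_vector b).

Lemma dual_vector_rootspace b : b \in Phi -> dual_vector b \in rootspace (- b).
Proof. by move=> bP; rewrite memvZ // e_rootspace // root_opp. Qed.

Lemma trform_dual_vector b c : b \in Phi -> c \in Phi -> trform (e b) (dual_vector c) = (b == c)%:R.
Proof.
move=> bP cP; have [->|bc] := eqVneq b c.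
  by rewrite trformZr mulVf // gt_eqF // trform_eNe_gt0.
by apply: (trform_orth (e_rootspace bP) (dual_vector_rootspace cP)); rewrite subr_eq0.
Qed.

Lemma rieszE b : riesz b = (trform (e b) (e (- b)))^-1 *: coroot b.
Proof. by rewrite /riesz lieZr. Qed.

Lemma riesz_H b : b \in Phi -> riesz b \in H.
Proof. by move=> bP; rewrite rieszE memvZ // coroot_H. Qed.

Lemma trform_riesz b h : b \in Phi -> h \in H -> trform (riesz b) h = wt b h.
Proof.
by move=> bP hH; rewrite rieszE trformZl trform_coroot // mulrC mulfK // gt_eqF // trform_eNe_gt0.
Qed.

Lemma wt_riesz b c : c \in Phi -> wt b (riesz c) = (trform (e c) (e (- c)))^-1 * wt b (coroot c).
Proof. by move=> cP; rewrite rieszE linearZ. Qed.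

Lemma wt_rieszC b c : b \in Phi -> c \in Phi -> wt b (riesz c) = wt c (riesz b).
Proof. by move=> bP cP; rewrite -trform_riesz ?riesz_H // trformC trform_riesz ?riesz_H. Qed.

Lemma dual_vectorN b : b \in Phi -> dual_vector (- b) = (trform (e b) (e (- b)))^-1 *: e b.
Proof. by move=> bP; rewrite /dual_vector opprK trformC. Qed.

Lemma root_coef_trform b x : b \in Phi -> root_coef b x = trform x (dual_vector b).
Proof.
move=> bP; rewrite {2}(chevalley_expand D x) trformC linearD /= trformC.
rewrite (trform_orth (H_rootspace0 (cartan_part_H D x)) (dual_vector_rootspace bP)); last first.
  by rewrite add0r oppr_eq0 root_neq0.
rewrite add0r raddf_sum (bigD1_seq b) ?fset_uniq //= trformZr trformC trform_dual_vector // eqxx.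
rewrite mulr1 big_seq_cond big1 ?addr0 // => c /andP[cP cb].
by rewrite trformZr trformC trform_dual_vector // (negPf cb) mulr0.
Qed.

(** The bilinear form (b, c) on weights induced by the trace form, written so that it makes
    sense for weights that are not roots. *)
Definition wform b c : K := \sum_(d <- Phi) wt b (riesz d) * wt c (riesz d).

Lemma wformC b c : wform b c = wform c b.
Proof. by apply: eq_bigr => d _; rewrite mulrC. Qed.
Lemma wformD b c c' : wform b (c + c') = wform b c + wform b c'.
Proof. by rewrite -big_split; apply: eq_bigr => d _; rewrite wtD mulrDr. Qed.
Lemma wformZ k b c : wform b (k *: c) = k * wform b c.
Proof. by rewrite mulr_sumr; apply: eq_bigr => d _; rewrite wtZ mulrCA. Qed.
Lemma wform_sum I (r : seq I) (Q : pred I) (F : I -> weight) b :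
  wform b (\sum_(i <- r | Q i) F i) = \sum_(i <- r | Q i) wform b (F i).
Proof.
elim/big_rec2: _ => [|i y x _ <-]; last by rewrite wformD.
by rewrite -(scale0r 0) wformZ mul0r.
Qed.

(** By linearity in the simple roots it suffices to compare on roots, where both sides
    are values of the trace form. *)
Lemma wform_root b a : a \in Phi -> wform b a = wt b (riesz a).
Proof.
move=> aP; rewrite wformC (weight_expand b) wform_sum wt_sum.
apply: eq_bigr => i _; rewrite wformZ wtZ; congr (_ * _).
have iP := simple_root_in i; rewrite wt_rieszC // -trform_riesz ?riesz_H // trformC.
rewrite trform_HH ?riesz_H // /wform big_seq [RHS]big_seq; apply: eq_bigr => d dP.
by rewrite (wt_rieszC aP dP) (wt_rieszC iP dP) mulrC.
Qed.

Lemma wform_gt0 a : a \in Phi -> 0 < wform a a.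
Proof.
move=> aP; rewrite wform_root // wt_riesz // wt_coroot // mulr_gt0 ?ltr0n //.
by rewrite invr_gt0 trform_eNe_gt0.
Qed.

(** Otherwise (b, b), which is a combination of the (b, a_i) with nonnegative coefficients,
    would not be positive. *)
Lemma pos_simple_gt0 b : b \in P -> exists i, 0 < wt b (coroot (al i)).
Proof.
move=> bP; have bPhi := pos_root_in bP.
suff: [exists i, 0 < wt b (coroot (al i))] by case/existsP => i; exists i.
apply: contraT => /existsPn b0; have := wform_gt0 bPhi.
rewrite {2}(weight_expand b) wform_sum le_gtF // sumr_le0 // => i _.
have iP := simple_root_in i.
rewrite wformZ mulr_ge0_le0 ?pos_coord_ge0 // wform_root // wt_riesz //.
rewrite mulr_ge0_le0 ?invr_ge0 ?(ltW (trform_eNe_gt0 _)) //.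
by rewrite real_leNgt ?real0 ?wt_coroot_real.
Qed.

Lemma pos_simple_or_sum b : b \in P -> (exists i, b = al i) \/
  exists i, b - al i \in P.
Proof.
move=> bP; have [i bi] := pos_simple_gt0 bP.
have [->|bai] := eqVneq b (al i); first by left; exists i.
right; exists i; apply: pos_sub_simple => //.
by apply: sub_root => //; rewrite ?simple_root_in ?pos_root_in.
Qed.

(** The root vectors of the simple roots generate the nilradical: every positive root
    is reached by adding simple roots one at a time.  Induction on the height. *)
Lemma pos_root_ind (Q : weight -> Prop) : (forall i, Q (al i)) ->
  (forall i b, b \in P -> al i + b \in P -> Q b -> Q (al i + b)) ->
  forall b, b \in P -> Q b.
Proof.
move=> Q1 QD.
suff E n b : b \in P -> \sum_i simple_coord i b = n%:R -> Q b.
  move=> b bP.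
  have /fin_all_exists[k kE] : forall i, exists n : nat, simple_coord i b = n%:R.
    by move=> i; apply: pos_coord_nat.
  apply: (E (\sum_i k i)%N) => //.
  by rewrite natr_sum; apply: eq_bigr => i _; rewrite kE.
elim: n b => [|n IH] b bP bE.
  have [i bi] := pos_coord_gt0 bP; move: bi.
  have /psumr_eq0P -> // : \sum_i simple_coord i b = 0 by [].
    by rewrite ltxx.
  by move=> i' _; apply: pos_coord_ge0.
case: (pos_simple_or_sum bP) => [[i ->]|[i biP]]; first exact: Q1.
rewrite -(subrK (al i) b) addrC; apply: QD; rewrite // ?[al i + _]addrC ?subrK //.
apply: IH => //; rewrite (eq_bigr (fun j => simple_coord j b - (j == i)%:R)).
  rewrite sumrB bE (bigD1 i) //= eqxx big1 ?addr0 => [|j /negPf -> //].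
  by rewrite -natr1 addrK.
by move=> j _; rewrite simple_coordD simple_coordN simple_coord_simple.
Qed.

End TraceForm.

(** * The Casimir element as a homotopy for derivations *)

Section Casimir.
Variables (K : numFieldType) (g : lieAlgType K) (D : chevalley_datum g).
Local Notation weight := (dual (cartan D)).
Local Notation H := (cartan D).
Local Notation Phi := (Defs.roots D).
Local Notation e := (root_vector D).
Implicit Types (a b c : weight) (x y z h : g) (i : 'I_(rank D)).

Local Notation P := (pos_roots D).
Local Notation al i := (tnth (simple_root D) i).

(** The contribution of the raising operator ad e_a to the Casimir element on e_b. *)
Definition casimir_coef a b : K := root_coef b (lie (dual_vector a) (lie (e a) (e b))).

Lemma lie_dual_vector_e a b : a \in Phi -> b \in Phi ->
  lie (dual_vector a) (lie (e a) (e b)) = casimir_coef a b *: e b.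
Proof.
move=> aP bP; apply: rootspace_line; first exact: root_neq0.
rewrite -{2}[b](addKr a); apply: lie_rootspace; first exact: dual_vector_rootspace.
by apply: lie_rootspace; apply: e_rootspace.
Qed.

(** Up to the positive normalization of e*_a this is the integer of [ladder]. *)
Lemma casimir_coefP a b : a \in Phi -> b \in Phi ->
  0 <= casimir_coef a b /\ (casimir_coef a b = 0 -> a + b \notin Phi /\ a + b != 0).
Proof.
move=> aP bP; have [n [nE n0]] := ladder aP bP.
have -> : casimir_coef a b = (trform D (e a) (e (- a)))^-1 * n%:R.
  rewrite /casimir_coef /dual_vector lieZl nE scalerA linearZ /= root_coef_e // eqxx; exact: mulr1.
have k0 := trform_eNe_gt0 aP; split; first by rewrite mulr_ge0 ?invr_ge0 ?ler0n // ltW.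
move/eqP; rewrite mulf_eq0 invr_eq0 gt_eqF //= pnatr_eq0 n0.
by case/andP.
Qed.

(** The pairing of b with the sum of the positive roots. *)
Definition two_rho b : K := \sum_(a <- P) wt b (riesz a).

Lemma two_rhoD b c : two_rho (b + c) = two_rho b + two_rho c.
Proof. by rewrite -big_split; apply: eq_bigr => a _; rewrite wtD. Qed.
Lemma two_rhoZ k b : two_rho (k *: b) = k * two_rho b.
Proof. by rewrite mulr_sumr; apply: eq_bigr => a _; rewrite wtZ. Qed.

(** The Casimir element of the trace form acts as the identity: its coefficient on e_b is
    the trace of ad e_b ad e*_b by invariance, and this trace is 1.  The three terms come
    from the Cartan part, from reordering, and from the operators ad e*_a ad e_a with
    a > 0. *)
Lemma casimir b : b \in Phi ->
  1 = wform b b + two_rho b + 2%:R * \sum_(a <- P) casimir_coef a b.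
Proof.
move=> bP; transitivity (trform D (e b) (dual_vector b)); first by rewrite trform_dual_vector // eqxx.
rewrite /trform basis_traceE -addrA; congr (_ + _).
  rewrite wform_root // -(cartan_part_id (riesz_H bP)) [RHS]linear_sum.
  apply: eq_bigr => i _ /=; rewrite linearZ /= (lieC (dual_vector b)).
  have iP := simple_root_in i.
  have /rootspaceE E := dual_vector_rootspace bP; rewrite E ?coroot_H // wtN scaleNr opprK.
  by rewrite lieZr -/(riesz b) [coroot_coef _ _]linearZ /=; exact: mulrC.
rewrite big_seq (eq_bigr (fun c => root_coef b (lie (e c) (lie (dual_vector c) (e b))))); last first.
  move=> c cP /=; rewrite !root_coef_trform // trform_invariant [RHS]trform_invariant; congr (- _).
  by rewrite trformC (lieC (e b)) (lieC (dual_vector b)) trformNl linearN /= opprK.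
(* the terms of -a and of a differ by the bracket of e_a and e*_a, which is t_a *)
rewrite -big_seq sum_roots /two_rho mulr_sumr -!big_split big_seq [RHS]big_seq.
apply: eq_bigr => a /pos_root_in aP /=.
rewrite lie_leibniz -/(riesz a) (lie_He (riesz_H aP)) // dual_vectorN // (lieZl _ (e a)) lieZr.
rewrite -lieZl -/(dual_vector a) lie_dual_vector_e // -scalerDl !linearZ /= root_coef_e // eqxx.
by rewrite -[_ *: 1]/(_ * 1) -[_ *: 1]/(_ * 1) !mulr1; ring.
Qed.

Lemma casimir_sum b : b \in Phi ->
  \sum_(a <- P) casimir_coef a b = 2%:R^-1 * (1 - wform b b - two_rho b).
Proof. by move=> bP; rewrite [X in X - _ - _](casimir bP); field. Qed.

(** The remaining terms in [casimir] are nonnegative with sum 0. *)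
Lemma casimir_top b : b \in Phi -> wform b b + two_rho b = 1 ->
  {in P, forall a, a + b \notin Phi /\ a + b != 0}.
Proof.
move=> bP E a aP; have := casimir bP; rewrite E => /eqP.
rewrite -subr_eq0 opprD addrA subrr add0r oppr_eq0 mulf_eq0 pnatr_eq0 /=.
rewrite big_seq psumr_eq0 => [|c cP]; last exact: (casimir_coefP (pos_root_in cP) bP).1.
move/allP => /(_ a aP); rewrite aP /= => /eqP.
by case: (casimir_coefP (pos_root_in aP) bP).
Qed.

(** The condition that e_b |-> phi b extends to a derivation of the nilradical with values
    in g. *)
Definition root_derivation (phi : weight -> g) := {in P &, forall a b,
  lie (e a) (phi b) - lie (e b) (phi a) =
  \sum_(d <- P) root_coef d (lie (e a) (e b)) *: phi d}.

(** The contraction of phi with the Casimir element: the candidate for a vector whose inner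
    derivation is a multiple of phi. *)
Definition homotopy_vector (phi : weight -> g) : g := \sum_(a <- P) lie (dual_vector a) (phi a).

Lemma sum_bracket (F : weight -> g) : {in P &, forall a b,
  \sum_(d <- P) root_coef d (lie (e a) (e b)) *: F d =
  if a + b \in P then struct_const a b *: F (a + b) else 0}.
Proof.
move=> a b aP bP; have ab0 := pos_add_neq0 aP bP.
rewrite lie_ee ?pos_root_in //; case: ifP => abP.
  rewrite (bigD1_seq (a + b)) ?fset_uniq //= linearZ /= root_coef_e ?pos_root_in // eqxx.
  rewrite -[_ *: 1]/(_ * 1) mulr1 big1 ?addr0 // => d dab.
  by rewrite linearZ /= root_coef_e ?pos_root_in // (negPf dab) scaler0 scale0r.
have abN : a + b \notin Phi by apply: contraFN abP; apply: pos_add.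
by rewrite {1}/struct_const root_coef_notin // scale0r big1 // => d _; rewrite linear0 scale0r.
Qed.

(** The e*_d with d > 0 form a basis of the opposite nilradical, dual to the e_d. *)
Lemma dual_vector_expand c x : c \in P -> x \in rootspace (- c) ->
  x = \sum_(d <- P) trform D x (e d) *: dual_vector d.
Proof.
move=> cP xc; have cPhi := pos_root_in cP.
rewrite (bigD1_seq c) ?fset_uniq //= big_seq_cond big1 ?addr0 => [|d /andP[dP dc]].
  have Nc0 : - c != 0 by rewrite oppr_eq0 root_neq0.
  rewrite (rootspace_line Nc0 xc) trformZl trformC /dual_vector scalerA mulfK //.
  by rewrite gt_eqF // trform_eNe_gt0.
rewrite (trform_orth xc (e_rootspace (pos_root_in dP))) ?scale0r //.
by rewrite addrC subr_eq0.
Qed.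

(** For a simple root the bracket has no component in n, since a_i - a is never positive.
    This is why [homotopy] is stated for simple roots only. *)
Lemma lie_simple_dual_vector i a : a \in P -> lie (e (al i)) (dual_vector a) =
  (if a == al i then riesz a else 0) +
  \sum_(d <- P) trform D (lie (e (al i)) (dual_vector a)) (e d) *: dual_vector d.
Proof.
move=> aP; have iP := simple_root_in i; have aPhi := pos_root_in aP.
have [->|ai] := eqVneq a (al i).
  rewrite -/(riesz _) big_seq big1 ?addr0 // => d dP.
  rewrite (trform_orth (H_rootspace0 (riesz_H iP)) (e_rootspace (pos_root_in dP))) ?scale0r //.
  by rewrite add0r root_neq0 ?pos_root_in.
have E : lie (e (al i)) (dual_vector a) \in rootspace (al i - a).
  by apply: lie_rootspace; [apply: e_rootspace|apply: dual_vector_rootspace].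
have ia0 : al i - a != 0 by rewrite subr_eq0 eq_sym.
case: (boolP (al i - a \in Phi)) => iaP.
  have := root_pos_or_neg iaP; rewrite (negPf (simple_sub_pos i aP)) /= => cP.
  by rewrite add0r; apply: dual_vector_expand cP _; rewrite opprK.
rewrite (rootspace_notin ia0 iaP E) add0r big1 // => d _.
by rewrite trformC linear0 scale0r.
Qed.

(** After the Leibniz rule and the derivation property, the terms with structure constants
    cancel by invariance of the trace form. *)
Lemma homotopy phi i : root_derivation phi -> lie (e (al i)) (homotopy_vector phi) =
  lie (riesz (al i)) (phi (al i)) + \sum_(a <- P) lie (dual_vector a) (lie (e a) (phi (al i))).
Proof.
move=> dphi; have iP := simple_root_in_pos i; have iPhi := simple_root_in i.
have E a : a \in P -> lie (e (al i)) (lie (dual_vector a) (phi a)) =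
    (lie (if a == al i then riesz a else 0) (phi a) +
     lie (dual_vector a) (lie (e a) (phi (al i)))) +
    (\sum_(d <- P) trform D (lie (e (al i)) (dual_vector a)) (e d) *: lie (dual_vector d) (phi a) +
     \sum_(d <- P) root_coef d (lie (e (al i)) (e a)) *: lie (dual_vector a) (phi d)).
  move=> aP; rewrite lie_leibniz [in LHS](lie_simple_dual_vector i aP) lieDl -!addrA; congr (_ + _).
  rewrite -[lie (e (al i)) (phi a)](subrK (lie (e a) (phi (al i)))) dphi //.
  rewrite lieDr lie_suml lie_sumr addrA addrC; congr (_ + (_ + _)).
    by apply: eq_bigr => d _; rewrite lieZl.
  by apply: eq_bigr => d _; rewrite lieZr.
rewrite lie_sumr big_seq (eq_bigr _ E) -big_seq !big_split /=.
rewrite (bigD1_seq (al i)) ?fset_uniq //= eqxx big1 ?addr0 => [|a /negPf ->]; last first.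
  by rewrite lie0l.
rewrite -[RHS]addr0; congr (_ + _).
rewrite [X in _ + X]exchange_big -big_split big_seq big1 //= => a aP.
rewrite -big_split big_seq big1 //= => d dP.
by rewrite -scalerDl root_coef_trform ?pos_root_in // trform_invariant (trformC D (dual_vector a)) addNr scale0r.
Qed.

Lemma trform_half h h' : h \in H -> h' \in H ->
  2%:R * (\sum_(a <- P) wt a h * wt a h') = trform D h h'.
Proof.
move=> hH h'H; rewrite trform_HH // sum_roots mulrDl mul1r; congr (_ + _).
by apply: eq_bigr => a _; rewrite !wtN mulrNN.
Qed.

Lemma sum_casimir_coef b : b \in Phi -> \sum_(a <- P) lie (dual_vector a) (lie (e a) (e b)) =
  (\sum_(a <- P) casimir_coef a b) *: e b.
Proof.
move=> bP; rewrite scaler_suml big_seq [RHS]big_seq; apply: eq_bigr => a aP.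
exact: lie_dual_vector_e (pos_root_in aP) bP.
Qed.

(** For the derivation ad h of weight 0 both sides of [homotopy] can be computed
    directly, and comparison with [casimir] leaves this identity.  It stands for the
    usual (2 rho, a_i) = (a_i, a_i). *)
Lemma two_rho_simple i : two_rho (al i) = wform (al i) (al i).
Proof.
have iP := simple_root_in_pos i; have iPhi := simple_root_in i; pose h := coroot (al i) : g.
have hH : h \in H by apply: coroot_H.
(* the derivation ad h with h the coroot, on which a_i takes the value 2 *)
pose phi b := wt b h *: e b : g.
have dphi : root_derivation phi.
  move=> a b aP bP; rewrite sum_bracket // /phi !lieZr (lieC (e b)) scalerN opprK.
  rewrite -scalerDl lie_ee ?pos_add_neq0 ?pos_root_in //.
  case: ifP => abP; first by rewrite wtD addrC !scalerA mulrC.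
  by rewrite /struct_const root_coef_notin ?scale0r ?scaler0 //; apply: contraFN abP; apply: pos_add.
have hE : homotopy_vector phi = - \sum_(a <- P) wt a h *: riesz a.
  rewrite -sumrN; apply: eq_big_seq => a aP /=.
  by rewrite /phi lieZr lieC scalerN.
have := homotopy i dphi.
rewrite hE lieNr lieC opprK lie_suml.
rewrite (eq_big_seq (fun a => (wt a h * wt a (riesz (al i))) *: e (al i))); last first.
  move=> a aP /=; rewrite lieZl lie_He ?riesz_H ?pos_root_in // scalerA wt_rieszC ?pos_root_in //.
rewrite -scaler_suml /phi lieZr lie_He ?riesz_H //.
rewrite (eq_bigr (fun a => wt (al i) h *: lie (dual_vector a) (lie (e a) (e (al i))))) => [|a _]; last first.
  by rewrite !lieZr.
rewrite -scaler_sumr sum_casimir_coef // -scalerDr -scalerDl scalerA => /eqP.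
rewrite -subr_eq0 -scalerBl scaler_eq0 (negPf (e_neq0 iPhi)) orbF subr_eq0 => /eqP E.
have T := trform_half hH (riesz_H iPhi); rewrite trformC trform_riesz // in T.
have C := casimir iPhi; rewrite wform_root // in C *.
have h2 : wt (al i) h = 2%:R by rewrite wt_coroot.
have two0 : 2%:R != 0 :> K by rewrite pnatr_eq0.
rewrite h2 in E T; rewrite E in T; apply: (mulfI two0).
have {}T : wt (al i) (riesz (al i)) + \sum_(a <- P) casimir_coef a (al i) = 2%:R^-1.
  by apply: (mulfI two0); apply: (mulfI two0); rewrite T mulfV // mulr1.
have -> : two_rho (al i) = 1 - wt (al i) (riesz (al i)) - 2%:R * \sum_(a <- P) casimir_coef a (al i).
  by rewrite {1}C; ring.
have -> : \sum_(a <- P) casimir_coef a (al i) = 2%:R^-1 - wt (al i) (riesz (al i)).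
  by rewrite -T; ring.
by field.
Qed.

(** Equivalently half of 1 + |rho|^2 - |w + rho|^2. *)
Definition homotopy_const w : K := 2%:R^-1 * (1 - wform w w - two_rho w).

(** Both terms of [homotopy] act on the root space of w + a_i by scalars, the
    second one being given by [casimir]. *)
Lemma homotopy_weight phi i (w : weight) : root_derivation phi -> w + al i \in Phi ->
  (exists z : K, phi (al i) = z *: e (w + al i)) ->
  lie (e (al i)) (homotopy_vector phi) = homotopy_const w *: phi (al i).
Proof.
move=> dphi gP [z zE]; have iPhi := simple_root_in i.
rewrite homotopy // zE lieZr lie_He ?riesz_H //.
rewrite (eq_bigr (fun a => z *: lie (dual_vector a) (lie (e a) (e (w + al i))))) => [|a _]; last first.
  by rewrite !lieZr.
rewrite -scaler_sumr sum_casimir_coef // !scalerA -scalerDl; congr (_ *: _).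
rewrite casimir_sum // two_rhoD two_rho_simple.
rewrite wformD [wform _ w]wformC [wform _ (al i)]wformC !wformD.
rewrite (wformC (al i) w).
have -> : wt (w + al i) (riesz (al i)) = wform w (al i) + wform (al i) (al i).
  by rewrite -wform_root // wformC wformD (wformC (al i) w).
by rewrite /homotopy_const; field.
Qed.

(** The vanishing constant says |w + rho| = |mu + rho| for a highest root mu.  Reflecting
    w + rho = (w + a_i) + s_i(rho) by s_i turns it into the Casimir value of the root
    s_i(w + a_i). *)
Lemma homotopy_const_eq0 (w : weight) i (gm := w + al i) : gm \in Phi -> homotopy_const w = 0 ->
  let del := gm - wt gm (coroot (al i)) *: al i in
  del \in Phi /\ {in P, forall a, a + del \notin Phi /\ a + del != 0}.
Proof.
move=> gP c0 del; have iPhi := simple_root_in i.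
have delP : del \in Phi by apply: reflection_root.
split=> //; apply: casimir_top => //.
have wE : w = gm - al i by rewrite addrK.
have {}c0 : wform w w + two_rho w = 1.
  move/eqP: c0; rewrite mulf_eq0 invr_eq0 pnatr_eq0 /= -addrA -opprD subr_eq0.
  by move/eqP.
rewrite -c0 wE /del -(scaleN1r (al i)) -(scaleNr (wt gm _)) !two_rhoD !two_rhoZ.
rewrite two_rho_simple.
have E k : wform (gm + k *: al i) (gm + k *: al i) = wform gm gm +
    2%:R * k * wform gm (al i) + k * k * wform (al i) (al i).
  clear c0 delP del wE; move: gm gP => b _.
  rewrite wformD wformZ (wformC _ b) (wformC _ (al i)) !wformD !wformZ (wformC (al i) b).
  by ring.
rewrite !E.
rewrite [wform gm (al i)]wform_root // [wform (al i) (al i)]wform_root //.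
by rewrite !wt_riesz // wt_coroot //; ring.
Qed.

End Casimir.

(** * The highest root *)

Section HighestRoot.
Variables (K : numFieldType) (g : lieAlgType K) (D : chevalley_datum g).
Local Notation weight := (dual (cartan D)).
Local Notation H := (cartan D).
Local Notation Phi := (Defs.roots D).
Local Notation e := (root_vector D).
Implicit Types (a b c : weight) (x y z h : g) (i : 'I_(rank D)).

Local Notation P := (pos_roots D).
Local Notation al i := (tnth (simple_root D) i).

Hypothesis g_simple : simple_lie g.

Lemma root_coefZ b k x : root_coef b (k *: x) = k * root_coef b x.
Proof. exact: linearZ. Qed.

(** The order of the root lattice, by coordinates in the simple roots. *)
Definition weight_le b c := forall i, simple_coord i b <= simple_coord i c.

Definition top_root b := {in P, forall a, a + b \notin Phi}.

Section TopRoot.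
Variables (mu : weight) (muP : mu \in P) (mu_top : top_root mu).

(** The subspaces among which the ideal generated by e_mu is found as a largest one:
    stable under the Borel subalgebra and with weights below mu. *)
Definition below_mu (W : {vspace g}) :=
  [/\ e mu \in W,
      forall x b, x \in W -> b \in Phi -> ~ weight_le b mu -> root_coef b x = 0,
      forall h x, h \in H -> x \in W -> lie h x \in W
    & forall a x, a \in P -> x \in W -> lie (e a) x \in W].

(** Closing W once under the opposite nilradical. *)
Definition lower (W : {vspace g}) : {vspace g} :=
  (W + \sum_(a : P) (ad (e (- val a))) @: W)%VS.

Lemma sub_lower W : (W <= lower W)%VS.
Proof. exact: addvSl. Qed.

Lemma mem_lower (W : {vspace g}) a x : a \in P -> x \in W -> lie (e (- a)) x \in lower W.
Proof.
move=> aP xW; rewrite -[lie _ _]add0r memv_add ?mem0v // -adE.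
rewrite (subvP (sumv_sup [` aP]%fset _ (subvv _))) // memv_img //.
Qed.

Lemma lower_ind (Q : g -> Prop) (W : {vspace g}) : (forall x, x \in W -> Q x) ->
  (forall a x, a \in P -> x \in W -> Q (lie (e (- a)) x)) ->
  Q 0 -> (forall x y, Q x -> Q y -> Q (x + y)) -> forall x, x \in lower W -> Q x.
Proof.
move=> QW QL Q0 QD x /memv_addP[y yW [z zW ->]]; apply: (QD); first exact: QW.
case/memv_sumP: zW => zs zsP ->; apply: (@big_ind _ Q _ _ Q0 QD) => a _.
by have /memv_imgP[u uW ->] := zsP a isT; rewrite adE; apply: QL => //; apply: valP.
Qed.

(** Only [e_c, [e_(-a), y]] needs an argument: the bracket of e_c and e_(-a) is in the Borel
    subalgebra or in the opposite nilradical, and both map W into lower W. *)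
Lemma below_mu_lower W : below_mu W -> below_mu (lower W).
Proof.
move=> [muW Wle WH WP]; have sW := subvP (sub_lower W).
split; first exact: sW.
- move=> x b xW bP nb; elim/lower_ind: xW => [y yW|a y aP yW||y z yE zE].
  + exact: Wle.
  + rewrite {1}(chevalley_expand D y) lieDr lieC lie_He ?cartan_part_H ?root_opp ?pos_root_in // linearD linearN /=.
    have ab : b != - a.
      apply/eqP => bE; apply: nb => i; rewrite bE simple_coordN.
      by rewrite (le_trans _ (pos_coord_ge0 i muP)) // oppr_le0 pos_coord_ge0.
    rewrite linearZ /= root_coef_e ?root_opp ?pos_root_in // (negPf ab) scaler0 oppr0 add0r.
    rewrite lie_sumr raddf_sum big_seq big1 // => c cP /=.
    rewrite lieZr root_coefZ.
    have [cW|cW] := pselect (weight_le c mu); last by rewrite (Wle y c) // mul0r.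
    have [ca|ca] := eqVneq (- a + c) 0.
      move/eqP: ca; rewrite addrC subr_eq0 => /eqP <-.
      by rewrite lieC -/(coroot c) linearN /= (root_coef_H _ (coroot_H cP)) oppr0 mulr0.
    rewrite lie_ee ?root_opp ?(pos_root_in aP) // root_coefZ.
    case: (boolP (- a + c \in Phi)) => acP; last by rewrite /struct_const (root_coef_notin _ acP) mul0r mulr0.
    rewrite root_coef_e //; case: eqP => [bE|]; last by rewrite !mulr0.
    case: nb => i; rewrite bE simple_coordD simple_coordN.
    by rewrite (le_trans _ (cW i)) // gerDr oppr_le0 pos_coord_ge0.
  + by rewrite linear0.
  + by rewrite linearD /= yE zE addr0.
- move=> h x hH; elim/lower_ind => [y yW|a y aP yW||y z yE zE].
  + by apply: sW; apply: WH.
  + rewrite lie_leibniz lie_He ?root_opp ?pos_root_in // lieZl memvD ?memvZ ?mem_lower //.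
    exact: WH.
  + by rewrite lie0r mem0v.
  + by rewrite lieDr memvD.
move=> c x cP; elim/lower_ind => [y yW|a y aP yW||y z yE zE].
- by apply: sW; apply: WP.
- rewrite lie_leibniz memvD ?mem_lower ?WP //.
  have [->|ca] := eqVneq c a; first by apply: sW; apply: WH => //; apply: coroot_H; apply: pos_root_in.
  case: (boolP (c - a \in Phi)) => caP; last first.
    by rewrite lie_ee0 ?root_opp ?(pos_root_in aP) ?(pos_root_in cP) ?subr_eq0 // lie0l mem0v.
  rewrite lie_ee ?root_opp ?(pos_root_in aP) ?(pos_root_in cP) ?subr_eq0 // lieZl memvZ //.
  have /orP[cP'|cP'] := root_pos_or_neg caP; first by apply: sW; apply: WP.
  by rewrite -[c - a]opprK mem_lower.
- by rewrite lie0r mem0v.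
by rewrite lieDr memvD.
Qed.

Lemma below_mu_line : below_mu <[e mu]>%VS.
Proof.
have muPhi := pos_root_in muP; split; first exact: memv_line.
- move=> _ b /vlineP[k ->] bP nb; rewrite linearZ /= root_coef_e //; case: eqP => [bE|]; last by rewrite scaler0.
  by case: nb => i; rewrite bE.
- by move=> h _ hH /vlineP[k ->]; rewrite lieZr lie_He // !memvZ // memv_line.
move=> a _ aP /vlineP[k ->].
have aPhi := pos_root_in aP; have aT := mu_top aP.
by rewrite lieZr lie_ee0 ?(pos_add_neq0 aP muP) // scaler0 mem0v.
Qed.

(** A subspace of maximal dimension satisfying [below_mu] is also stable under the
    opposite nilradical, hence is a nonzero ideal, hence is g. *)
Lemma all_below_mu b : b \in Phi -> weight_le b mu.
Proof.
(* Q n: some admissible subspace has dimension n *)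
pose Q n := `[< exists W : {vspace g}, below_mu W /\ \dim W = n >].
have ex : exists n, Q n.
  by exists (\dim <[e mu]>%VS); apply/asboolP; exists <[e mu]>%VS; split=> //; apply: below_mu_line.
have bd n : Q n -> (n <= \dim {:g})%N.
  by move/asboolP => [W [_ <-]]; apply/dimvS/subvf.
case: (ex_maxnP ex bd) => n /asboolP[W [QW Wn]] nmax.
have WE : W = lower W.
  apply/eqP; rewrite eqEdim sub_lower Wn nmax //.
  by apply/asboolP; exists (lower W); split=> //; apply: below_mu_lower.
have [muW Wle WH WP] := QW.
have idealW : lie_ideal W.
  move=> x y yW; rewrite (chevalley_expand D x) lieDl memvD ?(WH _ _ (cartan_part_H D x) yW) //.
  rewrite lie_suml big_seq memv_suml // => c cP; rewrite lieZl memvZ //.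
  have /orP[cP'|cP'] := root_pos_or_neg cP; first exact: WP.
  by rewrite -[c]opprK WE mem_lower.
have [|WT] := g_simple.2 W idealW.
  by move=> W0; move: muW; rewrite W0 memv0 (negPf (e_neq0 (pos_root_in muP))).
move=> bP; apply: contrapT => nb.
have := Wle (e b) b _ bP nb; rewrite WT memvf => /(_ isT)/eqP.
by rewrite root_coef_e // eqxx oner_eq0.
Qed.

End TopRoot.

Lemma top_root_pos b : b \in Phi ->
  {in P, forall a, a + b \notin Phi /\ a + b != 0} -> b \in P.
Proof.
move=> bP bt; have /orP[//|NbP] := root_pos_or_neg bP.
by have [_] := bt _ NbP; rewrite addNr eqxx.
Qed.

Lemma weight_le_anti b c : weight_le b c -> weight_le c b -> b = c.
Proof.
move=> bc cb; rewrite (weight_expand b) (weight_expand c).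
by apply: eq_bigr => i _; congr (_ *: _); apply/le_anti; rewrite bc cb.
Qed.

Lemma top_root_unique b c : b \in P -> c \in P -> top_root b -> top_root c -> b = c.
Proof.
move=> bP cP bt ct.
by apply: weight_le_anti; apply: all_below_mu => //; apply: pos_root_in.
Qed.

(** A maximal root is positive because otherwise its opposite would be above it. *)
Lemma maximal_root_top mu : maximal_root mu -> mu \in P /\ top_root mu.
Proof.
move=> [muP mumax].
have pos : mu \in P.
  have /orP[//|NmuP] := root_pos_or_neg muP.
  have E : - mu = mu.
    apply: mumax => [|i]; first by rewrite root_opp.
    have := pos_coord_ge0 i NmuP; rewrite simple_coordN => h.
    by rewrite (le_trans _ h) // -oppr_ge0.
  by rewrite -E.
split=> // a aP; apply/negP => amuP.
have E : a + mu = mu.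
  by apply: mumax => // i; rewrite simple_coordD lerDr pos_coord_ge0.
have := root_neq0 (pos_root_in aP); rewrite -(addrK mu a) E subrr eqxx //.
Qed.

End HighestRoot.

(** * Derivations given on the root vectors *)

Section Derivations.
Variables (K : numFieldType) (g : lieAlgType K) (D : chevalley_datum g).
Local Notation weight := (dual (cartan D)).
Local Notation H := (cartan D).
Local Notation Phi := (Defs.roots D).
Local Notation e := (root_vector D).
Implicit Types (a b c : weight) (x y z h : g) (i : 'I_(rank D)).

Local Notation P := (pos_roots D).
Local Notation al i := (tnth (simple_root D) i).

Lemma root_vector_nil b : b \in P -> e b \in nilspace D.
Proof.
move=> bP; rewrite memvE; apply: (sumv_sup [` bP]%fset) => //=.
by rewrite -memvE e_rootspace // pos_root_in.
Qed.

Lemma nil_expand x : x \in nilspace D -> x = \sum_(b <- P) root_coef b x *: e b.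
Proof.
case/memv_sumP => xs xsP xE; rewrite big_seq_fsetE /=.
have E (b : P) : xs b = root_coef (val b) (xs b) *: e (val b).
  by apply: rootspace_line; [apply: root_neq0; apply: pos_root_in; apply: valP|apply: xsP].
rewrite {1}xE; apply: eq_bigr => b _; rewrite {1}E; congr (_ *: _).
rewrite xE raddf_sum (bigD1 b) //= big1 ?addr0 // => c cb.
rewrite E root_coefZ root_coef_e ?pos_root_in ?(valP c) // eq_sym.
by rewrite (inj_eq val_inj) (negPf cb) mulr0.
Qed.

Definition nil_valued (phi : weight -> g) := {in P, forall b, phi b \in nilspace D}.

Lemma der_sub phi psi : @root_derivation K g D phi -> root_derivation psi -> root_derivation (fun b => phi b - psi b).
Proof.
move=> dphi dpsi a b aP bP; rewrite !lieDr !lieNr opprD addrACA -opprD dphi // dpsi //.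
by rewrite -sumrB; apply: eq_bigr => d _; rewrite scalerBr.
Qed.

Lemma der_scale (k : K) phi : @root_derivation K g D phi -> root_derivation (fun b => k *: phi b).
Proof.
move=> dphi a b aP bP; rewrite !lieZr -scalerBr dphi // scaler_sumr.
by apply: eq_bigr => d _; rewrite !scalerA mulrC.
Qed.

Lemma der_inner x : @root_derivation K g D (fun b => lie (e b) x).
Proof.
move=> a b aP bP; rewrite -lie_lie.
under eq_bigr do rewrite -lieZl.
rewrite -lie_suml sum_bracket //; case: ifP => abP.
  by rewrite lie_ee ?pos_root_in ?pos_add_neq0.
rewrite lie_ee0 ?(pos_root_in aP) ?(pos_root_in bP) ?pos_add_neq0 //.
by apply: contraFN abP; apply: pos_add.
Qed.

Lemma der_diag (t : weight -> K) : (forall a b, t (a + b) = t a + t b) ->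
  @root_derivation K g D (fun b => t b *: e b).
Proof.
move=> tD a b aP bP; rewrite sum_bracket // !lieZr (lieC (e b)) scalerN opprK.
rewrite -scalerDl lie_ee ?pos_add_neq0 ?(pos_root_in aP) ?(pos_root_in bP) //.
case: ifP => abP; first by rewrite tD addrC !scalerA mulrC.
by rewrite /struct_const root_coef_notin ?scale0r ?scaler0 //; apply: contraFN abP; apply: pos_add.
Qed.

(** The simple root vectors generate n. *)
Lemma der_eq0 phi : @root_derivation K g D phi -> (forall i, phi (al i) = 0) ->
  {in P, forall b, phi b = 0}.
Proof.
move=> dphi phi0; apply: pos_root_ind => [i|i b bP ibP bE]; first exact: phi0.
have := dphi _ _ (simple_root_in_pos i) bP; rewrite bE phi0 !lie0r subrr sum_bracket ?simple_root_in_pos // ibP.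
move/esym/eqP; rewrite scaler_eq0 (negPf (struct_const_neq0 _ _ _)) ?pos_root_in ?simple_root_in_pos //.
by move/eqP.
Qed.

(** Taking weight components commutes with ad e_a on n; there is no exception at weight 0
    because n has no vectors of weight 0 or of negative weight. *)
Lemma root_coef_lie a c x : a \in P -> x \in nilspace D ->
  root_coef (a + c) (lie (e a) x) *: e (a + c) = root_coef c x *: lie (e a) (e c).
Proof.
move=> aP xN; rewrite {1 2}(nil_expand xN) lie_sumr !raddf_sum !scaler_suml.
apply: eq_big_seq => d dP /=; have dPhi := pos_root_in dP; have aPhi := pos_root_in aP.
rewrite lieZr !root_coefZ root_coef_e // -!scalerA; congr (_ *: _).
rewrite lie_ee ?(pos_add_neq0 aP dP) // root_coefZ.
have [->|cd] := eqVneq c d; rewrite ?scale1r ?scale0r.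
  rewrite lie_ee ?(pos_add_neq0 aP dP) //; case: (boolP (a + d \in Phi)) => adP.
    by rewrite root_coef_e // eqxx mulr1.
  by rewrite /struct_const (root_coef_notin _ adP) mul0r scale0r.
case: (boolP (a + d \in Phi)) => adP.
  by rewrite root_coef_e // (inj_eq (addrI a)) (negPf cd) mulr0 scale0r.
by rewrite /struct_const (root_coef_notin _ adP) mul0r scale0r.
Qed.

Definition weight_component (phi : weight -> g) w b : g := root_coef (b + w) (phi b) *: e (b + w).

Lemma der_weight_component phi w : @root_derivation K g D phi -> nil_valued phi -> root_derivation (weight_component phi w).
Proof.
move=> dphi nphi a b aP bP; rewrite sum_bracket // /weight_component !lieZr.
rewrite -!root_coef_lie ?nphi // (addrCA b a) -scalerBl -[X in X *: _]linearB /=.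
rewrite dphi // sum_bracket //; case: ifP => abP.
  by rewrite root_coefZ scalerA addrA.
by rewrite [root_coef _ _]linear0 scale0r.
Qed.

(** Only the differences of positive roots occur as weights. *)
Lemma sum_weight_component phi : nil_valued phi -> exists s : seq weight,
  {in P, forall b, phi b = \sum_(w <- s) weight_component phi w b}.
Proof.
move=> nphi; exists (undup [seq c - b | c <- enum_fset P, b <- enum_fset P]) => b bP.
set s := undup _.
rewrite [LHS](nil_expand (nphi b bP)) [RHS](bigID (fun w => b + w \in P)) /=.
rewrite [X in _ = _ + X]big1 ?addr0 => [|w bwP]; last first.
  rewrite /weight_component [X in root_coef _ X](nil_expand (nphi b bP)) raddf_sum big_seq big1 ?scale0r //= => c cP.
  rewrite root_coefZ root_coef_e ?pos_root_in //; case: eqP bwP => [->|]; first by rewrite cP.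
  by rewrite mulr0.
rewrite -[RHS]big_filter.
have pE : perm_eq [seq w <- s | b + w \in P] [seq c - b | c <- enum_fset P].
  apply: uniq_perm; first by rewrite filter_uniq ?undup_uniq.
    by rewrite (map_inj_uniq (addIr _)) fset_uniq.
  move=> w; rewrite mem_filter mem_undup; apply/andP/mapP => [[bwP _]|[c cP ->]].
    by exists (b + w); rewrite // addrAC subrr add0r.
  rewrite addrC subrK; split=> //; exact: allpairs_f.
by rewrite (perm_big _ pE) big_map; apply: eq_bigr => c _; rewrite /weight_component addrC subrK.
Qed.

End Derivations.

(** * Derivations of the nilradical modulo inner ones *)

Section OuterDerivations.
Variables (K : numFieldType) (g : lieAlgType K) (D : chevalley_datum g).
Local Notation weight := (dual (cartan D)).
Local Notation H := (cartan D).
Local Notation Phi := (Defs.roots D).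
Local Notation e := (root_vector D).
Implicit Types (a b c : weight) (x y z h : g) (i : 'I_(rank D)).

Local Notation P := (pos_roots D).
Local Notation al i := (tnth (simple_root D) i).

Hypothesis g_simple : simple_lie g.
Variables (mu : weight).
Hypotheses (muP : mu \in P) (mu_top : top_root mu).
Hypothesis rank2 : forall i, exists i', i' != i.

Lemma root_le_mu b : b \in Phi -> weight_le b mu.
Proof. exact: all_below_mu. Qed.

Lemma mu_coord_gt0 i : 0 < simple_coord i mu.
Proof.
have := root_le_mu (simple_root_in i) i; rewrite simple_coord_simple eqxx.
exact: lt_le_trans.
Qed.

Lemma mu_neq i : mu != al i.
Proof.
have [i' ii'] := rank2 i; apply: contraTneq (mu_coord_gt0 i') => ->.
by rewrite simple_coord_simple (negPf ii') ltxx.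
Qed.

(** The string of a_i through mu ends at mu.  As mu is not proportional to a_i, its
    lower part consists of positive roots. *)
Lemma mu_string i : exists p : nat, [/\ wt mu (coroot (al i)) = p%:R,
  forall j : nat, (j <= p)%N -> mu - al i *+ j \in P & mu - al i *+ p.+1 \notin Phi].
Proof.
have iP := simple_root_in i.
have muN : mu != - al i.
  by apply: contraTneq muP => ->; apply: pos_opp; apply: simple_root_in_pos.
have [p [q [pP pN qP _ [wE _]]]] := root_string iP (pos_root_in muP) (mu_neq i) muN.
have q0 : q = 0%N.
  case: q qP {wE} => // q qP; have := mu_top (simple_root_in_pos i).
  by rewrite addrC -[al i]mulr1n qP.
exists p; rewrite wE q0 subr0; split=> // j /pP; rewrite -scaler_nat -scaleNr.
by apply: pos_shift => //; apply: mu_neq.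
Qed.

(** The root gamma_i, as the reflection of mu. *)
Definition mu_refl i := mu - wt mu (coroot (al i)) *: al i.

Lemma mu_refl_pos i : mu_refl i \in P.
Proof.
have [p [wE pP _]] := mu_string i.
by rewrite /mu_refl wE scaler_nat pP.
Qed.

Lemma max_string_mu_refl i m : max_string mu i m -> mu - al i *+ m = mu_refl i.
Proof.
case=> mP mmax; have [p [wE pP pN]] := mu_string i.
rewrite /mu_refl wE scaler_nat; congr (_ - _ *+ _); apply/eqP.
rewrite eqn_leq mmax // andbT leqNgt; apply/negP => pm.
by have := pos_root_in (mP _ pm); rewrite (negPf pN).
Qed.

Lemma mu_refl_coord i i' : i' != i -> simple_coord i' (mu_refl i) = simple_coord i' mu.
Proof.
move=> ii'; rewrite simple_coordD simple_coordN simple_coordZ simple_coord_simple.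
by rewrite (negPf ii') mulr0 subr0.
Qed.

Lemma mu_refl_neq i : mu_refl i != al i.
Proof.
have [i' ii'] := rank2 i; apply: contraTneq (mu_coord_gt0 i') => E.
by rewrite -(mu_refl_coord ii') E simple_coord_simple (negPf ii') ltxx.
Qed.

(** The reflection s_i permutes the positive roots other than a_i and maps a + gamma_i to
    s_i(a) + mu, which is beyond mu. *)
Lemma mu_refl_add_notin i a : a \in P -> a != al i -> a + mu_refl i \notin Phi.
Proof.
move=> aP ai; apply/negP => /(reflection_root (simple_root_in i)).
rewrite wtD [wt (mu_refl i) _]wtD wtN wtZ wt_coroot ?simple_root_in //.
set k := wt a _; set l := wt mu _ => E.
have E2 : a - k *: al i \in P.
  rewrite -scaleNr pos_shift // scaleNr; apply: reflection_root; rewrite ?simple_root_in //.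
  exact: pos_root_in.
have := mu_top E2; apply/negP; rewrite negbK.
suff -> : a - k *: al i + mu = a + mu_refl i - (k + (l - l * 2%:R)) *: al i by [].
rewrite /mu_refl -/l (_ : k + _ = k - l); last by ring.
by rewrite scalerBl opprB addrA [a + (mu - _)]addrA subrK addrAC.
Qed.

(** The derivation b_i. *)
Definition b_der i b : g := if b == al i then e (mu_refl i) else 0.

(** The root a_i is not a sum of positive roots, and [mu_refl_add_notin] says that the root
    vector of gamma_i commutes with the root vectors other than e_i. *)
Lemma der_b i : @root_derivation K g D (b_der i).
Proof.
move=> a b aP bP; rewrite sum_bracket //.
have -> : (if a + b \in P then struct_const a b *: b_der i (a + b) else 0) = 0.
  case: ifP => // _; rewrite /b_der; case: eqP => [E|_]; last by rewrite scaler0.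
  by have := simple_sub_pos i aP; rewrite -E addrAC subrr add0r bP.
have E c : c \in P -> c != al i -> lie (e c) (e (mu_refl i)) = 0.
  move=> cP ci; have := mu_refl_add_notin cP ci.
  by apply: lie_ee0; rewrite ?(pos_root_in cP) ?(pos_root_in (mu_refl_pos i)) ?(pos_add_neq0 cP (mu_refl_pos i)).
rewrite /b_der; have [->|bi] := eqVneq b (al i); have [->|ai] := eqVneq a (al i).
- by rewrite subrr.
- by rewrite E // lie0r subrr.
- by rewrite E // lie0r subrr.
- by rewrite !lie0r subrr.
Qed.

(** The combination of the c_i with coefficients t, of the b_i with coefficients u, and of
    the inner derivation by x. *)
Definition standard_fun (t u : 'I_(rank D) -> K) x b : g :=
  (\sum_i t i * simple_coord i b) *: e b + \sum_i u i *: b_der i b + lie (e b) x.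

Definition standard (phi : weight -> g) := exists t u x, x \in nilspace D /\
  {in P, forall b, phi b = standard_fun t u x b}.

Lemma standard_eq phi psi : {in P, phi =1 psi} -> standard psi -> standard phi.
Proof.
move=> E [t [u [x [xN H1]]]]; exists t, u, x; split=> // b bP.
by rewrite E // H1.
Qed.

Lemma standard_add phi psi : standard phi -> standard psi -> standard (fun b => phi b + psi b).
Proof.
move=> [t [u [x [xN H1]]]] [t' [u' [x' [xN' H2]]]].
exists (fun i => t i + t' i), (fun i => u i + u' i), (x + x').
split=> [|b bP]; first by rewrite memvD.
rewrite H1 // H2 // /standard_fun lieDr.
rewrite [in RHS](eq_bigr (fun i => t i * simple_coord i b + t' i * simple_coord i b)) => [|i _]; last first.
  by rewrite mulrDl.
rewrite [in RHS](eq_bigr (fun i => u i *: b_der i b + u' i *: b_der i b)) => [|i _]; last first.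
  by rewrite scalerDl.
rewrite !big_split /= scalerDl addrACA; congr (_ + _).
by rewrite addrACA.
Qed.

Lemma standard_diag (t : 'I_(rank D) -> K) : standard (fun b => (\sum_i t i * simple_coord i b) *: e b).
Proof.
exists t, (fun=> 0), 0; split=> [|b bP]; first exact: mem0v.
by rewrite /standard_fun lie0r addr0 [X in _ + X]big1 ?addr0 // => i _; rewrite scale0r.
Qed.

Lemma standard_inner x : x \in nilspace D -> standard (fun b => lie (e b) x).
Proof.
move=> xN; exists (fun=> 0), (fun=> 0), x; split=> // b bP.
rewrite /standard_fun big1 => [|i _]; last by rewrite mul0r.
by rewrite scale0r add0r big1 ?add0r // => i _; rewrite scale0r.
Qed.

Lemma standard_b i (k : K) : standard (fun b => k *: b_der i b).
Proof.
exists (fun=> 0), (fun i' => if i' == i then k else 0), 0; split=> [|b bP]; first exact: mem0v.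
rewrite /standard_fun big1 => [|i' _]; last by rewrite mul0r.
rewrite scale0r add0r lie0r addr0 (bigD1 i) //= eqxx big1 ?addr0 // => i' /negPf ->.
by rewrite scale0r.
Qed.

Lemma standard0 : standard (fun=> 0).
Proof. by apply: standard_eq (standard_inner (mem0v _)) => b _; rewrite lie0r. Qed.

Lemma standard_on_simple phi psi : root_derivation phi -> root_derivation psi -> (forall i, phi (al i) = psi (al i)) ->
  standard psi -> standard phi.
Proof.
move=> dphi dpsi E; apply: standard_eq => b bP; apply/eqP; rewrite -subr_eq0; apply/eqP.
apply: (der_eq0 (der_sub dphi dpsi)) => // i.
by rewrite E subrr.
Qed.

(** A derivation homogeneous of weight w: diagonal if w = 0, inner if the homotopy constant
    is nonzero, and a multiple of one b_i otherwise. *)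
Lemma standard_homogeneous phi (w : weight) : root_derivation phi ->
  {in P, forall b, exists2 z : K, phi b = z *: e (b + w) & b + w \notin P -> z = 0} ->
  standard phi.
Proof.
move=> dphi phiw; have [w0|w0] := eqVneq w 0.
  pose t i := root_coef (al i) (phi (al i)).
  apply: (standard_on_simple dphi _ _ (standard_diag t)) => [|i].
    apply: der_diag => a b; rewrite -big_split; apply: eq_bigr => i _ /=.
    by rewrite simple_coordD mulrDr.
  rewrite (bigD1 i) //= simple_coord_simple eqxx mulr1 big1 ?addr0 => [|i' ii']; last first.
    by rewrite simple_coord_simple (negPf ii') mulr0.
  have [z zE _] := phiw _ (simple_root_in_pos i).
  by rewrite /t zE w0 addr0 root_coefZ root_coef_e ?simple_root_in // eqxx mulr1.
have hom i : lie (e (al i)) (homotopy_vector phi) = homotopy_const w *: phi (al i).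
  have [z zE z0] := phiw _ (simple_root_in_pos i); case: (boolP (al i + w \in P)) => aw.
    apply: homotopy_weight => //; first by rewrite addrC pos_root_in.
    by exists z; rewrite addrC.
  rewrite homotopy // zE (z0 aw) scale0r scaler0 lie0r add0r big1 // => a _.
  by rewrite !lie0r.
have homw : homotopy_vector phi \in rootspace w.
  rewrite /homotopy_vector big_seq memv_suml // => a aP; have [z -> z0] := phiw _ aP.
  case: (boolP (a + w \in P)) => aw; last by rewrite (z0 aw) scale0r lie0r mem0v.
  rewrite lieZr memvZ // -[X in rootspace X](addKr a); apply: lie_rootspace.
    by apply: dual_vector_rootspace; apply: pos_root_in.
  by apply: e_rootspace; apply: pos_root_in.
have [c0|c0] := eqVneq (homotopy_const w) 0; last first.
  (* phi is ad x on n; x has weight w, so x is in n or vanishes *)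
  pose x := (homotopy_const w)^-1 *: homotopy_vector phi.
  have xw : x \in rootspace w by rewrite memvZ.
  have phiE i : phi (al i) = lie (e (al i)) x.
    by rewrite lieZr hom scalerA mulVf // scale1r.
  have phiE' : {in P, forall b, phi b = lie (e b) x}.
    move=> b bP; apply/eqP; rewrite -subr_eq0; apply/eqP.
    apply: (der_eq0 (der_sub dphi (@der_inner _ _ _ x))) => // i.
    by rewrite phiE subrr.
  suff xN : x \in nilspace D by apply: standard_eq phiE' (standard_inner xN).
  case: (boolP (w \in Phi)) => wP; last by rewrite (rootspace_notin w0 wP xw) mem0v.
  have [k xE] : exists k : K, x = k *: e w by exists (root_coef w x); apply: rootspace_line.
  have /orP[wP'|wP'] := root_pos_or_neg wP; first by rewrite xE memvZ // root_vector_nil.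
  have := phiE' _ wP'; have [z -> z0] := phiw _ wP'.
  rewrite z0 ?addNr ?scale0r; last by apply/negP => /pos_root_in/root_neq0; rewrite eqxx.
  rewrite xE lieZr lieC -/(coroot w) => /esym/eqP.
  rewrite scaler_eq0 oppr_eq0 => /orP[/eqP -> |/eqP h0]; first by rewrite scale0r mem0v.
  have := wt_coroot wP; rewrite h0 linear0 => /esym/eqP.
  by rewrite pnatr_eq0.
(* a nonzero value on e_i forces w = gamma_i - a_i *)
have key i : phi (al i) != 0 -> al i + w = mu_refl i.
  have [z zE z0] := phiw _ (simple_root_in_pos i); case: (boolP (al i + w \in P)) => aw; last first.
    by rewrite zE (z0 aw) scale0r eqxx.
  move=> _; have wiP : w + al i \in Phi by rewrite addrC pos_root_in.
  have [dP dt] := homotopy_const_eq0 wiP c0.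
  have dP' := top_root_pos dP dt.
  have dmu : w + al i - wt (w + al i) (coroot (al i)) *: al i = mu.
    by apply: top_root_unique => // a /dt[].
  rewrite addrC /mu_refl -dmu; move: (w + al i) => c; rewrite wtD wtN wtZ wt_coroot ?simple_root_in //.
  set k := wt _ _; rewrite -addrA -opprD -scalerDl.
  have -> : k + (k - k * 2%:R) = 0 by ring.
  by rewrite scale0r subr0.
have [/forallP E|] := boolP [forall i, phi (al i) == 0].
  apply: (standard_on_simple dphi (@der_inner _ _ _ 0) _ (standard_inner (mem0v _))) => i.
  by rewrite lie0r; apply/eqP.
rewrite negb_forall => /existsP[i phii].
have wi := key i phii; have [z zE _] := phiw _ (simple_root_in_pos i).
apply: (standard_on_simple dphi (der_scale z (@der_b i)) _ (standard_b i z)) => i'.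
rewrite /b_der; have [E|ii'] := eqVneq (al i') (al i).
  by rewrite E zE wi.
rewrite scaler0; apply/eqP; apply: contraT => /key wi'.
have {}ii' : i != i' by apply: contraNneq ii' => ->.
have [p [pE _ _]] := mu_string i.
have E : mu_refl i - al i = mu_refl i' - al i' by rewrite -wi -wi' addrAC subrr add0r addrAC subrr add0r.
have C : simple_coord i (mu_refl i) = simple_coord i mu - p%:R.
  by rewrite simple_coordD simple_coordN simple_coordZ simple_coord_simple eqxx mulr1 pE.
move/(congr1 (simple_coord i)): E; rewrite (simple_coordD i (mu_refl i)) C.
rewrite (simple_coordD i (mu_refl i')) (mu_refl_coord ii') !simple_coordN !simple_coord_simple.
rewrite eqxx (negPf ii') subr0 => /eqP; rewrite -subr_eq0.
have -> : simple_coord i mu - p%:R - 1 - simple_coord i mu = - (p.+1)%:R.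
  by rewrite -natr1; ring.
by rewrite oppr_eq0 pnatr_eq0.
Qed.

Theorem der_standard phi : root_derivation phi -> nil_valued phi -> standard phi.
Proof.
move=> dphi nphi; have [s sE] := sum_weight_component nphi; apply: standard_eq sE _.
elim: s => [|w s IH].
  by apply: standard_eq standard0 => b _; rewrite big_nil.
have W : standard (weight_component phi w).
  apply: (@standard_homogeneous _ w); first exact: der_weight_component.
  move=> b bP; exists (root_coef (b + w) (phi b)) => // bw.
  rewrite [X in root_coef _ X](nil_expand (nphi b bP)) raddf_sum big_seq big1 //= => c cP.
  rewrite root_coefZ root_coef_e ?pos_root_in //; case: eqP bw => [->|]; first by rewrite cP.
  by rewrite mulr0.
by apply: standard_eq (standard_add W IH) => b _; rewrite big_cons.
Qed.

End OuterDerivations.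

(** * Cochains of degree at most one *)

Section LowDegreeCochains.
Variables (K : fieldType) (L : lieAlgType K) (I : finType) (e : I -> L).
Hypothesis basis_e : basis_of fullv (codom_tuple e).
Local Notation cochain := (cochain L I).
Implicit Types (phi psi : cochain) (S : {set I}) (s : seq I).

Lemma signK n (x : L) : (-1) ^+ n *: ((-1) ^+ n *: x) = x.
Proof. by rewrite scalerA -expr2 sqrr_sign scale1r. Qed.

(** The defining span consists of the cochains supported on sets of size k.  The signs are
    those by which [monomial] compares a sequence with its sorted version. *)
Lemma cochainsP k phi :
  reflect (forall S, #|S| != k -> phi S = 0) (phi \in cochains e k).
Proof.
apply: (iffP idP) => [|phi0].
  rewrite /cochains; set s := [seq _ | _ <- _, _ <- _].
  rewrite -[s]/(tval (in_tuple s)) => /coord_span -> S Sk.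
  rewrite sum_ffunE big1 // => i _; rewrite ffunE.
  have /allpairsP[[c A] /= [_ ]] : s`_i \in s by apply: mem_nth.
  rewrite mem_enum inE => Ak ->; rewrite ffunE.
  case: ifP => [/andP[_ /eqP SE]|_]; last by rewrite scaler0.
  by move: Sk; rewrite SE set_enum Ak.
have -> : phi = \sum_(A : {set I} | #|A| == k) \sum_c
    ((-1) ^+ inversions (enum A) * dual_coord e c (phi A)) *: monomial e c (enum A).
  apply/ffunP => S; rewrite sum_ffunE; case: (eqVneq #|S| k) => Sk; last first.
    rewrite phi0 // big1 // => A Ak; rewrite sum_ffunE big1 // => c _.
    rewrite !ffunE set_enum; case: ifP => [/andP[_ /eqP SE]|_]; last by rewrite scaler0.
    by rewrite SE Ak in Sk.
  rewrite (bigD1 S) ?Sk //= [X in _ + X]big1 => [|A /andP[_ AS]]; last first.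
    rewrite sum_ffunE big1 // => c _; rewrite !ffunE set_enum eq_sym (negPf AS) andbF.
    by rewrite scaler0.
  rewrite addr0 sum_ffunE {1}(dual_coordK basis_e (phi S)); apply: eq_bigr => c _.
  by rewrite !ffunE set_enum eqxx enum_uniq /= mulrC -scalerA signK.
rewrite memv_suml // => A Ak; rewrite memv_suml // => c _.
rewrite memvZ // memv_span //; apply/allpairsP; exists (c, A).
by split; rewrite /= ?mem_enum ?inE.
Qed.

Lemma cochains_eval0 k phi s : phi \in cochains e k -> size s != k ->
  cochain_eval phi s = 0.
Proof.
move/cochainsP => phi0 sk; rewrite /cochain_eval; case: ifP => // us.
by rewrite phi0 ?scaler0 // cardsE (card_uniqP us).
Qed.

Lemma size_omit k s : (k < size s)%N -> size (omit k s) = (size s).-1.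
Proof.
move=> ks; rewrite size_cat size_takel ?size_drop; last exact: ltnW.
by rewrite -[in RHS](subnKC ks) addSn.
Qed.

(** Every term of the differential evaluates phi on one index fewer. *)
Lemma differential_eq0 k phi S : phi \in cochains e k -> #|S| != k.+1 ->
  differential e phi S = 0.
Proof.
move=> phik Sk; rewrite ffunE [X in X + _]big1 ?add0r => [|i _]; last first.
  rewrite (cochains_eval0 phik) ?lie0r ?scaler0 // size_omit -?cardE //.
  by apply: contra Sk => /eqP <-; rewrite prednK // (leq_ltn_trans _ (ltn_ord i)).
rewrite big1 // => i _; rewrite big1 // => j ij; rewrite big1 ?scaler0 // => l _.
have S0 : (0 < #|S|)%N by rewrite (leq_ltn_trans _ (ltn_ord i)).
have iS : (i < #|S|.-1)%N.
  by rewrite -ltnS prednK // (leq_ltn_trans ij).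
rewrite (cochains_eval0 phik) ?scaler0 //= !size_omit -?cardE //.
rewrite prednK ?(leq_ltn_trans _ iS) //.
by apply: contra Sk => /eqP <-; rewrite prednK.
Qed.

Lemma cochain_eval1 phi a : cochain_eval phi [:: a] = phi [set a].
Proof. by rewrite /cochain_eval /= scale1r set_seq1. Qed.

Lemma differential0 phi a : differential e phi [set a] = lie (e a) (phi set0).
Proof.
rewrite ffunE; have F (i : 'I_#|[set a]|) : enum_val i = a.
  by have := enum_valP i; rewrite inE => /eqP.
rewrite [X in _ + X]big1 ?addr0 => [|i _]; last first.
  have z (k : 'I_#|[set a]|) : k = 0%N :> nat.
    by apply/eqP; rewrite -leqn0 -ltnS -[X in (_ < X)%N](cards1 a) ltn_ord.
  by rewrite big1 // => j; rewrite !z.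
rewrite (eq_bigr (fun i : 'I_#|[set a]| => (fun m : nat => (-1) ^+ m *: lie (e a) (cochain_eval phi (omit m [:: a]))) i)).
  by rewrite cards1 big_ord1 /= scale1r /cochain_eval /= scale1r set_nil.
by move=> i _; rewrite F enum_set1.
Qed.

Lemma differential1 phi S a b : enum S = [:: a; b] -> differential e phi S =
  lie (e a) (phi [set b]) - lie (e b) (phi [set a]) -
  \sum_l dual_coord e l (lie (e a) (e b)) *: phi [set l].
Proof.
move=> ES; have S2 : #|S| = 2%N by rewrite cardE ES.
have F (i : 'I_#|S|) : enum_val i = nth a [:: a; b] i by rewrite (enum_val_nth a) ES.
rewrite ffunE; congr (_ + _).
  rewrite (eq_bigr (fun i : 'I_#|S| => (fun m : nat => (-1) ^+ m *:
    lie (e (nth a [:: a; b] m)) (cochain_eval phi (omit m [:: a; b]))) i)) => [|i _].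
    rewrite S2 big_ord_recl big_ord1 /= !cochain_eval1 scale1r.
    by rewrite [bump 0 0]/= expr1 scaleN1r.
  by rewrite F ES.
rewrite (eq_bigr (fun i : 'I_#|S| => (fun m : nat => \sum_(j < #|S| | (m < j)%N)
   (fun p : nat => (-1) ^+ (m + p) *: \sum_l dual_coord e l
    (lie (e (nth a [:: a; b] m)) (e (nth a [:: a; b] p))) *:
      cochain_eval phi (l :: omit m (omit p [:: a; b]))) j) i)) => [|i _]; last first.
  by apply: eq_bigr => j _; rewrite !F ES.
rewrite S2 big_ord_recl big_ord1 /= [X in _ + X]big1 => [|j]; last first.
  by rewrite ltnNge -ltnS ltn_ord.
rewrite addr0 big_mkcond big_ord_recl big_ord1 /= add0r expr1 scaleN1r.
by congr (- _); apply: eq_bigr => l _; rewrite cochain_eval1.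
Qed.

(** The condition of being a cocycle, for a cochain of degree 1 seen as a linear map
    e_a |-> phi {a}. *)
Definition derivation phi := forall a b,
  lie (e a) (phi [set b]) - lie (e b) (phi [set a]) =
  \sum_l dual_coord e l (lie (e a) (e b)) *: phi [set l].

(** The differential at a pair {a, b} is the defect of the Leibniz rule, up to sign. *)
Lemma cocycles1P phi : reflect (phi \in cochains e 1 /\ derivation phi)
  (phi \in cocycles e 1).
Proof.
rewrite memv_cap memv_ker lfunE /=; apply: (iffP andP) => [[phi1 /eqP d0]|[phi1 dphi]].
  split=> // a b; have [->|ab] := eqVneq a b.
    by rewrite subrr liexx big1 // => l _; rewrite [dual_coord _ _ _]linear0 scale0r.
  have S2 : #|[set a; b]| = 2%N by rewrite cards2 ab.
  have Se : size (enum [set a; b]) = 2%N by rewrite -cardE.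
  case ES : (enum [set a; b]) Se => [|x [|y [|]]] // _.
  have := congr1 (fun f : cochain => f [set a; b]) d0; rewrite (differential1 phi ES) ffunE => d2.
  have [ax ay] : a \in [:: x; y] /\ b \in [:: x; y].
    by rewrite -ES !mem_enum !inE !eqxx orbT.
  have xy : x != y by have := enum_uniq [set a; b]; rewrite ES /= inE andbT.
  move: ax ay ab; rewrite !inE => /orP[]/eqP -> /orP[]/eqP ->; rewrite ?eqxx // => _.
    by apply/eqP; rewrite -subr_eq0 d2.
  rewrite (eq_bigr (fun l => - (dual_coord e l (lie (e x) (e y)) *: phi [set l]))).
    by rewrite sumrN; move/eqP: d2; rewrite subr_eq0 => /eqP <-; rewrite opprB.
  by move=> l _; rewrite lieC [dual_coord _ _ _]linearN scaleNr.
split=> //; apply/eqP/ffunP => S; rewrite [RHS]ffunE.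
have [S2|S2] := eqVneq #|S| 2%N; last exact: differential_eq0 phi1 S2.
case ES : (enum S) S2 => [|x [|y [|? ?]]]; rewrite cardE ES // => _.
by rewrite (differential1 phi ES) dphi subrr.
Qed.

Lemma differential_C0 phi : phi \in cochains e 0 -> differential e phi \in cochains e 1.
Proof. by move=> phi0; apply/cochainsP => S S1; apply: differential_eq0 phi0 S1. Qed.

(** The coboundary of x, that is e_a |-> [e_a, x]. *)
Definition inner_cochain x : cochain :=
  [ffun S => \sum_(a | S == [set a]) lie (e a) x].

Lemma inner_cochainE x a : inner_cochain x [set a] = lie (e a) x.
Proof.
by rewrite ffunE (big_pred1 a) // => b; rewrite (inj_eq set1_inj) eq_sym.
Qed.

Lemma cochain1_eq phi psi : phi \in cochains e 1 -> psi \in cochains e 1 ->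
  (forall a, phi [set a] = psi [set a]) -> phi = psi.
Proof.
move=> /cochainsP phi1 /cochainsP psi1 E; apply/ffunP => S.
have [/eqP/cards1P[a ->]|S1] := eqVneq #|S| 1%N; first exact: E.
by rewrite phi1 ?psi1.
Qed.

Lemma inner_cochain_C1 x : inner_cochain x \in cochains e 1.
Proof.
apply/cochainsP => S S1; rewrite ffunE big_pred0 // => a.
by apply: contraNF S1 => /eqP ->; rewrite cards1.
Qed.

Lemma coboundaries1P phi : reflect (exists x, phi = inner_cochain x) (phi \in coboundaries e 1).
Proof.
apply: (iffP memv_imgP) => [[psi psi0 ->]|[x ->]].
  exists (psi set0); rewrite lfunE; apply: cochain1_eq => [||a].
  - exact: differential_C0.
  - exact: inner_cochain_C1.
  - by rewrite inner_cochainE; apply: differential0.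
pose psi : cochain := [ffun S => if S == set0 then x else 0].
have psi0 : psi \in cochains e 0.
  by apply/cochainsP => S; rewrite cards_eq0 ffunE => /negPf ->.
exists psi => //; rewrite lfunE; apply: cochain1_eq => [||a].
- exact: inner_cochain_C1.
- exact: differential_C0.
- by rewrite inner_cochainE /= differential0 ffunE eqxx.
Qed.

End LowDegreeCochains.

(** * The bracket in degree one *)

(** The cancellations in the commutator of two derivations perturbed by inner ones. *)
Lemma commutator_sum (V : zmodType) (A B C D E F G M : V) :
  ((A - (B + C)) - (D - E)) + (- F - - (D + G) - - (B - M)) + (- A - - F) =
  G - C + (E - M).
Proof.
rewrite !opprD !opprK !addrA.
rewrite [LHS](ACl ((1*11)*(2*9)*(4*7)*(6*12)*((8*3)*5*10)))/=.
by rewrite subrr !addNr !add0r.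
Qed.

Section CohomologyBracket.
Variables (K : fieldType) (L : lieAlgType K) (I : finType) (e : I -> L).
Hypothesis basis_e : basis_of fullv (codom_tuple e).
Local Notation cochain := (cochain L I).
Implicit Types (phi psi : cochain) (S : {set I}) (s : seq I).

(** The linear endomorphism of L given by a cochain of degree 1. *)
Definition cochain_fun phi (x : L) : L := \sum_k dual_coord e k x *: phi [set k].

Fact cochain_fun_is_linear phi : linear (cochain_fun phi).
Proof.
move=> k x y; rewrite /cochain_fun scaler_sumr -big_split; apply: eq_bigr => l _ /=.
by rewrite [dual_coord _ _ _]linearP scalerDl scalerA.
Qed.
HB.instance Definition _ phi := GRing.isLinear.Build K L L _ (cochain_fun phi) (cochain_fun_is_linear phi).

Lemma cochain_fun_e phi k : cochain_fun phi (e k) = phi [set k].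
Proof.
rewrite /cochain_fun (bigD1 k) //= big1 => [|l lk]; rewrite dual_coord_basis //.
  by rewrite eqxx scale1r addr0.
by rewrite (negPf lk) scale0r.
Qed.

Lemma cochain_funB phi psi x : cochain_fun (phi - psi) x = cochain_fun phi x - cochain_fun psi x.
Proof.
by rewrite /cochain_fun -sumrB; apply: eq_bigr => k _; rewrite !ffunE scalerBr.
Qed.

Lemma cochain_fun_inner y x : cochain_fun (inner_cochain e y) x = lie x y.
Proof.
rewrite {2}(dual_coordK basis_e x) lie_suml; apply: eq_bigr => k _.
by rewrite inner_cochainE lieZl.
Qed.

Lemma lie_sum2 (u w : I -> K) (F G : I -> L) :
  lie (\sum_i u i *: F i) (\sum_j w j *: G j) =
  \sum_i \sum_j (u i * w j) *: lie (F i) (G j).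
Proof.
rewrite lie_suml; apply: eq_bigr => i _; rewrite lie_sumr; apply: eq_bigr => j _.
by rewrite lieZl lieZr scalerA.
Qed.

Lemma cochain_fun_derivation phi x y : derivation e phi ->
  cochain_fun phi (lie x y) = lie (cochain_fun phi x) y + lie x (cochain_fun phi y).
Proof.
move=> dphi; rewrite {1 3}(dual_coordK basis_e x) {1 2}(dual_coordK basis_e y).
rewrite {2 3}/cochain_fun !lie_sum2 raddf_sum -big_split; apply: eq_bigr => i _ /=.
rewrite raddf_sum -big_split; apply: eq_bigr => j _ /=.
rewrite linearZ /= -scalerDr; congr (_ *: _).
by rewrite {1}/cochain_fun -dphi addrC; congr (_ + _); rewrite lieC opprK.
Qed.

Lemma sum_card1 (V : nmodType) (F : {set I} -> V) :
  (forall S, #|S| != 1%N -> F S = 0) -> \sum_S F S = \sum_k F [set k].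
Proof.
move=> F0; rewrite (bigID (fun S : {set I} => #|S| == 1%N)) /= [X in _ + X]big1 // addr0.
have inj : {in predT &, injective (@set1 I)} by move=> ? ? _ _; apply: set1_inj.
rewrite -(big_imset F inj) /=.
apply: eq_bigl => S; apply/idP/imsetP => [/cards1P[k ->]|[k _ ->]]; first by exists k.
by rewrite cards1.
Qed.

Lemma monomial1 c k l : monomial e c [:: k] [set l] = (k == l)%:R *: e c.
Proof.
rewrite ffunE /= set_seq1 (inj_eq set1_inj) eq_sym scale1r.
by case: eqP; rewrite ?scale1r ?scale0r.
Qed.

Lemma monomial_C1 c k : monomial e c [:: k] \in cochains e 1.
Proof.
apply/(cochainsP basis_e) => S S1; rewrite ffunE /= set_seq1.
by case: eqP => [SE|] //; rewrite SE cards1 in S1.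
Qed.

Lemma monomial_dot1 c k c' l :
  monomial_dot e c [:: k] c' [:: l] = (k == c')%:R *: monomial e c [:: l].
Proof.
rewrite /monomial_dot big_ord1 subnn expr0 scale1r /=; congr (_ *: _).
by rewrite (tnth_nth k) /= dual_coord_basis.
Qed.

Lemma cochain_dot1E phi psi : phi \in cochains e 1 -> psi \in cochains e 1 ->
  cochain_dot e phi psi = \sum_l \sum_k \sum_c
    (dual_coord e c (phi [set k]) * dual_coord e k (psi [set l])) *: monomial e c [:: l].
Proof.
move=> /(cochainsP basis_e) phi1 /(cochainsP basis_e) psi1; rewrite /cochain_dot.
transitivity (\sum_c \sum_k \sum_c' \sum_l
   (dual_coord e c (phi [set k]) * dual_coord e c' (psi [set l])) *:
     ((k == c')%:R *: monomial e c [:: l])).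
  apply: eq_bigr => c _; rewrite sum_card1 => [|S S1]; last first.
    rewrite big1 // => c' _; rewrite big1 // => S' _.
    by rewrite phi1 // [dual_coord _ _ _]linear0 mul0r scale0r.
  apply: eq_bigr => k _; apply: eq_bigr => c' _.
  rewrite sum_card1 => [|S S1]; last by rewrite psi1 // [dual_coord _ _ 0]linear0 mulr0 scale0r.
  by apply: eq_bigr => l _; rewrite !enum_set1 monomial_dot1.
transitivity (\sum_c \sum_k \sum_l
    (dual_coord e c (phi [set k]) * dual_coord e k (psi [set l])) *: monomial e c [:: l]).
  apply: eq_bigr => c _; apply: eq_bigr => k _; rewrite (bigD1 k) //= [X in _ + X]big1 ?addr0.
    by apply: eq_bigr => l _; rewrite eqxx scale1r.
  by move=> c' ck; rewrite big1 // => l _; rewrite eq_sym (negPf ck) scale0r scaler0.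
rewrite exchange_big /=; under eq_bigr do rewrite exchange_big /=.
by rewrite exchange_big.
Qed.

Lemma cochain_dot_C1 phi psi : phi \in cochains e 1 -> psi \in cochains e 1 ->
  cochain_dot e phi psi \in cochains e 1.
Proof.
move=> phi1 psi1; rewrite cochain_dot1E // memv_suml // => l _.
rewrite memv_suml // => k _; rewrite memv_suml // => c _.
by rewrite memvZ // monomial_C1.
Qed.

Lemma cochain_dot1 phi psi l : phi \in cochains e 1 -> psi \in cochains e 1 ->
  cochain_dot e phi psi [set l] = cochain_fun phi (psi [set l]).
Proof.
move=> phi1 psi1; rewrite cochain_dot1E // sum_ffunE (bigD1 l) //= [X in _ + X]big1 ?addr0.
  rewrite sum_ffunE; apply: eq_bigr => k _; rewrite sum_ffunE.
  rewrite {2}(dual_coordK basis_e (phi [set k])) scaler_sumr; apply: eq_bigr => c _.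
  by rewrite ffunE monomial1 eqxx scale1r scalerA mulrC.
move=> l' ll'; rewrite sum_ffunE big1 // => k _; rewrite sum_ffunE big1 // => c _.
by rewrite ffunE monomial1 (negPf ll') scale0r scaler0.
Qed.

Lemma bracket_C1 phi psi : phi \in cochains e 1 -> psi \in cochains e 1 ->
  cochain_bracket e 1 1 phi psi \in cochains e 1.
Proof. by move=> phi1 psi1; rewrite memvB ?memvZ ?cochain_dot_C1. Qed.

Lemma bracket1 phi psi l : phi \in cochains e 1 -> psi \in cochains e 1 ->
  cochain_bracket e 1 1 phi psi [set l] = cochain_fun phi (psi [set l]) - cochain_fun psi (phi [set l]).
Proof.
move=> phi1 psi1; rewrite !ffunE !cochain_dot1 //.
by rewrite -signr_odd expr0 scale1r.
Qed.

Lemma cohom_class_eq phi psi : phi - psi \in coboundaries e 1 ->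
  cohom_class e 1 phi = cohom_class e 1 psi.
Proof.
move=> B; apply/eqP; rewrite -subr_eq0 -linearB quot_proj_eq0; exact: B.
Qed.

Lemma quot_repr_class phi : exists y, quot_repr (cohom_class e 1 phi) = phi - inner_cochain e y.
Proof.
rewrite /quot_repr quot_projE.
have /(coboundaries1P basis_e)[y ->] := memv_proj (coboundaries e 1) phi.
by exists y.
Qed.

(** The representatives chosen by the quotient differ from phi and psi by inner
    derivations.  The commutator of derivations is compatible with this, since
    [phi, ad z] = ad (phi z) for a derivation phi. *)
Lemma cohom_bracket_class phi psi : phi \in cocycles e 1 -> psi \in cocycles e 1 ->
  @cohom_bracket _ _ _ e 1 1 (cohom_class e 1 phi) (cohom_class e 1 psi) =
  cohom_class e 1 (cochain_bracket e 1 1 phi psi).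
Proof.
move=> /(cocycles1P basis_e)[phi1 dphi] /(cocycles1P basis_e)[psi1 dpsi].
rewrite /cohom_bracket.
have [y ->] := quot_repr_class phi; have [z ->] := quot_repr_class psi.
apply: cohom_class_eq; apply/(coboundaries1P basis_e).
have I1 x : inner_cochain e x \in cochains e 1 by apply: inner_cochain_C1.
exists (cochain_fun psi y - cochain_fun phi z + lie z y); apply: (cochain1_eq basis_e) => [||a].
- by rewrite memvB // bracket_C1 // memvB.
- exact: I1.
rewrite ffunE [X in _ + X]ffunE !bracket1 ?memvB // inner_cochainE !cochain_funB !cochain_fun_inner.
have E (f f' : cochain) S : (f - f') S = f S - f' S by rewrite !ffunE.
rewrite !E !inner_cochainE !linearB /= !cochain_fun_derivation // !cochain_fun_e.
set x := e a; set p := phi [set a]; set q := psi [set a].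
rewrite !lieDr lieNr (lie_leibniz x z y) (lieC z (lie x y)).
rewrite [lie (q - _) y]lieDl [lie (p - _) z]lieDl !lieNl.
exact: commutator_sum.
Qed.
End CohomologyBracket.

(** * Recognizing sl(k) from a basis *)

Section IsomSl.
Variables (K : fieldType) (L : lieAlgType K) (k n : nat).
Variables (X : n.-tuple L) (M : 'I_n -> 'M[K]_k).
Hypothesis basis_X : basis_of fullv X.

Definition mx_rep (x : L) : 'M[K]_k := \sum_t coord X t x *: M t.

Fact mx_rep_is_linear : linear mx_rep.
Proof.
move=> c x y; rewrite /mx_rep scaler_sumr -big_split; apply: eq_bigr => t _ /=.
by rewrite linearP scalerDl scalerA.
Qed.
HB.instance Definition _ := GRing.isLinear.Build K L 'M[K]_k _ mx_rep mx_rep_is_linear.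

Lemma mx_repZ c x : mx_rep (c *: x) = c *: mx_rep x.
Proof. exact: linearZ. Qed.

Lemma mx_repN x : mx_rep (- x) = - mx_rep x.
Proof. exact: linearN. Qed.
Lemma mx_rep0 : mx_rep 0 = 0.
Proof. exact: linear0. Qed.

Lemma mx_rep_basis (t : 'I_n) : mx_rep X`_t = M t.
Proof.
rewrite /mx_rep (bigD1 t) //= big1 => [|s st]; rewrite coord_free ?(basis_free basis_X) //.
  by rewrite eqxx scale1r addr0.
by rewrite eq_sym (negPf st) scale0r.
Qed.

(** The elements x such that [mx_rep] is compatible with the bracket by x.  They form a
    Lie subalgebra, so that only generators have to be checked. *)
Definition repr_ad (x : L) := forall y,
  mx_rep (lie x y) = mx_rep x *m mx_rep y - mx_rep y *m mx_rep x.

Lemma repr_adD x x' : repr_ad x -> repr_ad x' -> repr_ad (x + x').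
Proof.
move=> Sx Sx' y; rewrite lieDl !(linearD mx_rep) /= Sx Sx' mulmxDl mulmxDr opprD.
by rewrite addrACA.
Qed.

Lemma repr_adZ c x : repr_ad x -> repr_ad (c *: x).
Proof.
by move=> Sx y; rewrite lieZl !mx_repZ Sx scalerBr scalemxAl scalemxAr.
Qed.

Lemma repr_ad_lie x x' : repr_ad x -> repr_ad x' -> repr_ad (lie x x').
Proof.
move=> Sx Sx' y; rewrite lie_lie linearB /= !(Sx, Sx').
rewrite !mulmxBl !mulmxBr !mulmxA.
have AC (V : zmodType) (A B C E F G : V) :
    (A - B - (C - E)) - (F - C - (B - G)) = (A - F) - (G - E).
  rewrite !opprD !opprK !addrA [LHS](ACl ((2*7)*(3*6)*(1*5*8*4)))/=.
  by rewrite !addNr !add0r.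
exact: AC.
Qed.

Lemma repr_ad_basis x : (forall t : 'I_n, mx_rep (lie x X`_t) = mx_rep x *m M t - M t *m mx_rep x) ->
  repr_ad x.
Proof.
move=> Sx y; rewrite {1}(coord_basis basis_X (memvf y)) lie_sumr raddf_sum.
rewrite {2 3}/mx_rep; set a := mx_rep x; rewrite mulmx_sumr mulmx_suml -sumrB.
apply: eq_bigr => t _; rewrite lieZr /= mx_repZ Sx scalerBr.
by rewrite scalemxAr scalemxAl.
Qed.

Lemma isom_sl_of_repr : (forall t, \tr (M t) = 0) ->
  (forall A, \tr A = 0 -> exists c : 'I_n -> K, A = \sum_t c t *: M t) ->
  (forall c : 'I_n -> K, \sum_t c t *: M t = 0 -> forall t, c t = 0) ->
  (forall t : 'I_n, repr_ad X`_t) -> isom_sl L k.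
Proof.
move=> trM spanM freeM SX; exists (linfun mx_rep); split=> [|A|x y].
- apply/eqP; rewrite -subv0; apply/subvP => x; rewrite memv_ker lfunE /= memv0 => /eqP x0.
  rewrite (coord_basis basis_X (memvf x)) big1 // => t _.
  by rewrite (freeM _ x0) scale0r.
- apply/memv_imgP/eqP => [[x _ ->]|/spanM[c ->]].
    rewrite lfunE /= /mx_rep raddf_sum /= big1 // => t _.
    by rewrite mxtraceZ trM mulr0.
  exists (\sum_t c t *: X`_t); first exact: memvf.
  by rewrite lfunE raddf_sum; apply: eq_bigr => t _; rewrite /= mx_repZ mx_rep_basis.
rewrite !lfunE /=; suff Sx : repr_ad x by [].
rewrite (coord_basis basis_X (memvf x)); elim/big_ind: _ => [y'|x1 x2|t _].
- by rewrite lie0l !linear0 mul0mx ?mulmx0 ?subrr ?oppr0 ?addr0.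
- exact: repr_adD.
- by apply: repr_adZ.
Qed.
End IsomSl.

(** The matrix units, with indices in nat so that comparisons of indices compute. *)
Definition unit_mx (K : fieldType) k (r s : nat) : 'M[K]_k :=
  \matrix_(i, j) ((val i == r) && (val j == s))%:R.

(** Entries indexed by nat compute under a case analysis on ordinals. *)
Lemma mx_natE (K : fieldType) k (A : 'M[K]_k) :
  exists f : nat -> nat -> K, forall i j, A i j = f i j.
Proof.
case: k A => [|k] A; first by exists (fun _ _ => 0) => -[].
by exists (fun r s => A (inord r) (inord s)) => i j; rewrite !inord_val.
Qed.

Lemma unit_mx_mul (K : fieldType) k r s t u : (s < k)%N ->
  unit_mx K k r s *m unit_mx K k t u = if s == t then unit_mx K k r u else 0.
Proof.
move=> sk; apply/matrixP => i j; rewrite !mxE (bigD1 (Ordinal sk)) //= big1 => [|l ls].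
  rewrite !mxE /= eqxx andbT addr0.
  by case: (s == t); rewrite /= ?mxE ?mulr0 // -natrM mulnb.
rewrite !mxE; have /negPf -> : val l != s by rewrite -[s]/(val (Ordinal sk)) (inj_eq val_inj).
by rewrite andbF mul0r.
Qed.

Ltac mx_units := rewrite ?(mulmxBl, mulmxBr) ?unit_mx_mul //=
  ?(subr0, sub0r, oppr0, opprK, opprB, opprD, scaler_nat, mulr2n, addr0, add0r, subrr) //.

Section Sl2.
Variables (K : numFieldType) (L : lieAlgType K) (h x y : L).
Hypothesis basis_X : basis_of fullv [:: h; x; y].
Hypotheses (hx : lie h x = 2%:R *: x) (hy : lie h y = - (2%:R *: y)) (xy : lie x y = h).

Lemma isom_sl2 : isom_sl L 2.
Proof.
pose X := [tuple h; x; y]; pose U := @unit_mx K 2.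
pose M (t : 'I_3) := nth 0 [:: U 0%N 0%N - U 1%N 1%N; U 0%N 1%N; U 1%N 0%N] t.
have B : basis_of fullv X := basis_X.
have Mh : mx_rep X M h = M 0 := mx_rep_basis M B 0.
have Mx : mx_rep X M x = M 1 := mx_rep_basis M B 1.
have My : mx_rep X M y = M 2%:R := mx_rep_basis M B 2%:R.
have repE := (mx_repN X M, mx_repZ X M, mx_rep0 X M, Mh, Mx, My).
have hx' : lie x h = - (2%:R *: x) by rewrite lieC hx.
have hy' : lie y h = 2%:R *: y by rewrite lieC hy opprK.
have yx : lie y x = - h by rewrite lieC xy.
have adx : repr_ad X M x.
  apply: (repr_ad_basis B); case=> [[|[|[|?]]] tP] //=; rewrite ?hx' ?xy ?liexx !repE /M /=;
    mx_units.
have ady : repr_ad X M y.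
  apply: (repr_ad_basis B); case=> [[|[|[|?]]] tP] //=; rewrite ?hy' ?yx ?liexx !repE /M /=;
    mx_units.
have adh : repr_ad X M h by rewrite -xy; apply: repr_ad_lie.
apply: (isom_sl_of_repr (M := M) B).
- by case=> [[|[|[|?]]] tP] //; rewrite /mxtrace !big_ord_recl big_ord0 /M /= !mxE /=; ring.
- move=> A; have [f AE] := mx_natE A.
  rewrite /mxtrace !big_ord_recl big_ord0 addr0 !AE /= => A0.
  exists (fun t => nth 0 [:: f 0%N 0%N; f 0%N 1%N; f 1%N 0%N] t).
  rewrite !big_ord_recl big_ord0 /M /=; apply/matrixP.
  have f1 : f 1%N 1%N = - f 0%N 0%N by apply/eqP; rewrite -addr_eq0 addrC; apply/eqP.
  by case=> [[|[|?]] rP] //; case=> [[|[|?]] sP] //; rewrite AE !mxE /= ?f1; ring.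
- move=> c c0; pose f r := c (inord r).
  have cE t : c t = f (val t) by rewrite /f inord_val.
  have E r s : \sum_(t < 3) f t * M t r s = 0.
    rewrite -[RHS](_ : (\sum_t c t *: M t) r s = 0); last by rewrite c0 mxE.
    by rewrite summxE; apply: eq_bigr => t _; rewrite mxE cE.
  have := (E 0 0, E 0 1, E 1 0).
  rewrite !big_ord_recl !big_ord0 /M /= !mxE /= !(subr0, sub0r, mulr0, mulr1, addr0, add0r, mulrN).
  move=> [[E0 E1] E2].
  by case=> [[|[|[|?]]] tP]; rewrite ?cE.
by case=> [[|[|[|?]]] tP].
Qed.
End Sl2.

Section Sl3.
Variables (K : numFieldType) (L : lieAlgType K) (h1 h2 e1 e2 e3 f1 f2 f3 : L).
Hypothesis basis_X : basis_of fullv [:: h1; h2; e1; e2; e3; f1; f2; f3].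
Hypotheses (e1f1 : lie e1 f1 = h1) (e2f2 : lie e2 f2 = h2)
  (e1e2 : lie e1 e2 = e3) (f2f1 : lie f2 f1 = f3)
  (e1f2 : lie e1 f2 = 0) (e2f1 : lie e2 f1 = 0)
  (e1e3 : lie e1 e3 = 0) (e2e3 : lie e2 e3 = 0)
  (f1f3 : lie f1 f3 = 0) (f2f3 : lie f2 f3 = 0)
  (h1e1 : lie h1 e1 = 2%:R *: e1) (h1e2 : lie h1 e2 = - e2)
  (h2e1 : lie h2 e1 = - e1) (h2e2 : lie h2 e2 = 2%:R *: e2)
  (h1f1 : lie h1 f1 = - (2%:R *: f1)) (h1f2 : lie h1 f2 = f2)
  (h2f1 : lie h2 f1 = f1) (h2f2 : lie h2 f2 = - (2%:R *: f2)).

(** The brackets of the generators e1, e2, f1, f2 with the basis determine the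
    representation; those not assumed follow from the Jacobi identity. *)
Lemma isom_sl3 : isom_sl L 3.
Proof.
pose X := [tuple h1; h2; e1; e2; e3; f1; f2; f3].
pose U r s := @unit_mx K 3 r s.
pose M (t : 'I_8) := nth 0 [:: U 0%N 0%N - U 1%N 1%N; U 1%N 1%N - U 2%N 2%N;
  U 0%N 1%N; U 1%N 2%N; U 0%N 2%N; U 1%N 0%N; U 2%N 1%N; U 2%N 0%N] t.
have B : basis_of fullv X := basis_X.
pose o n (n8 : (n < 8)%N) : 'I_8 := Ordinal n8.
have M0 : mx_rep X M h1 = M (@o 0%N isT) := mx_rep_basis M B (@o 0%N isT).
have M1 : mx_rep X M h2 = M (@o 1%N isT) := mx_rep_basis M B (@o 1%N isT).
have M2 : mx_rep X M e1 = M (@o 2%N isT) := mx_rep_basis M B (@o 2%N isT).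
have M3 : mx_rep X M e2 = M (@o 3%N isT) := mx_rep_basis M B (@o 3%N isT).
have M4 : mx_rep X M e3 = M (@o 4%N isT) := mx_rep_basis M B (@o 4%N isT).
have M5 : mx_rep X M f1 = M (@o 5%N isT) := mx_rep_basis M B (@o 5%N isT).
have M6 : mx_rep X M f2 = M (@o 6%N isT) := mx_rep_basis M B (@o 6%N isT).
have M7 : mx_rep X M f3 = M (@o 7%N isT) := mx_rep_basis M B (@o 7%N isT).
have repE := (mx_repN X M, mx_repZ X M, mx_rep0 X M, (M0, M1, M2, M3), (M4, M5, M6, M7)).
have e1h1 : lie e1 h1 = - (2%:R *: e1) by rewrite lieC h1e1.
have e1h2 : lie e1 h2 = e1 by rewrite lieC h2e1 opprK.
have e2h1 : lie e2 h1 = e2 by rewrite lieC h1e2 opprK.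
have e2h2 : lie e2 h2 = - (2%:R *: e2) by rewrite lieC h2e2.
have f1h1 : lie f1 h1 = 2%:R *: f1 by rewrite lieC h1f1 opprK.
have f1h2 : lie f1 h2 = - f1 by rewrite lieC h2f1.
have f2h1 : lie f2 h1 = - f2 by rewrite lieC h1f2.
have f2h2 : lie f2 h2 = 2%:R *: f2 by rewrite lieC h2f2 opprK.
have e2e1 : lie e2 e1 = - e3 by rewrite lieC e1e2.
have f1f2 : lie f1 f2 = - f3 by rewrite lieC f2f1.
have f1e1 : lie f1 e1 = - h1 by rewrite lieC e1f1.
have f2e2 : lie f2 e2 = - h2 by rewrite lieC e2f2.
have f1e2 : lie f1 e2 = 0 by rewrite lieC e2f1 oppr0.
have f2e1 : lie f2 e1 = 0 by rewrite lieC e1f2 oppr0.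
have e1f3 : lie e1 f3 = - f2 by rewrite -f2f1 lie_leibniz e1f2 lie0l add0r e1f1 f2h1.
have e2f3 : lie e2 f3 = f1 by rewrite -f2f1 lie_leibniz e2f2 e2f1 lie0r addr0 h2f1.
have f1e3 : lie f1 e3 = e2 by rewrite -e1e2 lie_leibniz f1e1 f1e2 lie0r addr0 lieNl h1e2 opprK.
have f2e3 : lie f2 e3 = - e1.
  by rewrite -e1e2 lie_leibniz f2e1 lie0l add0r f2e2 lieNr e1h2.
have ade1 : repr_ad X M e1.
  apply: (repr_ad_basis B); case=> [[|[|[|[|[|[|[|[|?]]]]]]]] tP] //=;
    rewrite ?e1h1 ?e1h2 ?liexx ?e1e2 ?e1e3 ?e1f1 ?e1f2 ?e1f3 !repE /M /=; mx_units.
have ade2 : repr_ad X M e2.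
  apply: (repr_ad_basis B); case=> [[|[|[|[|[|[|[|[|?]]]]]]]] tP] //=;
    rewrite ?e2h1 ?e2h2 ?liexx ?e2e1 ?e2e3 ?e2f1 ?e2f2 ?e2f3 !repE /M /=; mx_units.
have adf1 : repr_ad X M f1.
  apply: (repr_ad_basis B); case=> [[|[|[|[|[|[|[|[|?]]]]]]]] tP] //=;
    rewrite ?f1h1 ?f1h2 ?liexx ?f1e1 ?f1e2 ?f1e3 ?f1f2 ?f1f3 !repE /M /=; mx_units.
have adf2 : repr_ad X M f2.
  apply: (repr_ad_basis B); case=> [[|[|[|[|[|[|[|[|?]]]]]]]] tP] //=;
    rewrite ?f2h1 ?f2h2 ?liexx ?f2e1 ?f2e2 ?f2e3 ?f2f1 ?f2f3 !repE /M /=; mx_units.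
have adh1 : repr_ad X M h1 by rewrite -e1f1; apply: repr_ad_lie.
have adh2 : repr_ad X M h2 by rewrite -e2f2; apply: repr_ad_lie.
have ade3 : repr_ad X M e3 by rewrite -e1e2; apply: repr_ad_lie.
have adf3 : repr_ad X M f3 by rewrite -f2f1; apply: repr_ad_lie.
apply: (isom_sl_of_repr (M := M) B).
- case=> [[|[|[|[|[|[|[|[|?]]]]]]]] tP] //=;
    rewrite /mxtrace !big_ord_recl big_ord0 /M /= !mxE /=; ring.
- move=> A; have [f AE] := mx_natE A.
  rewrite /mxtrace !big_ord_recl big_ord0 addr0 !AE /= => A0.
  exists (fun t => nth 0 [:: f 0%N 0%N; f 0%N 0%N + f 1%N 1%N;
     f 0%N 1%N; f 1%N 2%N; f 0%N 2%N; f 1%N 0%N; f 2%N 1%N; f 2%N 0%N] t).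
  rewrite !big_ord_recl big_ord0 /M /=; apply/matrixP.
  have fE : f 2%N 2%N = - (f 0%N 0%N + f 1%N 1%N).
    by apply/eqP; rewrite -addr_eq0 addrC -addrA; apply/eqP.
  by case=> [[|[|[|?]]] rP] //; case=> [[|[|[|?]]] sP] //; rewrite AE !mxE /= ?fE; ring.
- move=> c c0; have E r s : (\sum_t c t *: M t) r s = 0 by rewrite c0 mxE.
  pose f r := c (inord r); have cE t : c t = f (val t) by rewrite /f inord_val.
  pose p n (n3 : (n < 3)%N) : 'I_3 := Ordinal n3.
  have {}E r s : \sum_(t < 8) f t * M t r s = 0.
    by rewrite -[RHS](E r s) summxE; apply: eq_bigr => t _; rewrite mxE cE.
  have := (E (@p 0%N isT) (@p 0%N isT), E (@p 0%N isT) (@p 1%N isT), E (@p 0%N isT) (@p 2%N isT),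
   E (@p 1%N isT) (@p 0%N isT), E (@p 1%N isT) (@p 2%N isT), E (@p 2%N isT) (@p 0%N isT),
   E (@p 2%N isT) (@p 1%N isT), E (@p 2%N isT) (@p 2%N isT)).
  rewrite !big_ord_recl !big_ord0 /M /= !mxE /= !(subr0, sub0r, mulr0, mulr1, addr0, add0r, mulrN).
  move=> [[[[[[[E0 E1] E2] E3] E4] E5] E6] E7].
  by case=> [[|[|[|[|[|[|[|[|?]]]]]]]] tP]; rewrite ?cE //=; apply: oppr_inj; rewrite oppr0.
by case=> [[|[|[|[|[|[|[|[|?]]]]]]]] tP].
Qed.
End Sl3.

(** * Types A1 and A2 *)

Section SmallRank.
Variables (K : numFieldType) (g : lieAlgType K) (D : chevalley_datum g).
Local Notation weight := (dual (cartan D)).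
Local Notation H := (cartan D).
Local Notation Phi := (Defs.roots D).
Local Notation e := (root_vector D).
Implicit Types (a b c : weight) (x y z h : g) (i : 'I_(rank D)).

Local Notation P := (pos_roots D).
Local Notation al i := (tnth (simple_root D) i).

(** The Chevalley basis, listed along given enumerations of the simple roots and of the
    roots. *)
Lemma chevalley_basis_perm (js : seq 'I_(rank D)) (bs : seq weight) :
  uniq js -> (forall i, i \in js) -> uniq bs -> (forall b, (b \in bs) = (b \in Phi)) ->
  basis_of fullv ([seq coroot (al i) : g | i <- js] ++ [seq e b | b <- bs]).
Proof.
move=> ujs js_all ubs bsE; have [B _ _ _] := root_vectorP D.
suff pE : perm_eq ([seq coroot b : g | b <- simple_root D] ++ [seq e b | b <- enum_fset Phi])
                  ([seq coroot (al i) : g | i <- js] ++ [seq e b | b <- bs]).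
  by rewrite -(perm_basis _ pE).
rewrite -[X in map _ X ++ _]map_tnth_enum -map_comp.
apply: perm_cat; apply: perm_map.
  by apply: uniq_perm; rewrite ?enum_uniq // => i; rewrite mem_enum js_all.
by apply: uniq_perm; rewrite ?fset_uniq.
Qed.

Lemma isom_sl2_rank1 i : (forall i', i' = i) -> isom_sl g 2.
Proof.
move=> iE; have aPhi := simple_root_in i.
have bE b : (b \in [:: al i; - al i]) = (b \in Phi).
  rewrite !inE; apply/orP/idP => [[/eqP -> //|/eqP ->]|bPhi]; first by rewrite root_opp.
  have main c : c \in P -> c = al i.
    move=> cP; apply/eqP; apply: contraT => /(pos_other_coord cP)[i'].
    by rewrite (iE i') eqxx.
  have /orP[/main ->|/main E] := root_pos_or_neg bPhi; first by left.
  by right; rewrite -E opprK.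
have aNa : al i != - al i.
  by rewrite -addr_eq0 -mulr2n mulrn_neq0.
have js i' : i' \in [:: i] by rewrite (iE i') inE.
have u2 : uniq [:: al i; - al i] by rewrite /= inE aNa.
have B := @chevalley_basis_perm [:: i] [:: al i; - al i] isT js u2 bE.
apply: (@isom_sl2 _ _ (coroot (al i)) (e (al i)) (e (- al i)) B) => //.
- by rewrite (lie_He (coroot_H aPhi)) // wt_coroot.
- by rewrite (lie_He (coroot_H aPhi)) ?root_opp // wtN wt_coroot // scaleNr.
Qed.

Section A2.
Variables (i j : 'I_(rank D)).
Local Notation a := (al i).
Local Notation b := (al j).
Hypotheses (ij : i != j) (abP : a + b \in Phi)
  (PE : forall c, c \in P -> c \in [:: a; b; a + b]).

Lemma A2_coord c : c \in P -> simple_coord i c <= 1 /\ simple_coord j c <= 1.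
Proof.
have ji : (j == i) = false by rewrite eq_sym (negPf ij).
by move/PE; rewrite !inE => /or3P[] /eqP ->;
  rewrite ?simple_coordD !simple_coord_simple !eqxx ?ji ?(negPf ij) ?addr0 ?add0r ?lexx ?ler01.
Qed.

Lemma A2_simple_neq : b != a.
Proof.
apply/negP => /eqP/(congr1 (simple_coord i)); rewrite !simple_coord_simple eqxx (negPf ij).
by move/esym/eqP; rewrite oner_eq0.
Qed.

Lemma A2_notin : [/\ b - a \notin Phi, a - b \notin Phi, a + (a + b) \notin Phi
  & b + (a + b) \notin Phi].
Proof.
have ai := simple_root_in_pos i; have bj := simple_root_in_pos j.
have two1 : 2%:R <= 1 :> K = false by rewrite lern1.
have ba : b - a \notin Phi.
  apply/negP => /(pos_sub_simple bj A2_simple_neq); rewrite (negPf (simple_sub_pos j ai)) //.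
split=> //.
- by rewrite -root_opp opprB.
- apply/negP => E; have cP : a + (a + b) \in P.
    by apply: (pos_add ai) => //; apply: pos_add.
  have [] := A2_coord cP; rewrite !simple_coordD !simple_coord_simple eqxx (negPf ij).
  by rewrite addr0 -natrD two1.
apply/negP => E; have cP : b + (a + b) \in P.
  by apply: (pos_add bj) => //; apply: pos_add.
have [_] := A2_coord cP; rewrite !simple_coordD !simple_coord_simple eqxx [j == i]eq_sym (negPf ij).
by rewrite add0r -natrD two1.
Qed.

Lemma A2_wt : wt b (coroot a) = -1.
Proof.
have [ba _ aab _] := A2_notin; have aPhi := simple_root_in i; have bPhi := simple_root_in j.
have bna := A2_simple_neq.
have bnNa : b != - a by rewrite -addr_eq0 pos_add_neq0 ?simple_root_in_pos.
have [p [q [pP _ qP qN [-> _]]]] := root_string aPhi bPhi bna bnNa.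
have p0 : p = 0%N by case: p pP => // p /(_ 1%N isT); rewrite mulr1n (negPf ba).
have q1 : q = 1%N.
  case: q qP qN => [|[|q]] qP qN //; first by move: qN; rewrite mulr1n addrC abP.
  by have := qP 2%N isT; rewrite mulr2n addrC -addrA (negPf aab).
by rewrite p0 q1 sub0r.
Qed.
End A2.

Lemma A2_roots (i j : 'I_(rank D)) : i != j -> al i + al j \in Phi ->
  (forall c, c \in P -> c \in [:: al i; al j; al i + al j]) ->
  forall c, (c \in [:: al i; al j; al i + al j; - al i; - al j; - (al i + al j)]) = (c \in Phi).
Proof.
move=> ij abP PE c; have aPhi := simple_root_in i; have bPhi := simple_root_in j.
rewrite !inE; apply/idP/idP.
  do ![case/orP] => /eqP ->; rewrite ?root_opp //.
move=> /root_pos_or_neg/orP[/PE|/PE]; rewrite !inE => /or3P[] /eqP; rewrite ?[- c = _]eqr_oppLR.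
- by move=> ->; rewrite eqxx.
- by move=> ->; rewrite eqxx ?orbT.
- by move=> ->; rewrite eqxx ?orbT.
- by move/(canRL opprK) ->; rewrite eqxx ?orbT.
- by move/(canRL opprK) ->; rewrite eqxx ?orbT.
- by move/(canRL opprK) ->; rewrite eqxx ?orbT.
Qed.

Lemma A2_uniq (i j : 'I_(rank D)) : i != j -> al i + al j \in P ->
  uniq [:: al i; al j; al i + al j; - al i; - al j; - (al i + al j)].
Proof.
move=> ij abP.
have aP := simple_root_in_pos i; have bP := simple_root_in_pos j.
have ab : al i != al j by rewrite eq_sym A2_simple_neq.
have PN c d : c \in P -> d \in P -> c != - d by move=> cP dP; rewrite -addr_eq0 pos_add_neq0.
have a0 := root_neq0 (pos_root_in aP); have b0 := root_neq0 (pos_root_in bP).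
have E1 : al i != al i + al j by rewrite -subr_eq0 opprD addrA subrr sub0r oppr_eq0.
have E2 : al j != al i + al j.
  apply/eqP => E; case/eqP: a0; apply: (addIr (al j)); rewrite -E.
  by rewrite add0r.
by rewrite /= !inE !(inj_eq oppr_inj) !(negPf (PN _ _ _ _)) // (negPf ab) (negPf E1) (negPf E2).
Qed.

(** The vectors [e_a, e_b] and [e_(-b), e_(-a)] replace e_(a + b) and its opposite; they are
    nonzero multiples of them. *)
Lemma isom_sl3_A2 (i j : 'I_(rank D)) : i != j -> (forall k, k = i \/ k = j) -> al i + al j \in Phi ->
  (forall c, c \in P -> c \in [:: al i; al j; al i + al j]) -> isom_sl g 3.
Proof.
move=> ij ijE abPhi PE; have aP := simple_root_in_pos i; have bP := simple_root_in_pos j.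
have aPhi := pos_root_in aP; have bPhi := pos_root_in bP; have ab0 := root_neq0 abPhi.
have abP : al i + al j \in P by apply: pos_add.
have [ba ab aab bab] := A2_notin ij abPhi PE.
have js k : k \in [:: i; j] by rewrite !inE; case: (ijE k) => ->; rewrite eqxx ?orbT.
have uj : uniq [:: i; j] by rewrite /= inE ij.
have B := chevalley_basis_perm uj js (A2_uniq ij abP) (A2_roots ij abPhi PE).
have wba : wt (al j) (coroot (al i)) = -1 by apply: A2_wt.
have wab : wt (al i) (coroot (al j)) = -1.
  have ji : j != i by rewrite eq_sym.
  have baP : al j + al i \in Phi by rewrite addrC.
  apply: (A2_wt ji baP) => c /PE.
  by rewrite !inE orbCA (addrC (al j)).
set a := al i in wba wab aP aPhi ab0 abP abPhi ba ab aab bab B PE *.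
set b := al j in wba wab bP bPhi ab0 abP abPhi ba ab aab bab B PE *.
have nab0 : - b + - a != 0 by rewrite -opprD oppr_eq0 addrC.
have e3E : lie (e a) (e b) = struct_const a b *: e (a + b) := lie_ee aPhi bPhi ab0.
have f3E : lie (e (- b)) (e (- a)) = struct_const (- b) (- a) *: e (- b + - a).
  by apply: lie_ee; rewrite ?root_opp.
have N1 := struct_const_neq0 aPhi bPhi abPhi.
have N2 : struct_const (- b) (- a) != 0 by apply: struct_const_neq0; rewrite ?root_opp // -opprD root_opp addrC.
have hP := coroot_H aPhi; have hP' := coroot_H bPhi.
have nP c : c \in Phi -> - c \in Phi by rewrite root_opp.
have lieH h c : h \in H -> c \in Phi -> lie h (e c) = wt c h *: e c.
  by move=> hH cP; apply: lie_He.
apply: (@isom_sl3 _ _ (coroot a) (coroot b) (e a) (e b) (lie (e a) (e b)) (e (- a)) (e (- b))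
  (lie (e (- b)) (e (- a)))) => //.
- have dimg : \dim {:g} = 8 by have /andP[/eqP <- /eqP] := B.
  rewrite basisEdim dimg andbT.
  rewrite -(span_basis B); apply/span_subvP => x.
  rewrite !inE; set X := [:: coroot a; _; _; _; _; _; _; _].
  have XP y : y \in X -> y \in <<X>>%VS by apply: memv_span.
  have sc k c : k != 0 -> k *: e c \in X -> e c \in <<X>>%VS.
    by move=> k0 /XP; rewrite -{2}[e c]scale1r -(mulVf k0) -scalerA; apply: memvZ.
  do ![case/orP] => /eqP ->.
  + by apply: XP; rewrite inE eqxx.
  + by apply: XP; rewrite !inE eqxx ?orbT.
  + by apply: XP; rewrite !inE eqxx ?orbT.
  + by apply: XP; rewrite !inE eqxx ?orbT.
  + by apply: (sc _ _ N1); rewrite -e3E !inE eqxx ?orbT.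
  + by apply: XP; rewrite !inE eqxx ?orbT.
  + by apply: XP; rewrite !inE eqxx ?orbT.
  rewrite [a + b]addrC opprD.
  by apply: (sc _ _ N2); rewrite -f3E !inE eqxx ?orbT.
- by apply: lie_ee0; rewrite ?nP // subr_eq0 eq_sym A2_simple_neq.
- by apply: lie_ee0; rewrite ?nP // subr_eq0 A2_simple_neq.
- by rewrite e3E lieZr lie_ee0 ?scaler0 // pos_add_neq0.
- by rewrite e3E lieZr lie_ee0 ?scaler0 // pos_add_neq0.
- have nE : - b - a = - (a + b) by rewrite opprD addrC.
  rewrite f3E nE lieZr lie_ee0 ?scaler0 ?nP // -opprD ?oppr_eq0 ?pos_add_neq0 //.
  by rewrite root_opp.
- have nE : - b - a = - (a + b) by rewrite opprD addrC.
  rewrite f3E nE lieZr lie_ee0 ?scaler0 ?nP // -opprD ?oppr_eq0 ?pos_add_neq0 //.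
  by rewrite root_opp.
- by rewrite lieH // wt_coroot.
- by rewrite lieH // wba scaleN1r.
- by rewrite lieH // wab scaleN1r.
- by rewrite lieH // wt_coroot.
- by rewrite lieH ?nP // wtN wt_coroot // scaleNr.
- by rewrite lieH ?nP // wtN wba opprK scale1r.
- by rewrite lieH ?nP // wtN wab opprK scale1r.
- by rewrite lieH ?nP // wtN wt_coroot // scaleNr.
Qed.
End SmallRank.

(** * The first cohomology of the nilradical *)

Section Translation.
Variables (K : numFieldType) (g : lieAlgType K) (D : chevalley_datum g).
Local Notation weight := (dual (cartan D)).
Local Notation H := (cartan D).
Local Notation Phi := (Defs.roots D).
Local Notation e := (root_vector D).
Implicit Types (a b c : weight) (x y z h : g) (i : 'I_(rank D)).

Local Notation P := (pos_roots D).
Local Notation al i := (tnth (simple_root D) i).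

Local Notation en := (@nilp_basis K g D).
Local Notation cochain := (cochain (Defs.nilp D) P).
Implicit Types (phi psi : cochain).

Lemma val_nilp_basis (b : P) : vsval (en b) = e (val b).
Proof. by rewrite vsprojK // root_vector_nil // (valP b). Qed.

Lemma val_sum_nilp_basis (k : P -> K) :
  vsval (\sum_b k b *: en b : Defs.nilp D) = \sum_(b : P) k b *: e (val b).
Proof.
rewrite (big_morph (@vsval _ _ _) (id1 := 0) (op1 := +%R)) //.
by apply: eq_bigr => b _; rewrite -val_nilp_basis.
Qed.

Lemma nilp_basisP : basis_of fullv (codom_tuple en).
Proof.
apply/andP; split.
  rewrite eqEsubv subvf /=; apply/subvP => x _.
  have -> : x = \sum_b root_coef (val b) (vsval x) *: en b.
    apply: val_inj; rewrite [RHS]val_sum_nilp_basis [LHS](nil_expand (subvsP x)).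
    by rewrite big_seq_fsetE.
  by apply: memv_suml => b _; apply: memvZ; apply: memv_span; apply: codom_f.
apply: codom_free => k /(congr1 (@vsval _ _ _)); rewrite val_sum_nilp_basis => k0 b.
have := congr1 (root_coef (val b)) k0; rewrite raddf_sum (bigD1 b) //= root_coefZ root_coef_e ?pos_root_in ?(valP b) // eqxx.
rewrite mulr1 big1 ?addr0 => [|c cb].
  by rewrite [RHS]linear0.
by rewrite root_coefZ root_coef_e ?pos_root_in ?(valP c) // eq_sym (inj_eq val_inj) (negPf cb) mulr0.
Qed.

Lemma dual_coord_nilp_basis (b : P) (x : Defs.nilp D) : dual_coord en b x = root_coef (val b) (vsval x).
Proof.
rewrite {2}(dual_coordK nilp_basisP x) val_sum_nilp_basis raddf_sum (bigD1 b) //= root_coefZ.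
rewrite root_coef_e ?pos_root_in ?(valP b) // eqxx mulr1 big1 ?addr0 // => c cb.
by rewrite root_coefZ root_coef_e ?pos_root_in ?(valP c) // eq_sym (inj_eq val_inj) (negPf cb) mulr0.
Qed.

Definition fun_of_cochain phi b : g :=
  if insub b is Some b' then vsval (phi [set b']) else 0.

Lemma fun_of_cochainE phi (b : P) : fun_of_cochain phi (val b) = vsval (phi [set b]).
Proof. by rewrite /fun_of_cochain valK. Qed.

Lemma val_lie (x y : Defs.nilp D) : vsval (lie x y) = lie (vsval x) (vsval y).
Proof. exact: val_nilp_lie. Qed.

(** The two descriptions of derivations, on cochains with values in the nilradical and on
    functions of weights with values in g. *)
Lemma derivation_der phi (f : weight -> g) :
  (forall b : P, f (val b) = vsval (phi [set b])) -> derivation en phi <-> root_derivation f.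
Proof.
move=> fE.
have S (a b : P) : vsval (\sum_l dual_coord en l (lie (en a) (en b)) *: phi [set l] : Defs.nilp D) =
   \sum_(d <- P) root_coef d (lie (e (val a)) (e (val b))) *: f d.
  rewrite big_seq_fsetE (big_morph (@vsval _ _ _) (id1 := 0) (op1 := +%R)) //.
  by apply: eq_bigr => l _; rewrite dual_coord_nilp_basis val_lie !val_nilp_basis /= fE.
have T (a b : P) : vsval (lie (en a) (phi [set b]) - lie (en b) (phi [set a])) =
   lie (e (val a)) (f (val b)) - lie (e (val b)) (f (val a)).
  by rewrite -[LHS]/(vsval (lie (en a) (phi [set b]) : Defs.nilp D) - vsval (lie (en b) (phi [set a]) : Defs.nilp D)) !val_lie !val_nilp_basis !fE.
split=> [dphi a b aP bP|df a b].
  by have := S [` aP]%fset [` bP]%fset; rewrite -dphi T.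
by apply: subvs_inj; rewrite T S; apply: df; apply: valP.
Qed.

Lemma c_cochain1 i (b : P) : c_cochain i [set b] = simple_coord i (val b) *: en b.
Proof.
rewrite /c_cochain sum_ffunE (bigD1 b) //= big1 ?addr0 => [|c cb].
  by rewrite ffunE monomial1 eqxx scale1r.
by rewrite ffunE monomial1 (negPf cb) scale0r scaler0.
Qed.

Lemma c_cocycle i : c_cochain i \in cocycles en 1.
Proof.
apply/(cocycles1P nilp_basisP); split.
  by apply: memv_suml => b _; apply: memvZ; apply: monomial_C1; apply: nilp_basisP.
apply/(@derivation_der _ (fun b => simple_coord i b *: e b)) => [b|].
  by rewrite c_cochain1 -val_nilp_basis.
by apply: der_diag => a b; apply: simple_coordD.
Qed.

Hypothesis g_simple : simple_lie g.
Variables (mu : weight).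
Hypotheses (muP : mu \in P) (mu_top : top_root mu).
Hypothesis rank2 : forall i, exists i', i' != i.
Variables (gamma : 'I_(rank D) -> P) (gammaE : forall i, val (gamma i) = mu_refl mu i).

Definition b_cochain i : cochain := monomial en (gamma i) [:: simple_idx i].

Lemma simple_idxE i (l : P) : (simple_idx i == l) = (val l == al i).
Proof. by rewrite eq_sym -(inj_eq val_inj). Qed.

Lemma b_cochain1 i (l : P) : b_cochain i [set l] = (simple_idx i == l)%:R *: en (gamma i).
Proof. exact: monomial1. Qed.

Lemma val_b_cochain i (l : P) : b_der mu i (val l) = vsval (b_cochain i [set l]).
Proof.
rewrite b_cochain1 simple_idxE /b_der; case: eqP => _; last by rewrite scale0r.
by rewrite scale1r val_nilp_basis gammaE.
Qed.

Lemma b_cocycle i : b_cochain i \in cocycles en 1.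
Proof.
apply/(cocycles1P nilp_basisP); split; first by apply: monomial_C1; apply: nilp_basisP.
by apply/(derivation_der (val_b_cochain i)); apply: der_b.
Qed.

(** The reflection s_i maps gamma_i - a_i to mu + a_i. *)
Lemma mu_refl_sub_notin i : mu_refl mu i - al i \notin Phi.
Proof.
have iPhi := simple_root_in i.
apply/negP => /(reflection_root iPhi); apply/negP.
rewrite /mu_refl wtD [wt (mu - _) _]wtD !wtN wtZ wt_coroot //; set k := wt mu _.
suff -> : mu - k *: al i - al i - (k - k * 2%:R - 2%:R) *: al i = al i + mu.
  by apply: mu_top; apply: simple_root_in_pos.
have -> : k - k * 2%:R - 2%:R = - k - 2%:R by ring.
rewrite scalerBl scaleNr scaler_nat mulr2n opprB opprK.
move: (k *: al i) (al i) => c b; rewrite !addrA [LHS](ACl ((2*6)*(3*4)*(5*1)))/=.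
by rewrite !addNr !add0r.
Qed.

Lemma root_coef_lie_notin a c x : a \in P -> x \in nilspace D -> c \notin Phi ->
  a + c \in Phi -> root_coef (a + c) (lie (e a) x) = 0.
Proof.
move=> aP xN cN acP; have := root_coef_lie c aP xN.
rewrite (root_coef_notin _ cN) scale0r => /eqP.
by rewrite scaler_eq0 (negPf (e_neq0 acP)) orbF => /eqP.
Qed.

Lemma standard_fun_simple t u x i :
  standard_fun mu t u x (al i) = t i *: e (al i) + u i *: e (mu_refl mu i) + lie (e (al i)) x.
Proof.
congr (_ *: _ + _ + _).
  rewrite (bigD1 i) //= simple_coord_simple eqxx mulr1 big1 ?addr0 // => i' ii'.
  by rewrite simple_coord_simple (negPf ii') mulr0.
rewrite (bigD1 i) //= /b_der eqxx big1 ?addr0 // => i' ii'.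
case: eqP => [E|]; last by rewrite scaler0.
have := congr1 (simple_coord i) E; rewrite !simple_coord_simple eqxx eq_sym (negPf ii').
by move/eqP; rewrite oner_eq0.
Qed.

(** Compare the coefficients of e_i and of the root vector of gamma_i in the image of e_i;
    the inner part contributes to neither, 0 and gamma_i - a_i not being roots. *)
Lemma standard_fun_eq0 t u x : x \in nilspace D -> {in P, forall b, standard_fun mu t u x b = 0} ->
  forall i, t i = 0 /\ u i = 0.
Proof.
move=> xN S i; have aP := simple_root_in_pos i; have iPhi := simple_root_in i.
have gP := pos_root_in (mu_refl_pos g_simple muP mu_top rank2 i).
have gai := mu_refl_neq g_simple muP mu_top rank2 i.
have N0 : (0 : weight) \notin Phi by apply/negP => /root_neq0; rewrite eqxx.
have := S _ aP; rewrite standard_fun_simple => E; split.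
  have Z : root_coef (al i) (lie (e (al i)) x) = 0.
    by rewrite -{1}[al i]addr0 root_coef_lie_notin ?addr0.
  have := congr1 (root_coef (al i)) E; rewrite !linearD /= !root_coefZ !root_coef_e // eqxx eq_sym (negPf gai).
  by rewrite Z mulr0 mulr1 !addr0 linear0.
have cE : al i + (mu_refl mu i - al i) = mu_refl mu i by rewrite addrC subrK.
have Z : root_coef (mu_refl mu i) (lie (e (al i)) x) = 0.
  by rewrite -{1}cE root_coef_lie_notin ?mu_refl_sub_notin // cE.
have := congr1 (root_coef (mu_refl mu i)) E; rewrite !linearD /= !root_coefZ !root_coef_e // eqxx (negPf gai).
by rewrite Z mulr0 mulr1 add0r addr0 linear0.
Qed.

Lemma val_inner (x : Defs.nilp D) (b : P) :
  vsval (inner_cochain en x [set b]) = lie (e (val b)) (vsval x).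
Proof. by rewrite inner_cochainE val_lie val_nilp_basis. Qed.

Lemma vsval_sum (I : Type) (r : seq I) (F : I -> Defs.nilp D) :
  vsval (\sum_(i <- r) F i : Defs.nilp D) = \sum_(i <- r) vsval (F i).
Proof. by rewrite (big_morph (@vsval _ _ _) (id1 := 0) (op1 := +%R)). Qed.

Definition standard_cochain t u (x : Defs.nilp D) : cochain :=
  \sum_i t i *: c_cochain i + \sum_i u i *: b_cochain i + inner_cochain en x.

Lemma standard_cochain_C1 t u (x : Defs.nilp D) : standard_cochain t u x \in cochains en 1.
Proof.
have [cC bC] : (forall i, c_cochain i \in cochains en 1) /\ (forall i, b_cochain i \in cochains en 1).
  by split=> i; [have := c_cocycle i|have := b_cocycle i]; case/(cocycles1P nilp_basisP).
have iC : inner_cochain en x \in cochains en 1 by apply: inner_cochain_C1; exact: nilp_basisP.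
rewrite /standard_cochain memvD // memvD // memv_suml // => i _; by rewrite memvZ ?cC ?bC.
Qed.

Lemma val_standard_cochain t u (x : Defs.nilp D) (b : P) :
  vsval (standard_cochain t u x [set b]) = standard_fun mu t u (vsval x) (val b).
Proof.
rewrite [X in vsval X]ffunE [X in X + _]ffunE !sum_ffunE.
rewrite -[LHS]/(vsval (\sum_i (t i *: c_cochain i) [set b] : Defs.nilp D) +
  vsval (\sum_i (u i *: b_cochain i) [set b] : Defs.nilp D) + vsval (inner_cochain en x [set b])).
rewrite val_inner !vsval_sum; congr (_ + _ + _).
  rewrite scaler_suml; apply: eq_bigr => i _; rewrite ffunE c_cochain1.
  by rewrite -[LHS]/(t i *: (simple_coord i (val b) *: vsval (en b))) val_nilp_basis scalerA.
by apply: eq_bigr => i _; rewrite ffunE val_b_cochain.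
Qed.

Lemma cocycle_standard phi : phi \in cocycles en 1 ->
  exists t u (x : Defs.nilp D), phi = standard_cochain t u x.
Proof.
case/(cocycles1P nilp_basisP) => phi1 dphi.
have dphi' : root_derivation (fun_of_cochain phi).
  by apply/(derivation_der (fun_of_cochainE phi)).
have nphi : nil_valued (fun_of_cochain phi).
  by move=> b bP; rewrite -[b]/(val [` bP]%fset) fun_of_cochainE subvsP.
have [t [u [x [xN E]]]] := der_standard g_simple muP mu_top rank2 dphi' nphi.
exists t, u, (vsproj (nilspace D) x); apply: (cochain1_eq nilp_basisP) => // [|b].
  exact: standard_cochain_C1.
by apply: subvs_inj; rewrite val_standard_cochain vsprojK // -E ?(valP b) // fun_of_cochainE.
Qed.

Local Notation cl := (cohom_class en 1).

Lemma class_standard t u (x : Defs.nilp D) : cl (standard_cochain t u x) =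
  \sum_i t i *: cl (c_cochain i) + \sum_i u i *: cl (b_cochain i).
Proof.
rewrite /standard_cochain -[RHS]addr0 /cohom_class !linearD !linear_sum /=; congr (_ + _ + _).
- by apply: eq_bigr => i _; rewrite linearZ.
- by apply: eq_bigr => i _; rewrite linearZ.
apply/eqP; rewrite quot_proj_eq0; apply/(coboundaries1P nilp_basisP).
by exists x.
Qed.

Definition generator_class (s : 'I_(rank D) + 'I_(rank D)) : quotv (coboundaries en 1) :=
  match s with inl i => cl (c_cochain i) | inr i => cl (b_cochain i) end.

Lemma sum_generator_class k : \sum_s k s *: generator_class s =
  \sum_i k (inl i) *: cl (c_cochain i) + \sum_i k (inr i) *: cl (b_cochain i).
Proof. exact: big_sumType. Qed.

Lemma generator_class_basis : basis_of (cohomology en 1) (codom_tuple generator_class).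
Proof.
apply/andP; split.
  rewrite eqEsubv; apply/andP; split.
    apply/span_subvP => _ /codomP[[i|i] ->]; apply: memv_img.
      exact: c_cocycle.
    exact: b_cocycle.
  apply/subvP => _ /memv_imgP[phi /cocycle_standard[t [u [x ->]]] ->].
  rewrite -/(cohom_class en 1 _) class_standard.
  have mem s : generator_class s \in <<codom_tuple generator_class>>%VS.
    by apply: memv_span; apply: codom_f.
  apply: memvD; apply: memv_suml => i _; apply: memvZ.
    exact: (mem (inl i)).
  exact: (mem (inr i)).
apply: codom_free => k; rewrite sum_generator_class -(class_standard _ _ 0) => /eqP.
rewrite quot_proj_eq0 => /(coboundaries1P nilp_basisP)[y yE].
have S : {in P, forall b, standard_fun mu (k \o inl) (k \o inr) (- vsval y) b = 0}.
  move=> b bP; have := congr1 (fun f : cochain => vsval (f [set [` bP]%fset])) yE.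
  rewrite val_standard_cochain val_inner /= /standard_fun linear0 addr0 => ->.
  by rewrite lieNr subrr.
have := standard_fun_eq0 _ S; rewrite memvN subvsP => /(_ isT) E.
by case=> i; have [] := E i.
Qed.

(** If gamma_j = a_i, then mu = a_i + q a_j with q > 0.  As every simple root occurs in mu, the
    rank is two.  The coefficient of a_i in gamma_i leaves gamma_i = mu or
    gamma_i = mu - a_i = q a_j; in the latter case q = 1, all roots are below
    mu = a_i + a_j, and g is of type A2. *)
Lemma mu_refl_eq_simple i j : mu_refl mu j = al i -> ~ isom_sl g 3 ->
  mu_refl mu i = mu /\ mu - al j \in P.
Proof.
move=> gji nsl3.
have [p [pE pP _]] := mu_string g_simple muP mu_top rank2 i.
have [q [qE qP _]] := mu_string g_simple muP mu_top rank2 j.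
have ij : i != j.
  apply/eqP => ij; have := mu_refl_neq g_simple muP mu_top rank2 j.
  by rewrite gji ij eqxx.
have muE : mu = al i + al j *+ q.
  by rewrite -gji /mu_refl qE scaler_nat subrK.
have q0 : (0 < q)%N.
  rewrite lt0n; apply/eqP => q0; have := mu_neq g_simple muP mu_top rank2 i.
  by rewrite muE q0 mulr0n addr0 eqxx.
have ijE k : k = i \/ k = j.
  have := mu_coord_gt0 g_simple muP mu_top k.
  rewrite muE simple_coordD simple_coordMn !simple_coord_simple.
  have [->|ki] := eqVneq k i; first by left.
  have [->|kj] := eqVneq k j; first by right.
  by rewrite mul0rn addr0 ltxx.
split; last by have := qP 1%N q0; rewrite mulr1n.
have p1 : (p <= 1)%N.
  have := pos_coord_ge0 i (mu_refl_pos g_simple muP mu_top rank2 i).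
  rewrite simple_coordD simple_coordN simple_coordZ pE [X in _ <= X - _](_ : _ = 1).
    by rewrite simple_coord_simple eqxx mulr1 subr_ge0 -[1]/(1%:R) ler_nat.
  by rewrite muE simple_coordD simple_coordMn !simple_coord_simple eqxx (negPf ij) mul0rn addr0.
have giE : mu_refl mu i = mu - al i *+ p by rewrite /mu_refl pE scaler_nat.
case: p p1 {pP pE} giE => [|[|//]] _ giE; first by rewrite giE mulr0n subr0.
case: nsl3; have q1 : q = 1%N.
  apply: (root_multiple (simple_root_in j)).
  have := pos_root_in (mu_refl_pos g_simple muP mu_top rank2 i).
  by rewrite giE muE mulr1n addrAC subrr add0r.
have {}muE : mu = al i + al j by rewrite muE q1 mulr1n.
apply: (@isom_sl3_A2 _ _ _ i j) => // [|c cP]; first by rewrite -muE pos_root_in.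
have cE : c = simple_coord i c *: al i + simple_coord j c *: al j.
  rewrite {1}(weight_expand c) (bigD1 i) //= (bigD1 j) 1?eq_sym //= big_pred0 ?addr0 // => k.
  by case: (ijE k) => ->; rewrite eqxx ?andbF.
have [m mE] := pos_coord_nat i cP; have [l lE] := pos_coord_nat j cP.
have cmu := root_le_mu g_simple muP mu_top (pos_root_in cP).
have := cmu i; have := cmu j; rewrite muE !simple_coordD !simple_coord_simple !eqxx.
rewrite [j == i]eq_sym (negPf ij) addr0 add0r mE lE -[1]/(1%:R) !ler_nat.
have c0 := root_neq0 (pos_root_in cP); move: c0; rewrite cE mE lE.
case: m {mE} => [|[|//]]; case: l {lE} => [|[|//]]; rewrite ?scale0r ?scale1r ?addr0 ?add0r.
- by rewrite eqxx.
- by rewrite !inE eqxx orbT.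
- by rewrite !inE eqxx.
- by rewrite !inE eqxx !orbT.
Qed.

(** The composite sends e_j to the root vector of gamma_i if gamma_j = a_i and is 0
    otherwise.  In the first case gamma_i = mu, and the root vector of mu - a_j maps e_j to a
    nonzero multiple of e_mu and commutes with the other positive root vectors, as
    mu - a_j + l is not below mu for any positive root l other than a_j. *)
Lemma dot_b_coboundary i j : ~ isom_sl g 3 ->
  cochain_dot en (b_cochain i) (b_cochain j) \in coboundaries en 1.
Proof.
move=> nsl3; have bC k : b_cochain k \in cochains en 1.
  by have /(cocycles1P nilp_basisP)[] := b_cocycle k.
have dC := cochain_dot_C1 nilp_basisP (bC i) (bC j).
have dE l : cochain_dot en (b_cochain i) (b_cochain j) [set l] =
    (simple_idx j == l)%:R *: ((simple_idx i == gamma j)%:R *: en (gamma i)).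
  by rewrite (cochain_dot1 nilp_basisP) // b_cochain1 linearZ /= cochain_fun_e ?b_cochain1 //; apply: nilp_basisP.
have [ij|ij] := eqVneq (simple_idx i) (gamma j); last first.
  suff -> : cochain_dot en (b_cochain i) (b_cochain j) = 0 by apply: mem0v.
  apply: (cochain1_eq nilp_basisP) => //; first exact: mem0v.
  by move=> l; rewrite dE (negPf ij) scale0r scaler0 ffunE.
have gji : mu_refl mu j = al i by rewrite -gammaE -ij.
have [gi mjP] := mu_refl_eq_simple gji nsl3.
have mjE : al j + (mu - al j) = mu by rewrite addrC subrK.
have Nj : struct_const (al j) (mu - al j) != 0.
  by apply: struct_const_neq0; rewrite ?simple_root_in ?mjE ?(pos_root_in mjP) ?(pos_root_in muP).
apply/(coboundaries1P nilp_basisP).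
exists ((struct_const (al j) (mu - al j))^-1 *: en [` mjP]%fset).
apply: (cochain1_eq nilp_basisP) => //; first exact: (inner_cochain_C1 nilp_basisP).
move=> l; rewrite dE ij eqxx scale1r; apply: subvs_inj; rewrite val_inner.
rewrite -[vsval (_ *: en [` mjP]%fset)]/(_ *: vsval (en [` mjP]%fset)) val_nilp_basis lieZr /=.
rewrite -[LHS]/(_ *: vsval (en (gamma i))) val_nilp_basis gammaE gi simple_idxE.
case: eqP => [->|/eqP lj].
  rewrite scale1r lie_ee ?mjE ?simple_root_in ?(pos_root_in mjP) ?(root_neq0 (pos_root_in muP)) //.
  by rewrite scalerA mulVf // scale1r.
rewrite scale0r lie_ee0 ?scaler0 ?(pos_root_in mjP) ?(pos_root_in (valP l)) ?(pos_add_neq0 (valP l) mjP) //.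
apply/negP => lP; have [k kj k0] := pos_other_coord (valP l) lj.
have := root_le_mu g_simple muP mu_top lP k; rewrite !simple_coordD simple_coordN simple_coord_simple.
by rewrite (negPf kj) subr0 gerDr => /(lt_le_trans k0); rewrite ltxx.
Qed.

Local Notation br := (@cohom_bracket _ _ _ en 1 1).

(** Each of the two composites is a coboundary. *)
Lemma bracket_bb i j : ~ isom_sl g 3 -> br (cl (b_cochain i)) (cl (b_cochain j)) = 0.
Proof.
move=> nsl3; rewrite (cohom_bracket_class nilp_basisP) ?b_cocycle //.
apply/eqP; rewrite /cohom_class quot_proj_eq0; apply: memvB; first exact: dot_b_coboundary.
by apply: memvZ; apply: dot_b_coboundary.
Qed.

Lemma bracket_cc i j : br (cl (c_cochain i)) (cl (c_cochain j)) = 0.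
Proof.
have cC k : c_cochain k \in cochains en 1.
  by have /(cocycles1P nilp_basisP)[] := c_cocycle k.
rewrite (cohom_bracket_class nilp_basisP) ?c_cocycle //.
suff -> : cochain_bracket en 1 1 (c_cochain i) (c_cochain j) = 0 by rewrite /cohom_class linear0.
apply: (cochain1_eq nilp_basisP) => [||l].
- exact: (bracket_C1 nilp_basisP).
- exact: mem0v.
rewrite (bracket1 nilp_basisP) // !c_cochain1 !linearZ /= !(cochain_fun_e nilp_basisP) !c_cochain1 [RHS]ffunE.
by rewrite scalerN !scalerA mulrC subrr.
Qed.

Lemma bracket_cb i j : br (cl (c_cochain i)) (cl (b_cochain j)) =
  monomial_weight i (gamma j) [:: simple_idx j] *: cl (b_cochain j).
Proof.
have cC k : c_cochain k \in cochains en 1.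
  by have /(cocycles1P nilp_basisP)[] := c_cocycle k.
have bC k : b_cochain k \in cochains en 1.
  by have /(cocycles1P nilp_basisP)[] := b_cocycle k.
rewrite (cohom_bracket_class nilp_basisP) ?c_cocycle ?b_cocycle //.
rewrite /cohom_class -linearZ; congr (quot_proj _ _).
apply: (cochain1_eq nilp_basisP) => [||l].
- exact: (bracket_C1 nilp_basisP).
- exact: memvZ.
rewrite (bracket1 nilp_basisP) // [RHS]ffunE !b_cochain1 c_cochain1 !linearZ /=.
rewrite !(cochain_fun_e nilp_basisP) b_cochain1 c_cochain1 /monomial_weight big_seq1.
case: eqP => [<-|_]; last by rewrite !scale0r oppr0 scaler0 addr0.
by rewrite !scale1r scalerN -scalerBl simple_coordD simple_coordN.
Qed.

End Translation.

Theorem mainTheorem1 (R : realType) (g : lieAlgType R[i])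
    (g_simple : simple_lie g) (D : chevalley_datum g)
    (mu : dual (cartan D)) (mu_max : maximal_root mu)
    (m : 'I_(rank D) -> nat) (mP : forall i, max_string mu i (m i))
    (gamma : 'I_(rank D) -> pos_roots D)
    (gammaP : forall i, val (gamma i) = mu - tnth (simple_root D) i *+ m i) :
  let n := rank D in
  let e := @nilp_basis _ g D in
  let c := @c_cochain _ g D in
  let b := fun i : 'I_n => monomial e (gamma i) [:: simple_idx i] in
  let w_b := fun i j : 'I_n => monomial_weight i (gamma j) [:: simple_idx j] in
  let cl := cohom_class e 1 in
  let br := @cohom_bracket _ _ _ e 1 1 in
  (~ isom_sl g 2 ->
     [/\ forall i, c i \in cocycles e 1%N /\ b i \in cocycles e 1%N,
         \dim (cohomology e 1) = (2 * n)%N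
       & basis_of (cohomology e 1)
           ([seq cl (c i) | i <- enum 'I_n] ++ [seq cl (b i) | i <- enum 'I_n])])
  /\
  (~ isom_sl g 2 -> ~ isom_sl g 3 ->
     forall i j : 'I_n,
       [/\ br (cl (c i)) (cl (c j)) = 0,
           br (cl (b i)) (cl (b j)) = 0
         & br (cl (c i)) (cl (b j)) = w_b i j *: cl (b j)]).
Proof.
move=> n e c b w_b cl br.
have [muP mu_top] := maximal_root_top mu_max.
have rank2 : ~ isom_sl g 2 -> forall i : 'I_n, exists i', i' != i.
  move=> nsl2 i; apply: contrapT => ni; apply: nsl2.
  apply: (@isom_sl2_rank1 _ _ D i) => i'; apply/eqP; apply: contrapT => /negP ii'.
  by apply: ni; exists i'.
have gammaE : (forall i : 'I_n, exists i', i' != i) -> forall i, val (gamma i) = mu_refl mu i.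
  move=> r2 i; rewrite gammaP.
  exact: (max_string_mu_refl g_simple muP mu_top r2 (mP i)).
split=> [/rank2 r2|/rank2 r2 nsl3 i j].
  have gE := gammaE r2.
  have B := generator_class_basis g_simple muP mu_top r2 gE.
  have BE : tval (codom_tuple (generator_class gamma)) =
      [seq cl (c i) | i <- enum 'I_n] ++ [seq cl (b i) | i <- enum 'I_n].
    by rewrite /= codomE enum_sum map_cat -!map_comp.
  split.
  - move=> i; split; first exact: c_cocycle.
    exact: (b_cocycle g_simple muP mu_top r2 gE).
  - by rewrite (size_basis B) card_sum card_ord mulSn mul1n.
  - by rewrite -BE.
have gE := gammaE r2.
split.
- exact: bracket_cc.
- exact: (bracket_bb g_simple muP mu_top r2 gE).
- exact: (bracket_cb g_simple muP mu_top r2 gE).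
Qed.
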